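(* Let $f=y\wedge\hat y:M\to O(n-r+1,r+1)/\bigl(O(n-r,r)\times O(1,1)\bigr)$ be a Lorentzian non-degenerate map. Then $f$ is a curved flat if and only if $y$ and $\hat y$ form a Darboux pair of timelike $(\pm)$-isothermic surfaces (i.e. both $(+)$-isothermic or both $(-)$-isothermic).
   Context: $\mathbb{R}^m_s$ is $\mathbb{R}^m$ with $\langle x,x\rangle=\sum_{i=1}^{m-s}x_i^2-\sum_{i=m-s+1}^m x_i^2$. Let $n-r\ge2$, $r\ge1$. $Q^n_r$ is the set of points $[x]\in\mathbb{R}P^{n+1}$ with $x\in\mathbb{R}^{n+2}_{r+1}\setminus\{0\}$, $\langle x,x\rangle=0$, with the conformal structure induced by $\langle\,,\rangle$. $M$ is a connected surface. Curved flats. Let $G/K$ be a symmetric space, $K$ the fixed subgroup of an involution $\sigma$ of $G$, and $\mathfrak g=\mathfrak k\oplus\mathfrak p$ the decomposition into the $+1$ and $-1$ eigenspaces of $\sigma$. An immersion $\phi:M\to G/K$ with (local) frame $F:M\to G$ and $F^{-1}dF=\alpha_{\mathfrak k}+\alpha_{\mathfrak p}$ is a curved flat if at each point the image of $\alpha_{\mathfrak p}$ is contained in an Abelian subalgebra of $\mathfrak g$ (equivalently $[\alpha_{\mathfrak p}\wedge\alpha_{\mathfrak p}]=0$). Here $G=O(n-r+1,r+1)$ is the orthogonal group of $\mathbb{R}^{n+2}_{r+1}$ and $K=O(n-r,r)\times O(1,1)$ is the subgroup commuting with the involution acting as $-1$ on a fixed 2-plane of signature $(1,1)$ and as $+1$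 on its orthogonal complement, so $G/K$ is the Grassmannian of 2-dimensional Lorentzian planes in $\mathbb{R}^{n+2}_{r+1}$. A map $f$ into $G/K$ defines a pair of maps $y,\hat y:M\to Q^n_r$, given by the two null lines of the plane $f(p)$; conversely $f=y\wedge\hat y$ is the plane spanned by $y$ and $\hat y$. $f$ is Lorentzian non-degenerate if both $y$ and $\hat y$ are Lorentzian (timelike) immersions. Isothermic surfaces and Darboux pairs. An immersion $y:M\to Q^n_r$ is timelike if $\langle dY,dY\rangle$ is a Lorentzian metric for local null lifts $Y$ ($[Y]=y$). Asymptotic coordinates $(u,v)$ satisfy $\langle Y_u,Y_u\rangle=\langle Y_v,Y_v\rangle=0$; the canonical lift satisfies $\langle Y_u,Y_v\rangle=\frac12$ (replace $v$ by $-v$ if $\langle Y_u,Y_v\rangle<0$; the coordinates $(u,v)$ and $(u,-v)$ are not distinguished). For the canonical lift, write $Y_{uu}=-\frac{s_1}{2}Y+\kappa_1$, $Y_{vv}=-\frac{s_2}{2}Y+\kappa_2$ with $s_i$ functions and $\kappa_i$ orthogonal to $\mathrm{Span}\{Y,Y_u,Y_v,Y_{uv}\}$. $y$ is $(\pm)$-isothermic if around each point there are asymptotic coordinates with $\kappa_1=\pm\kappa_2$ (adapted coordinates). Given a timelike $(\pm)$-isothermic surface $y$ with canonical lift $Y$ with respect to the adapted coordinate $(u,v)$, a timelike immersion $\hat y:M\to Q^n_r$ is a Darboux transform of $y$ if a local lift $\hat Y$ of $\hat y$ satisfies $\langle Y,\hat Y\rangle\ne0$, $\hat Y_u\in\mathrm{Span}\{\hat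 Y,Y,Y_v\}$ and $\hat Y_v\in\mathrm{Span}\{\hat Y,Y,Y_u\}$ (independent of the choice of lifts). Then $y,\hat y$ are called a Darboux pair. *)

(* Defs.v *)
(* "Smooth" means C^infinity throughout. *)
From HB Require Import structures.
From mathcomp Require Import all_boot all_order all_algebra.
From mathcomp Require Import all_classical all_reals all_analysis.

Set Implicit Arguments.
Unset Strict Implicit.
Unset Printing Implicit Defensive.

Import Order.TTheory GRing.Theory Num.Theory.
Import numFieldNormedType.Exports.

Local Open Scope classical_set_scope.
Local Open Scope ring_scope.

(** * Smooth surfaces *)

Definition iter_derive (R : realType) (W : normedModType R)
    (f : 'rV[R]_2 -> W) (vs : seq 'rV[R]_2) : 'rV[R]_2 -> W :=
  foldr (fun v (g : 'rV[R]_2 -> W) => fun x => 'D_v g x) f vs.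

(* C^infinity on O (used for open O): all iterated directional derivatives
   are Frechet differentiable, hence continuous, at every point of O. *)
Definition smooth_on (R : realType) (W : normedModType R)
    (O : set 'rV[R]_2) (f : 'rV[R]_2 -> W) : Prop :=
  forall (vs : seq 'rV[R]_2) (x : 'rV[R]_2),
    O x -> differentiable (iter_derive f vs) x.

(* Charts are total functions; [cmap] is meaningful on [cdom] only and [cinv]
   on [crange] only. *)
Record chart (R : realType) (M : topologicalType) := Chart {
  cdom : set M;
  cmap : M -> 'rV[R]_2;
  cinv : 'rV[R]_2 -> M }.

Definition crange (R : realType) (M : topologicalType) (c : chart R M) :
  set 'rV[R]_2 := cmap c @` cdom c.

Definition is_chart (R : realType) (M : topologicalType) (c : chart R M) :
    Prop :=
  [/\ open (cdom c), open (crange c),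
      forall p, cdom c p -> cinv c (cmap c p) = p,
      forall p, cdom c p -> {for p, continuous (cmap c)} &
      forall x, crange c x -> {for x, continuous (cinv c)}].

Definition smooth_transition (R : realType) (M : topologicalType)
    (c d : chart R M) : Prop :=
  smooth_on (cmap c @` (cdom c `&` cdom d)) (cmap d \o cinv c).

Definition compatible (R : realType) (M : topologicalType) (c d : chart R M) :
    Prop :=
  smooth_transition c d /\ smooth_transition d c.

(* As the atlas is maximal, its members are exactly the local coordinate
   systems (u, v) of the surface. *)
Record surface (R : realType) := Surface {
  points :> topologicalType;
  atlas : set (chart R points);
  surface_hausdorff : hausdorff_space points;
  surface_second_countable : @second_countable points;
  atlas_chart : forall c, atlas c -> is_chart c;
  atlas_cover : forall p : points, exists2 c, atlas c & cdom c p;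
  atlas_compatible : forall c d, atlas c -> atlas d -> compatible c d;
  atlas_maximal : forall c, is_chart c ->
    (forall d, atlas d -> compatible c d) -> atlas c }.

Definition smooth_fun (R : realType) (M : surface R) (W : normedModType R)
    (U : set M) (g : M -> W) : Prop :=
  forall c : chart R M, atlas c ->
    smooth_on (cmap c @` (cdom c `&` U)) (g \o cinv c).

(* dg_p(X), where the tangent vector X at p has components a in the chart c. *)
Definition dchart (R : realType) (M : surface R) (W : normedModType R)
    (c : chart R M) (a : 'rV[R]_2) (g : M -> W) (p : M) : W :=
  'D_a (g \o cinv c) (cmap c p).

Definition du (R : realType) (M : surface R) (W : normedModType R)
    (c : chart R M) (g : M -> W) : M -> W :=
  dchart c (delta_mx 0 0) g.

Definition dv (R : realType) (M : surface R) (W : normedModType R)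
    (c : chart R M) (g : M -> W) : M -> W :=
  dchart c (delta_mx 0 1) g.

(** * The pseudo-Euclidean space, the quadric and the Grassmannian *)

(* The inner product of R^m_s: the last s coordinates are negative. *)
Definition ip (R : realType) (m s : nat) (x y : 'cV[R]_m) : R :=
  \sum_(i < m) (-1) ^+ (m - s <= i)%N * x i 0 * y i 0.

(* The symmetric bilinear form B has signature (1,1) on the 2-dimensional
   space P: there is an orthonormal basis of P of signature (+,-). *)
Definition lorentzian (R : realType) (V : Type) (B : V -> V -> R)
    (P : V -> Prop) : Prop :=
  exists x1 x2 : V, [/\ P x1, P x2, B x1 x1 = 1, B x2 x2 = -1 & B x1 x2 = 0].

(* Points of RP^(n+1) are lines in R^(n+2)_(r+1); those of Q^n_r are the null
   lines. *)
Record quadric (R : realType) (n r : nat) := Quadric {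
  qline :> {vspace 'cV[R]_n.+2};
  qline_dim : \dim qline = 1%N;
  qline_null : forall x, x \in qline -> ip r.+1 x x = 0 }.

(* The Grassmannian of Lorentzian 2-planes of R^(n+2)_(r+1), identified with
   O(n-r+1,r+1) / (O(n-r,r) x O(1,1)) by g K |-> g(P0), where P0 is
   [base_plane] below. *)
Record lorentz_plane (R : realType) (n r : nat) := LorentzPlane {
  lplane :> {vspace 'cV[R]_n.+2};
  lplane_dim : \dim lplane = 2%N;
  lplane_lorentzian : lorentzian (ip r.+1) (fun x => x \in lplane) }.

(** * Timelike surfaces in the quadric *)

(* A smooth local lift on the open set U; it is automatically null. *)
Definition local_lift (R : realType) (M : surface R) (n r : nat)
    (y : M -> quadric R n r) (U : set M) (Y : M -> 'cV[R]_n.+2) : Prop :=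
  [/\ open U, smooth_fun U Y &
      forall p, U p -> Y p != 0 /\ (<[Y p]>%VS = y p)].

Definition smooth_quadric (R : realType) (M : surface R) (n r : nat)
    (y : M -> quadric R n r) : Prop :=
  forall p, exists U Y, U p /\ local_lift y U Y.

(* Injectivity of dy: the tangent space of RP^(n+1) at [Y] is, up to a line
   factor, R^(n+2) / <[Y]>. *)
Definition immersion_quadric (R : realType) (M : surface R) (n r : nat)
    (y : M -> quadric R n r) : Prop :=
  smooth_quadric y /\
  forall U Y c p a, local_lift y U Y -> atlas c -> U p -> cdom c p ->
    dchart c a Y p \in <[Y p]>%VS -> a = 0.

Definition timelike_immersion (R : realType) (M : surface R) (n r : nat)
    (y : M -> quadric R n r) : Prop :=
  immersion_quadric y /\
  forall U Y c p, local_lift y U Y -> atlas c -> U p -> cdom c p ->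
    lorentzian (fun a b => ip r.+1 (dchart c a Y p) (dchart c b Y p))
      (fun _ : 'rV[R]_2 => True).

(** * Curved flats *)

(* G = O(n-r+1, r+1) *)
Definition in_G (R : realType) (n r : nat) (g : 'M[R]_n.+2) : Prop :=
  forall x y : 'cV[R]_n.+2, ip r.+1 (g *m x) (g *m y) = ip r.+1 x y.

Definition in_g (R : realType) (n r : nat) (X : 'M[R]_n.+2) : Prop :=
  forall x y : 'cV[R]_n.+2, ip r.+1 (X *m x) y + ip r.+1 x (X *m y) = 0.

Definition lie (R : realType) (n : nat) (X Y : 'M[R]_n) : 'M[R]_n :=
  X *m Y - Y *m X.

Definition abelian_subalgebra (R : realType) (n r : nat)
    (A : {vspace 'M[R]_n.+2}) : Prop :=
  [/\ forall X, X \in A -> in_g r X,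
      forall X Y, X \in A -> Y \in A -> lie X Y \in A &
      forall X Y, X \in A -> Y \in A -> lie X Y = 0].

(* The plane spanned by the first (positive) and the last (negative) vector of
   the standard basis. *)
Definition base_plane (R : realType) (n : nat) : {vspace 'cV[R]_n.+2} :=
  (<[delta_mx ord0 ord0]> + <[delta_mx ord_max ord0]>)%VS.

(* -1 on [base_plane], +1 on its orthogonal complement. *)
Definition base_involution (R : realType) (n : nat) : 'M[R]_n.+2 :=
  \matrix_(i, j) (if i == j then
                    if (i == ord0) || (i == ord_max) then -1 else 1
                  else 0).

(* K is the fixed subgroup of [sigma]. *)
Definition sigma (R : realType) (n : nat) (g : 'M[R]_n.+2) : 'M[R]_n.+2 :=
  base_involution R n *m g *m base_involution R n.

(* The component in the -1-eigenspace p of (the differential of) [sigma]. *)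
Definition p_part (R : realType) (n : nat) (X : 'M[R]_n.+2) : 'M[R]_n.+2 :=
  2^-1 *: (X - sigma X).

(* F : U -> G smooth, such that F K = f. *)
Definition local_frame (R : realType) (M : surface R) (n r : nat)
    (f : M -> lorentz_plane R n r) (U : set M) (F : M -> 'M[R]_n.+2) : Prop :=
  [/\ open U, smooth_fun U F &
      forall p, U p -> in_G r (F p) /\
        (linfun (mulmx (F p)) @: base_plane R n)%VS = f p].

Definition alpha (R : realType) (M : surface R) (n : nat)
    (F : M -> 'M[R]_n.+2) (c : chart R M) (a : 'rV[R]_2) (p : M) :
    'M[R]_n.+2 :=
  invmx (F p) *m dchart c a F p.

Definition alpha_p (R : realType) (M : surface R) (n : nat)
    (F : M -> 'M[R]_n.+2) (c : chart R M) (a : 'rV[R]_2) (p : M) :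
    'M[R]_n.+2 :=
  p_part (alpha F c a p).

(* G -> G/K is a principal bundle, so the smooth maps into G/K are those with
   smooth local frames. *)
Definition smooth_grass (R : realType) (M : surface R) (n r : nat)
    (f : M -> lorentz_plane R n r) : Prop :=
  forall p, exists U F, U p /\ local_frame f U F.

(* Under T(G/K) = G x_K p, the differential of f = F K is (F, alpha_p). *)
Definition immersion_grass (R : realType) (M : surface R) (n r : nat)
    (f : M -> lorentz_plane R n r) : Prop :=
  smooth_grass f /\
  forall U F c p a, local_frame f U F -> atlas c -> U p -> cdom c p ->
    alpha_p F c a p = 0 -> a = 0.

Definition curved_flat (R : realType) (M : surface R) (n r : nat)
    (f : M -> lorentz_plane R n r) : Prop :=
  immersion_grass f /\
  forall U F c p, local_frame f U F -> atlas c -> U p -> cdom c p ->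
    exists2 A : {vspace 'M[R]_n.+2}, abelian_subalgebra r A &
      forall a, alpha_p F c a p \in A.

(** * Isothermic surfaces and Darboux pairs *)

Definition asymptotic_coords (R : realType) (M : surface R) (n r : nat)
    (c : chart R M) (Y : M -> 'cV[R]_n.+2) : Prop :=
  forall p, cdom c p ->
    ip r.+1 (du c Y p) (du c Y p) = 0 /\ ip r.+1 (dv c Y p) (dv c Y p) = 0.

(* c is an asymptotic coordinate system for y, oriented so that
   <Y_u,Y_v> > 0, and Y is the canonical lift. *)
Definition canonical_lift (R : realType) (M : surface R) (n r : nat)
    (y : M -> quadric R n r) (c : chart R M) (Y : M -> 'cV[R]_n.+2) : Prop :=
  [/\ atlas c, local_lift y (cdom c) Y, asymptotic_coords r c Y &
      forall p, cdom c p -> ip r.+1 (du c Y p) (dv c Y p) = 2^-1].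

Definition ortho_frame (R : realType) (M : surface R) (n r : nat)
    (c : chart R M) (Y : M -> 'cV[R]_n.+2) (p : M) (k : 'cV[R]_n.+2) : Prop :=
  forall x,
    x \in (<[Y p]> + <[du c Y p]> + <[dv c Y p]> + <[du c (dv c Y) p]>)%VS ->
    ip r.+1 k x = 0.

(* The sign is encoded by b : bool as (-1) ^+ b: false is (+), true is (-). *)
Definition adapted (R : realType) (M : surface R) (n r : nat) (b : bool)
    (y : M -> quadric R n r) (c : chart R M) (Y : M -> 'cV[R]_n.+2) : Prop :=
  canonical_lift y c Y /\
  exists (s1 s2 : M -> R) (k1 k2 : M -> 'cV[R]_n.+2),
    forall p, cdom c p ->
      [/\ du c (du c Y) p = - (s1 p / 2) *: Y p + k1 p,
          dv c (dv c Y) p = - (s2 p / 2) *: Y p + k2 p,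
          ortho_frame r c Y p (k1 p), ortho_frame r c Y p (k2 p) &
          k1 p = (-1) ^+ b *: k2 p].

Definition isothermic (R : realType) (M : surface R) (n r : nat) (b : bool)
    (y : M -> quadric R n r) : Prop :=
  timelike_immersion y /\
  forall p, exists c Y, cdom c p /\ adapted b y c Y.

Definition darboux_transform (R : realType) (M : surface R) (n r : nat)
    (b : bool) (y yh : M -> quadric R n r) : Prop :=
  [/\ isothermic b y, timelike_immersion yh &
      forall p, exists c Y Yh,
        [/\ cdom c p, adapted b y c Y, local_lift yh (cdom c) Yh &
          forall q, cdom c q ->
            [/\ ip r.+1 (Y q) (Yh q) != 0,
                du c Yh q \in (<[Yh q]> + <[Y q]> + <[dv c Y q]>)%VS &
                dv c Yh q \in (<[Yh q]> + <[Y q]> + <[du c Y q]>)%VS]]].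

(* Main.v *)
Require Import Defs.
From HB Require Import structures.
From mathcomp Require Import all_boot all_order all_algebra.
From mathcomp Require Import all_classical all_reals all_analysis.
From mathcomp Require Import ring lra.
Import Order.TTheory GRing.Theory Num.Theory.
Import numFieldNormedType.Exports.
Set Implicit Arguments.
Unset Strict Implicit.
Unset Printing Implicit Defensive.
Local Open Scope classical_set_scope.
Local Open Scope ring_scope.


(** Let Y and Yh be null lifts of y and yh, and for a tangent vector a let
    N_a, Nh_a be the components of dY(a), dYh(a) orthogonal to the plane
    spanned by Y and Yh. In a frame F these are F (X_a eta) and F (X_a etah),
    where X_a is the p-part of the Maurer-Cartan form and eta, etah span the
    fixed plane ([frame_tangent]). As elements of p exchange the plane with
    its complement, X_a and X_b commute if and only if

      <N_a, Nh_b> = <N_b, Nh_a>  and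
      <w, Nh_b> N_a + <w, N_b> Nh_a = <w, Nh_a> N_b + <w, N_a> Nh_b

    for all w orthogonal to the plane ([lie_flat]). The proof is about these
    two equations, called flatness below ([flat_at]).

    Flatness implies the Darboux property. Let e1, e2 be the null directions
    of the Lorentzian metric <dY, dY>. Flatness forces Nh_1 to be a multiple
    of N_2 and Nh_2 a multiple of N_1 ([flat_null_frame]), so the quadratic
    form q(a) = <N_a, Nh_a> / <Y, Yh>, which does not depend on the lifts, is
    diagonal in e1, e2, and it is non-degenerate because yh is an immersion.
    One rescales e1 and e2 to q(e_i) = s_i = 1 or -1, and the lifts to
    <Y_1, Y_2> = 1/2 and <Y, Yh> = 1 ([flat_model]). Computing the second
    derivatives of Yh along e1, e2 in both orders then gives at the same time
    [e1, e2] = 0 and that s2 Y_11 - s1 Y_22 lies in the span of Y and Yh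
    ([canonical_frame_commutes]). The frame dual to a commuting frame consists
    of closed 1-forms; their primitives are coordinates by the inverse function
    theorem ([commuting_frame_coordinates]), so e1, e2 are the coordinate
    fields of asymptotic coordinates in which Y is the canonical lift. The
    structure equations Nh_1 = 2 s1 N_2, Nh_2 = 2 s2 N_1 are the Darboux
    relations, and the relation between Y_11 and Y_22 becomes
    kappa_1 = s1 s2 kappa_2 since kappa_1 and kappa_2 are orthogonal to Y and
    Y_uv ([adapted_kappa]). The equations of flatness are symmetric in y and
    yh, so yh is isothermic too.

    The sign s1 s2 is -1 exactly when q has a nontrivial zero. This is a
    condition on the point alone, so the sign is locally constant, hence
    constant because the surface is connected ([curved_flat_global_sign]),
    and it is the same for y and yh because q is symmetric in them.

    Conversely, the Darboux relations say that Nh_u is a multiple of N_v and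
    Nh_v a multiple of N_u; as N_u and N_v are null, flatness in the adapted
    coordinates is an identity ([flat_vec_null]). Flatness means that the
    values X_a commute, whatever the chart, so these span an Abelian
    subalgebra ([darboux_curved_flat]). *)

(** * Differentiable maps between normed spaces *)

Section Differentiability.
Context {R : realType}.
Implicit Types U V W : normedModType R.

(** The differentials of functions with continuous partial derivatives and
    of inverse functions are found by estimates, for which the remainder is
    wanted with explicit constants instead of Landau symbols. *)
Lemma differentiable_epsP V W (f : V -> W) x (L : {linear V -> W}) :
  continuous L ->
  (forall e, 0 < e -> \forall h \near 0, `|f (h + x) - f x - L h| <= e * `|h|) ->
  is_diff x f L.
Proof.
move=> cL eL.
have fL : f \o shift x = cst (f x) + L +o_ 0 id.
  apply/eqaddoP => e e0; near=> h => /=.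
  have -> : ((f \o shift x) - (cst (f x) + L)) h = f (h + x) - f x - L h.
    by rewrite !fctE /= opprD addrA.
  by near: h; exact: eL.
have dE := diff_unique cL fL.
apply: DiffDef => //; apply/diff_locallyP; rewrite dE; split => //.
Unshelve. all: by end_near. Qed.

Lemma differentiable_eps V W (f : V -> W) x : differentiable f x ->
  forall e, 0 < e ->
    \forall h \near 0, `|f (h + x) - f x - 'd f x h| <= e * `|h|.
Proof.
move=> /diff_locallyP[_ /eqaddoP fo] e e0.
near=> h; have -> : f (h + x) - f x - 'd f x h =
   ((f \o shift x) - (cst (f x) + 'd f x)) h.
  by rewrite !fctE /= opprD addrA.
by near: h; exact: fo.
Unshelve. all: by end_near. Qed.

Lemma near_eq_differentiable V W (f g : V -> W) x :
  (\forall z \near x, f z = g z) -> differentiable f x -> differentiable g x.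
Proof.
move=> fg df; suff : is_diff x g ('d f x) by move=> [].
apply: differentiable_epsP => [|e e0]; first exact: diff_continuous.
have fg' : \forall h \near 0, f (h + x) = g (h + x).
  by move: fg; rewrite (near_shift 0) subr0.
rewrite -(nbhs_singleton fg); near=> h.
have <- : f (h + x) = g (h + x) by near: h.
by near: h; exact: differentiable_eps.
Unshelve. all: by end_near. Qed.

Lemma differentiable_mxP V m n (M : V -> 'M[R]_(m, n)) x :
  differentiable M x <-> forall i j, differentiable (fun z => M z i j) x.
Proof.
split=> [dM i j|dM].
  exact: (differentiable_comp dM (differentiable_coord _ i j)).
pose f (i : 'I_m) (j : 'I_n) := fun z => M z i j *: (delta_mx i j : 'M[R]_(m, n)).
have -> : M = \sum_(i < m) \sum_(j < n) f i j.
  apply/funext => z; rewrite [LHS]matrix_sum_delta fct_sumE.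
  by apply: eq_bigr => i _; rewrite fct_sumE.
apply: differentiable_sum => i; apply: differentiable_sum => j.
exact: differentiableZl.
Qed.

Lemma derive_mxE V m n (M : V -> 'M[R]_(m, n)) x v i j : derivable M x v ->
  ('D_v M x) i j = 'D_v (fun z => M z i j) x.
Proof. by move=> dM; rewrite derive_mx// mxE. Qed.

Lemma derive_chain U V W (f : V -> W) (g : U -> V) x v :
  differentiable g x -> differentiable f (g x) ->
  'D_v (f \o g) x = 'D_('D_v g x) f (g x).
Proof.
move=> dg df; rewrite !deriveE //; last exact: differentiable_comp.
by rewrite diff_comp.
Qed.

Lemma derive_lin V W (f : V -> W) x a v w : differentiable f x ->
  'D_(a *: v + w) f x = a *: 'D_v f x + 'D_w f x.
Proof. by move=> df; rewrite !deriveE// linearP. Qed.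

Lemma deriveZv V W (f : V -> W) x a v : differentiable f x ->
  'D_(a *: v) f x = a *: 'D_v f x.
Proof. by move=> df; rewrite !deriveE// linearZ. Qed.

Lemma ord2E (j : 'I_2) : (j = 0) \/ (j = 1).
Proof. by case: j => [[|[|m]] hm] //; [left|right]; apply: val_inj. Qed.

Lemma rV2E (v : 'rV[R]_2) : v = v 0 0 *: delta_mx 0 0 + v 0 1 *: delta_mx 0 1.
Proof.
by apply/rowP => j; rewrite !mxE; case: (ord2E j) => -> /=;
  rewrite ?(mulr1, mulr0, addr0, add0r).
Qed.

Lemma derive_coord2 W (f : 'rV[R]_2 -> W) x v : differentiable f x ->
  'D_v f x = v 0 0 *: 'D_(delta_mx 0 0) f x + v 0 1 *: 'D_(delta_mx 0 1) f x.
Proof. by move=> df; rewrite {1}[v]rV2E derive_lin// deriveZv. Qed.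

Lemma open_nbhs_near (T : topologicalType) (O : set T) x (P : T -> Prop) :
  open O -> O x -> (forall z, O z -> P z) -> \forall z \near x, P z.
Proof.
move=> oO Ox OP; have : \forall z \near x, O z by apply: open_nbhs_nbhs.
exact: filterS.
Qed.

End Differentiability.

(** * Smooth functions on open subsets of the plane *)

Section Ck.
Context {R : realType}.
Local Notation V := 'rV[R]_2.

(** Being smooth is not inductive in the function, because the list of
    directions varies; a finite order of differentiability is, and closure
    under each operation follows by induction on it. *)
Fixpoint Ck (W : normedModType R) (k : nat) (O : set V) (f : V -> W) : Prop :=
  if k is k'.+1 then
    (forall x, O x -> differentiable f x) /\
    (forall v, Ck k' O (fun x => 'D_v f x))
  else True.

Lemma smooth_onP (W : normedModType R) (O : set V) (f : V -> W) :
  smooth_on O f <-> forall k, Ck k O f.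
Proof.
split=> [sf k|Cf vs].
  elim: k f sf => //= k IH f sf; split=> [x Ox|v]; first exact: (sf [::] x Ox).
  by apply: IH => vs x Ox; have := sf (rcons vs v) x Ox; rewrite /iter_derive foldr_rcons.
elim/last_ind: vs f Cf => [|vs v IH] f Cf x Ox; first exact: (Cf 1%N).1.
rewrite /iter_derive foldr_rcons; apply: IH => // k.
exact: (Cf k.+1).2.
Qed.

Lemma Ck_ext (W : normedModType R) k (O : set V) (f g : V -> W) :
  open O -> (forall x, O x -> f x = g x) -> Ck k O f -> Ck k O g.
Proof.
move=> oO; elim: k f g => //= k IH f g fg [df Df].
have nfg x : O x -> \forall z \near x, f z = g z.
  by move=> Ox; exact: open_nbhs_near fg.
split=> [x Ox|v]; first by apply: near_eq_differentiable (df _ Ox); exact: nfg.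
apply: IH (Df v) => x Ox; apply: near_eq_derive; exact: nfg.
Qed.

Lemma Ck_sub (W : normedModType R) k (O O' : set V) (f : V -> W) :
  O' `<=` O -> Ck k O f -> Ck k O' f.
Proof.
move=> OO; elim: k f => //= k IH f [df Df].
by split=> [x /OO /df //|v]; apply: IH.
Qed.

Lemma CkW (W : normedModType R) k (O : set V) (f : V -> W) :
  Ck k.+1 O f -> Ck k O f.
Proof.
by elim: k f => //= k IH f [df Df]; split => // v; apply: IH; exact: Df.
Qed.

Lemma Ck_cst (W : normedModType R) k (O : set V) (a : W) : Ck k O (fun=> a).
Proof.
elim: k a => //= k IH a; split => [x _|v]; first exact: differentiable_cst.
by have -> : (fun x => 'D_v (fun=> a) x) = fun=> 0 by apply/funext => x; exact: derive_cst.
Qed.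

Lemma CkD (W : normedModType R) k (O : set V) (f g : V -> W) : open O ->
  Ck k O f -> Ck k O g -> Ck k O (fun x => f x + g x).
Proof.
move=> oO; elim: k f g => //= k IH f g [df Df] [dg Dg].
split=> [x Ox|v]; first by apply: differentiableD; [exact: df|exact: dg].
apply: (Ck_ext oO) (IH _ _ (Df v) (Dg v)) => x Ox.
by rewrite -deriveD//; apply: diff_derivable; [exact: df|exact: dg].
Qed.

Lemma Ck_sum (W : normedModType R) k (O : set V) (I : Type) (s : seq I)
    (P : pred I) (f : I -> V -> W) : open O ->
  (forall i, Ck k O (f i)) -> Ck k O (fun x => \sum_(i <- s | P i) f i x).
Proof.
move=> oO Cf; elim: s => [|i s IH].
  have -> : (fun x => \sum_(i <- [::] | P i) f i x) = fun=> 0.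
    by apply/funext => x; rewrite big_nil.
  exact: Ck_cst.
under eq_fun do rewrite big_cons.
by case: (P i) => //; exact: CkD.
Qed.

Lemma CkM k (O : set V) (f g : V -> R) : open O ->
  Ck k O f -> Ck k O g -> Ck k O (fun x => f x * g x).
Proof.
move=> oO; elim: k f g => //= k IH f g Cf Cg.
have [df Df] := Cf; have [dg Dg] := Cg.
split=> [x Ox|v]; first by apply: differentiableM; [exact: df|exact: dg].
apply: (@Ck_ext _ _ _ (fun x => f x * 'D_v g x + g x * 'D_v f x)) => // [x Ox|].
  apply/esym; exact: (deriveM (diff_derivable (df _ Ox)) (diff_derivable (dg _ Ox))).
by apply: CkD => //; apply: IH => //; apply: CkW.
Qed.

Lemma Ck_mulc k (O : set V) (c : R) (f : V -> R) : open O ->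
  Ck k O f -> Ck k O (fun x => c * f x).
Proof. by move=> oO Cf; apply: CkM => //; exact: Ck_cst. Qed.

Lemma CkN k (O : set V) (f : V -> R) : open O ->
  Ck k O f -> Ck k O (fun x => - f x).
Proof.
move=> oO Cf; under eq_fun do rewrite -mulN1r.
exact: Ck_mulc.
Qed.

Lemma CkB k (O : set V) (f g : V -> R) : open O ->
  Ck k O f -> Ck k O g -> Ck k O (fun x => f x - g x).
Proof. by move=> oO Cf Cg; apply: CkD => //; exact: CkN. Qed.

(** The derivative of 1/f is -f'/f^2, which only involves f' and
    1/f itself, so the order of 1/f grows by induction up to that of f. *)
Lemma CkV k (O : set V) (f : V -> R) : open O ->
  (forall x, O x -> f x != 0) -> Ck k O f -> Ck k O (fun x => (f x)^-1).
Proof.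
move=> oO f0; elim: k => //= k IH Cf; have [df Df] := Cf.
have dfx x v : O x -> derivable f x v by move=> /df /diff_derivable.
split=> [x Ox|v].
  by apply: differentiableV; [exact: df|exact: f0].
apply: (@Ck_ext _ _ _ (fun x => - ((f x)^-1 * (f x)^-1) * 'D_v f x)) => // [x Ox|].
  by rewrite (deriveV (f0 _ Ox) (dfx _ v Ox)) -exprVn expr2.
have Ci := IH (CkW Cf).
by apply: CkM => //; apply: CkN => //; exact: CkM.
Qed.

(** As for the inverse: the derivative f'/(2 sqrt f) involves only f' and
    sqrt f itself. *)
Lemma Ck_sqrt k (O : set V) (f : V -> R) : open O ->
  (forall x, O x -> 0 < f x) -> Ck k O f -> Ck k O (fun x => Num.sqrt (f x)).
Proof.
move=> oO f0; elim: k => //= k IH Cf; have [df Df] := Cf.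
have ds x : O x -> differentiable (Num.sqrt : R -> R) (f x).
  move=> Ox; apply/derivable1_diffP.
  by have [] := is_derive1_sqrt (f0 _ Ox).
split=> [x Ox|v].
  exact: (differentiable_comp (df _ Ox) (ds _ Ox)).
apply: (@Ck_ext _ _ _ (fun x => (2 * Num.sqrt (f x))^-1 * 'D_v f x)) => // [x Ox|].
  rewrite -[RHS]/('D_v (Num.sqrt \o f) x) (derive_chain _ (df _ Ox) (ds _ Ox)).
  have := deriveZv ('D_v f x) (1 : R) (ds _ Ox); rewrite [_ *: 1]mulr1 => ->.
  by rewrite derive_sqrt ?f0// [RHS]mulrC.
have Ci := IH (CkW Cf).
apply: CkM => //; apply: CkV => // [x Ox|]; last exact: Ck_mulc.
by rewrite mulf_neq0// lt0r_neq0// sqrtr_gt0 f0.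
Qed.

Lemma Ck_mxP k m n (O : set V) (M : V -> 'M[R]_(m, n)) : open O ->
  Ck k O M <-> forall i j, Ck k O (fun x => M x i j).
Proof.
move=> oO; elim: k M => [|k IH] M; first by split.
split=> [[dM DM] i j|CM].
  split=> [x Ox|v]; first by move: i j; apply/differentiable_mxP; exact: dM.
  apply: (Ck_ext oO) (((IH _).1 (DM v)) i j) => x Ox.
  by rewrite derive_mxE//; apply: diff_derivable; exact: dM.
have dM x : O x -> differentiable M x.
  by move=> Ox; apply/differentiable_mxP => i j; exact: (CM i j).1.
split=> // v; apply/IH => i j; apply: (Ck_ext oO) ((CM i j).2 v) => x Ox.
by rewrite derive_mxE//; apply: diff_derivable; exact: dM.
Qed.

Lemma Ck_scale k m n (O : set V) (a : V -> R) (M : V -> 'M[R]_(m, n)) : open O ->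
  Ck k O a -> Ck k O M -> Ck k O (fun x => a x *: M x).
Proof.
move=> oO Ca /(Ck_mxP _ _ oO) CM; apply/Ck_mxP => // i j.
by under eq_fun do rewrite mxE; exact: CkM.
Qed.

(** By the chain rule the derivative of f o g is a combination of first
    partial derivatives of f, composed with g, whose coefficients are
    derivatives of g; the induction applies to these composites. *)
Lemma Ck_comp_scalar k (O O' : set V) (g : V -> V) (f : V -> R) :
  open O -> (forall x, O x -> O' (g x)) ->
  Ck k O g -> Ck k O' f -> Ck k O (f \o g).
Proof.
move=> oO gO; elim: k f => //= k IH f Cg Cf; have [dg Dg] := Cg; have [df Df] := Cf.
split=> [x Ox|v].
  by apply: differentiable_comp; [exact: dg|apply: df; exact: gO].
pose F x := ('D_v g x) 0 0 * 'D_(delta_mx 0 0) f (g x) +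
            ('D_v g x) 0 1 * 'D_(delta_mx 0 1) f (g x).
apply: (@Ck_ext _ _ _ F) => // [x Ox|].
  have dfg : differentiable f (g x) by apply: df; exact: gO.
  by rewrite (derive_chain _ (dg _ Ox) dfg) [RHS]derive_coord2.
have Cgi i j : Ck k O (fun x => ('D_v g x) i j) by move: i j; apply/Ck_mxP.
by apply: CkD => //; apply: CkM => //; exact: (IH _ (CkW Cg) (Df _)).
Qed.

Lemma Ck_comp k m n (O O' : set V) (g : V -> V) (f : V -> 'M[R]_(m, n)) :
  open O -> open O' -> (forall x, O x -> O' (g x)) ->
  Ck k O g -> Ck k O' f -> Ck k O (f \o g).
Proof.
move=> oO oO' gO Cg /(Ck_mxP _ _ oO') Cf; apply/Ck_mxP => // i j.
exact: (Ck_comp_scalar oO gO Cg (Cf i j)).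
Qed.

Lemma Ck_id k (O : set V) : open O -> Ck k O id.
Proof.
case: k => //= k oO; split=> [x Ox|v]; first by [].
have -> : (fun x => 'D_v id x) = (fun=> v) :> (V -> V) by apply/funext => x; exact: derive_id.
exact: Ck_cst.
Qed.

Lemma Ck_continuous (W : normedModType R) (O : set V) (f : V -> W) x :
  Ck 1 O f -> O x -> {for x, continuous f}.
Proof. by move=> [df _] Ox; apply: differentiable_continuous; exact: df. Qed.

End Ck.

(** * Symmetry of second derivatives *)

Section MeanValue.
Context {R : realType} (V : normedModType R).
Implicit Types (f : V -> R) (v w x a : V).

(** Restricting f to a line turns directional derivatives into derivatives
    in one variable, to which the mean value theorem applies. *)
Lemma derivable_line (W : normedModType R) (f : V -> W) a v (t : R) :
  derivable f (a + t *: v) v ->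
  is_derive t 1 (fun s : R => f (a + s *: v)) ('D_v f (a + t *: v)).
Proof.
move=> df.
have E : (fun h : R => h^-1 *: (((fun s => f (a + s *: v)) \o shift t) (h *: (1 : R)) - f (a + t *: v))) =
    (fun h : R => h^-1 *: ((f \o shift (a + t *: v)) (h *: v) - f (a + t *: v))).
  apply/funext => h /=; congr (_ *: (f _ - _)).
  by rewrite [h *: (1 : R)]mulr1 scalerDl addrCA.
by split; rewrite /derivable /derive E.
Qed.

Lemma MVT_line f a v (s : R) :
  (forall t : R, 0 <= t <= 1 -> derivable f (a + (t * s) *: v) v) ->
  exists2 t : R, 0 <= t <= 1 & f (a + s *: v) - f a = s * 'D_v f (a + (t * s) *: v).
Proof.
move=> df; pose phi t := f (a + t *: v).
have dpsi (t : R) : 0 <= t <= 1 ->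
    is_derive t 1 (fun t => phi (t * s)) (s * 'D_v f (a + (t * s) *: v)).
  move=> /df /derivable_line dphi.
  have dl : is_derive t 1 (fun t : R => t * s) s.
    have -> : (fun t : R => t * s) = s *: (id : R -> R).
      by apply/funext => u; rewrite !fctE [RHS]mulrC.
    by apply: is_derive_eq; rewrite [LHS]mulr1.
  have d1 : differentiable (fun t : R => t * s) t by apply/derivable1_diffP; case: dl.
  have d2 : differentiable phi (t * s) by apply/derivable1_diffP; case: dphi.
  split; first exact/diff_derivable/(differentiable_comp d1 d2).
  rewrite -[LHS]/('D_1 (phi \o (fun t => t * s)) t) derive_chain// derive_val.
  by rewrite -[s in 'D_s _ _]mulr1 [LHS](deriveZv _ _ d2) [in LHS]derive_val.
have [||t t01] := @MVT _ (fun t => phi (t * s)) (fun t => s * 'D_v f (a + (t * s) *: v)) 0 1 ltr01.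
- by move=> t; rewrite in_itv/= => /andP[t0 t1]; apply: dpsi; rewrite !ltW.
- by apply: derivable_within_continuous => t; rewrite in_itv/= => /dpsi[].
rewrite /phi mul1r mul0r scale0r addr0 subr0 mulr1 => ->.
by exists t => //; move: t01; rewrite in_itv/= => /andP[/ltW-> /ltW->].
Qed.

Lemma MVT_lineZ f a v (s : R) :
  (forall t : R, 0 <= t <= 1 -> differentiable f (a + (t * s) *: v)) ->
  exists2 t : R, 0 <= t <= 1 & f (a + s *: v) - f a = s * 'D_v f (a + (t * s) *: v).
Proof. by move=> df; apply: MVT_line => t /df /diff_derivable. Qed.

(** The mean value theorem along v, applied to z |-> f (z + s w) - f z, and
    then along w. *)
Lemma second_difference f x v w (s : R) :
  (forall t t' : R, 0 <= t <= 1 -> 0 <= t' <= 1 ->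
    differentiable f (x + (t * s) *: v + (t' * s) *: w) /\
    differentiable ('D_v f) (x + (t * s) *: v + (t' * s) *: w)) ->
  exists t t' : R, [/\ 0 <= t <= 1, 0 <= t' <= 1 &
    f (x + s *: v + s *: w) - f (x + s *: v) - (f (x + s *: w) - f x) =
      s * (s * 'D_w ('D_v f) (x + (t * s) *: v + (t' * s) *: w))].
Proof.
move=> df; have i0 : 0 <= (0 : R) <= 1 by rewrite lexx ler01.
have i1 : 0 <= (1 : R) <= 1 by rewrite lexx ler01.
pose g z := f (z + s *: w) - f z.
have dshift z : is_diff z (fun z : V => z + s *: w) id.
  have -> : (fun z : V => z + s *: w) = (id : V -> V) + cst (s *: w) by [].
  by apply: is_diff_eq; rewrite addr0.
have dg1 (t : R) : 0 <= t <= 1 -> differentiable (fun z => f (z + s *: w)) (x + (t * s) *: v).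
  move=> t01; apply: (@differentiable_comp _ _ _ _ (fun z => z + s *: w) f); first by case: (dshift (x + (t * s) *: v)).
  by have [] := df t 1 t01 i1; rewrite mul1r.
have dg2 (t : R) : 0 <= t <= 1 -> differentiable f (x + (t * s) *: v).
  by move=> t01; have [] := df t 0 t01 i0; rewrite mul0r scale0r addr0.
have dg (t : R) : 0 <= t <= 1 -> differentiable g (x + (t * s) *: v).
  by move=> t01; apply: differentiableB; [exact: dg1|exact: dg2].
have [t t01 gE] := @MVT_lineZ g x v s dg.
have [|t' t'01 hE] := @MVT_lineZ ('D_v f) (x + (t * s) *: v) w s.
  by move=> t' t'01; have [] := df t t' t01 t'01.
exists t, t'; split => //; rewrite -hE -[LHS]/(g (x + s *: v) - g x) gE; congr (_ * _).
rewrite /g [LHS](deriveB (diff_derivable (dg1 _ t01)) (diff_derivable (dg2 _ t01))); congr (_ - _).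
rewrite -[LHS]/('D_v (f \o (fun z => z + s *: w)) (x + (t * s) *: v)).
rewrite derive_chain; last 2 first.
- by case: (dshift (x + (t * s) *: v)).
- by have [] := df t 1 t01 i1; rewrite mul1r.
congr ('D_ _ f _); rewrite deriveE; last by case: (dshift (x + (t * s) *: v)).
by rewrite diff_val.
Qed.

(** The second difference does not depend on the order of the two steps; by
    [second_difference] it equals both mixed derivatives, divided by s^2, at
    points near x, and they agree in the limit by continuity. *)
Lemma derive_comm_scalar (O : set V) f v w x : open O -> O x ->
  (forall z, O z -> differentiable f z) ->
  (forall z, O z -> differentiable ('D_v f) z) ->
  (forall z, O z -> differentiable ('D_w f) z) ->
  {for x, continuous ('D_w ('D_v f))} -> {for x, continuous ('D_v ('D_w f))} ->
  'D_w ('D_v f) x = 'D_v ('D_w f) x.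
Proof.
move=> oO Ox df dv dw cA cB; apply/eqP; rewrite -subr_eq0 -normr_eq0.
rewrite eq_le normr_ge0 andbT; apply/ler_addgt0Pl => e e0; rewrite addr0.
have [e2 e2E] : exists e2, e2 + e2 = e /\ 0 < e2.
  by exists (e / 2); rewrite -splitr divr_gt0.
have /nbhs_ballP[d /= d0 dP] : \forall z \near x,
   [/\ O z, `|'D_w ('D_v f) x - 'D_w ('D_v f) z| < e2 &
       `|'D_v ('D_w f) x - 'D_v ('D_w f) z| < e2].
  have h1 : \forall z \near x, O z by exact: open_nbhs_nbhs.
  have h2 : \forall z \near x, `|'D_w ('D_v f) x - 'D_w ('D_v f) z| < e2.
    by move/cvgrPdist_lt : cA; apply; case: e2E.
  have h3 : \forall z \near x, `|'D_v ('D_w f) x - 'D_v ('D_w f) z| < e2.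
    by move/cvgrPdist_lt : cB; apply; case: e2E.
  by apply: filterS3 h1 h2 h3 => z.
(* the step keeps the whole parallelogram at x inside the ball of radius d *)
pose s := d / (`|v| + `|w| + 1).
have n0 : 0 < `|v| + `|w| + 1 by rewrite ltr_wpDl ?addr_ge0.
have s0 : 0 < s by rewrite divr_gt0.
have inb (v' w' : V) (t t' : R) : `|v'| + `|w'| = `|v| + `|w| -> 0 <= t <= 1 -> 0 <= t' <= 1 ->
    ball x d (x + (t * s) *: v' + (t' * s) *: w').
  move=> vw /andP[t0 t1] /andP[t'0 t'1]; rewrite -ball_normE /ball_/=.
  rewrite -addrA opprD addNKr normrN.
  have nZ (r : R) (u : V) : 0 <= r -> `|(r * s) *: u| = r * s * `|u|.
    by move=> r0; rewrite (normrZ (r * s)) ger0_norm// mulr_ge0// ltW.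
  apply: (le_lt_trans (ler_normD _ _)); rewrite !nZ//.
  apply: (@le_lt_trans _ _ (s * (`|v| + `|w|))).
    rewrite -vw mulrDr lerD// ler_wpM2r// ler_piMl// ltW//.
  rewrite /s mulrAC -mulrA gtr_pMr// ltr_pdivrMr// mul1r ltrDl ltr01 //.
have [t [t' [t01 t'01 E1]]] := @second_difference f x v w s (fun t t' h h' =>
   let: And3 o _ _ := dP _ (inb v w t t' erefl h h') in conj (df _ o) (dv _ o)).
have [u [u' [u01 u'01 E2]]] := @second_difference f x w v s (fun t t' h h' =>
   let: And3 o _ _ := dP _ (inb w v t t' (addrC _ _) h h') in conj (df _ o) (dw _ o)).
have [_ b1 _] := dP _ (inb v w t t' erefl t01 t'01).
have [_ _ b2] := dP _ (inb w v u u' (addrC _ _) u01 u'01).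
have E12 : f (x + s *: v + s *: w) - f (x + s *: v) - (f (x + s *: w) - f x) =
    f (x + s *: w + s *: v) - f (x + s *: w) - (f (x + s *: v) - f x).
  rewrite [x + s *: w + s *: v]addrAC; move: (f _) (f (x + s *: v)) (f _) (f _) => A B C D.
  by ring.
rewrite E1 E2 in E12.
have E := mulfI (lt0r_neq0 s0) (mulfI (lt0r_neq0 s0) E12).
rewrite E in b1.
case: e2E => <- _.
move: ('D_v ('D_w f) (x + _ + _)) ('D_w ('D_v f) x) ('D_v ('D_w f) x) b1 b2 => c a b b1 b2.
rewrite (_ : a - b = (a - c) - (b - c)); last by ring.
apply: le_trans (ler_normB _ _) _; exact: (lerD (ltW b1) (ltW b2)).
Qed.

End MeanValue.

Section Clairaut.
Context {R : realType}.
Local Notation V := 'rV[R]_2.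

(** Order 3 makes the second derivatives continuous. *)
Lemma derive_comm m n (O : set V) (f : V -> 'M[R]_(m, n)) v w x : open O ->
  Ck 3 O f -> O x -> 'D_w (fun z => 'D_v f z) x = 'D_v (fun z => 'D_w f z) x.
Proof.
move=> oO Cf Ox.
have dd u z : O z -> differentiable (fun z => 'D_u f z) z.
  by move=> Oz; exact: (Cf.2 u).1.
apply/matrixP => i j.
pose fij z := f z i j.
have Cij : Ck 3 O fij by move: i j @fij; exact/(Ck_mxP _ _ oO).
have dE u : \forall z \near x, ('D_u f z) i j = 'D_u fij z.
  apply: (open_nbhs_near oO Ox) => z Oz.
  exact: (derive_mxE _ _ (diff_derivable (Cf.1 z Oz))).
have E u u' : ('D_u' (fun z => 'D_u f z) x) i j = 'D_u' ('D_u fij) x.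
  have := derive_mxE i j (diff_derivable (v := u') (dd u x Ox)) => ->.
  exact: (near_eq_derive _ (dE u)).
apply: (etrans (E v w)); apply: (etrans _ (esym (E w v))).
apply: (derive_comm_scalar oO Ox Cij.1 (Cij.2 v).1 (Cij.2 w).1).
- exact: (Ck_continuous ((Cij.2 v).2 w) Ox).
- exact: (Ck_continuous ((Cij.2 w).2 v) Ox).
Qed.
End Clairaut.

(** * Continuous partial derivatives *)

Section Gradient.
Context {R : realType}.
Local Notation V := 'rV[R]_2.
Local Notation d0 := (delta_mx 0 0 : V).
Local Notation d1 := (delta_mx 0 1 : V).

Definition gradient_form (p q : R) (h : V) : R := p * h 0 0 + q * h 0 1.

Lemma gradient_form_linear p q : linear (gradient_form p q).
Proof. by move=> a u v; rewrite /gradient_form !mxE /GRing.scale/=; ring. Qed.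

HB.instance Definition _ p q :=
  GRing.isLinear.Build R V R _ (gradient_form p q) (gradient_form_linear p q).

Lemma coord_le_norm m n (M : 'M[R]_(m, n)) i j : `|M i j| <= `|M|.
Proof.
rewrite [leRHS]/Num.Def.normr/= mx_normrE.
exact: (le_bigmax _ (fun ij => `|M ij.1 ij.2|) (i, j)).
Qed.

Lemma norm_le_coord m n (M : 'M[R]_(m, n)) (e : R) : 0 <= e ->
  (forall i j, `|M i j| <= e) -> `|M| <= e.
Proof.
move=> e0 Me; rewrite [leLHS]/Num.Def.normr/= mx_normrE.
by rewrite bigmax_le.
Qed.

Lemma norm_lt_coord m n (M : 'M[R]_(m, n)) (e : R) : 0 < e ->
  (forall i j, `|M i j| < e) -> `|M| < e.
Proof.
move=> e0 Me; rewrite [ltLHS]/Num.Def.normr/= mx_normrE.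
by rewrite bigmax_lt.
Qed.

Lemma gradient_form_continuous p q : continuous (gradient_form p q).
Proof.
move=> x; apply: (@continuousD R R V (fun h => p * h 0 0) (fun h => q * h 0 1));
  apply: continuousM; [exact: cst_continuous|exact: coord_continuous|
  exact: cst_continuous|exact: coord_continuous].
Qed.

(** The increment is followed along the two sides of a rectangle, on each of
    which the mean value theorem applies. *)
Lemma differentiable_partials (f P Q : V -> R) x :
  (\forall z \near x, is_derive z d0 f (P z) /\ is_derive z d1 f (Q z)) ->
  {for x, continuous P} -> {for x, continuous Q} ->
  is_diff x f (gradient_form (P x) (Q x)).
Proof.
move=> df cP cQ; apply: differentiable_epsP => [|e e0].
  exact: gradient_form_continuous.
have e20 : 0 < e / 2 by rewrite divr_gt0.
have /nbhs_ballP[d /= d_gt0 dP] : \forall z \near x,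
   [/\ is_derive z d0 f (P z) /\ is_derive z d1 f (Q z),
       `|P x - P z| < e / 2 & `|Q x - Q z| < e / 2].
  have h2 : \forall z \near x, `|P x - P z| < e / 2 by move/cvgrPdist_lt : cP; exact.
  have h3 : \forall z \near x, `|Q x - Q z| < e / 2 by move/cvgrPdist_lt : cQ; exact.
  by apply: filterS3 df h2 h3 => z.
apply/nbhs_ballP; exists d => //= h; rewrite -ball_normE /ball_/= sub0r normrN => hd.
have hin (a b : R) : `|a| <= `|h 0 0| -> `|b| <= `|h 0 1| -> ball x d (x + a *: d0 + b *: d1).
  move=> ha hb; rewrite -ball_normE /ball_/= -addrA opprD addNKr normrN.
  apply: norm_lt_coord => // i j; rewrite !mxE.
  apply: le_lt_trans hd; case: (ord2E j) => ->; rewrite ord1 /= ?mulr1 ?mulr0 ?addr0 ?add0r.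
  - by apply: le_trans ha _; exact: coord_le_norm.
  - by apply: le_trans hb _; exact: coord_le_norm.
have tl (t a : R) : 0 <= t <= 1 -> `|t * a| <= `|a|.
  by move=> /andP[t0 t1]; rewrite normrM ger0_norm// ler_piMl.
have n0 : `|0 : R| <= `|h 0 1| by rewrite normr0.
have [|t t01 E0] := @MVT_line _ _ f x d0 (h 0 0).
  move=> t t01; have := hin _ _ (tl _ _ t01) n0.
  by rewrite scale0r addr0 => /dP[[[]]].
have [|t' t'01 E1] := @MVT_line _ _ f (x + h 0 0 *: d0) d1 (h 0 1).
  move=> t' t'01; have [[_ [dd _]] _ _] := dP _ (hin _ _ (lexx `|h 0 0|) (tl _ (h 0 1) t'01)).
  exact: dd.
have := hin _ _ (tl _ _ t01) n0; rewrite scale0r addr0 => /dP[[[_ Pz] _] bP _].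
have /dP[[_ [_ Qz]] _ bQ] := hin _ _ (lexx `|h 0 0|) (tl _ (h 0 1) t'01).
rewrite Pz in E0; rewrite Qz in E1.
have -> : h + x = x + h 0 0 *: d0 + h 0 1 *: d1 by rewrite addrC -addrA -rV2E.
rewrite /gradient_form.
move: (f _) (f _) (f _) (P (_ + _)) (Q (_ + _)) (P x) (Q x) E0 E1 bP bQ => y z fx p q Px Qx E0 E1 bP bQ.
have -> : y - z - (Px * h 0 0 + Qx * h 0 1) = - (h 0 0 * (Px - p)) - (h 0 1 * (Qx - q)).
  rewrite (_ : y - z = (y - fx) + (fx - z)); last by ring.
  by rewrite E0 E1; ring.
rewrite -opprD normrN; apply: (le_trans (ler_normD _ _)); rewrite !normrM.
have le_norm i j := coord_le_norm h i j.
rewrite [e]splitr mulrDl; apply: lerD.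
  by rewrite mulrC; apply: ler_pM => //; exact: ltW.
by rewrite mulrC; apply: ler_pM => //; exact: ltW.
Qed.

End Gradient.

(** * Integrals depending on a parameter *)

Section OneVariableIntegrals.
Context {R : realType}.
Local Notation mu := (@lebesgue_measure R).

Lemma continuous_integrable_cc (g : R -> R) (l u : R) :
  (forall t, l <= t <= u -> {for t, continuous g}) ->
  mu.-integrable `[l, u] (EFin \o g).
Proof.
move=> cg; apply: continuous_compact_integrable; first exact: segment_compact.
apply: continuous_in_subspaceT => t; rewrite inE/= in_itv/=; exact: cg.
Qed.

Lemma is_derive_primitive (g : R -> R) (l u b : R) : l < b < u ->
  (forall t, l <= t <= u -> {for t, continuous g}) ->
  is_derive b 1 (fun x => \int[mu]_(t in `[l, x]) g t) (g b).
Proof.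
move=> /andP[lb bu] cg.
have [] := continuous_FTC1_closed bu (continuous_integrable_cc cg) lb.
  by apply: cg; rewrite !ltW.
move=> dF F'; split; first exact: dF.
by rewrite -derive1E; exact: F'.
Qed.

(** Differentiation under the integral sign, combined with the fundamental
    theorem: for a closed form P ds + Q dt the derivative of Q in s is the
    derivative of P in t, and its integral over t is a difference of values
    of P. *)
Lemma is_derive_under_integral (q p : R -> R -> R) (dq : R -> R -> R) (a la ua l b M : R) :
  la < a < ua -> l < b -> 0 <= M ->
  (forall x t, la < x < ua -> l <= t <= b -> {for t, continuous (q x)}) ->
  (forall x t, la < x < ua -> l <= t <= b -> is_derive x 1 (q^~ t) (dq x t)) ->
  (forall x t, la < x < ua -> l <= t <= b -> `|dq x t| <= M) ->
  (forall t, l <= t <= b -> {for t, continuous (dq a)}) ->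
  (forall t, l <= t <= b -> is_derive t 1 (p a) (dq a t)) ->
  is_derive a 1 (fun x => \int[mu]_(t in `[l, b]) q x t) (p a b - p a l).
Proof.
move=> Ia lb M0 cq dqE bdq cdq dp.
have Ia' : [set` `]la, ua[] a by rewrite /= in_itv.
have der := @cvg_differentiation_under_integral R _ _ mu q `[l, b] (measurable_itv _) a la ua Ia'.
have E : \int[mu]_(y in `[l, b]) partial1of2 q a y = p a b - p a l.
  rewrite (_ : \int[mu]_(y in `[l, b]) partial1of2 q a y = \int[mu]_(y in `[l, b]) dq a y).
    have FTC : derivable_oo_LRcontinuous (p a) l b.
      have cp t : l <= t <= b -> {for t, continuous (p a)}.
        by move=> /dp [dpt _]; apply/differentiable_continuous/derivable1_diffP.
      split=> [t||].
      + rewrite in_itv/= => /andP[lt tb]; have tlb : l <= t <= b by rewrite !ltW.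
        by have [dpt _] := dp t tlb; exact: dpt.
      + by apply: cvg_at_right_filter; apply: cp; rewrite lexx ltW.
      + by apply: cvg_at_left_filter; apply: cp; rewrite lexx ltW.
    rewrite /Rintegral (continuous_FTC2 lb _ FTC); first by [].
      by apply: continuous_in_subspaceT => t; rewrite inE/= in_itv/=; exact: cdq.
    move=> t; rewrite in_itv/= => /andP[lt tb]; rewrite derive1E.
    have tlb : l <= t <= b by rewrite !ltW.
    by have [_ dpt] := dp t tlb; exact: dpt.
  apply: eq_Rintegral => t; rewrite inE/= in_itv/= => tlb.
  by rewrite partial1of2E; have [] := dqE a t Ia tlb.
have {}der : h^-1 *: (\int[mu]_(y in `[l, b]) q (h + a) y - \int[mu]_(y in `[l, b]) q a y)
      @[h --> 0^'] --> p a b - p a l.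
  rewrite -E; apply: (der _ _ (fun=> M)) => //=.
  - move=> x; rewrite in_itv/= => Ix; apply: continuous_integrable_cc => t tlb.
    exact: cq.
  - move=> x t; rewrite !in_itv/= => Ix tlb.
    by have [] := dqE x t Ix tlb.
  - by apply: continuous_integrable_cc => t _; exact: cst_continuous.
  - move=> x t; rewrite !in_itv/= => Ix tlb; rewrite partial1of2E.
    by have [_ ->] := dqE x t Ix tlb; exact: bdq.
have E1 : (fun h : R => h^-1 *: (((fun x => \int[mu]_(t in `[l, b]) q x t) \o shift a) (h *: 1) -
            \int[mu]_(t in `[l, b]) q a t)) =
          (fun h : R => h^-1 *: (\int[mu]_(y in `[l, b]) q (h + a) y - \int[mu]_(y in `[l, b]) q a y)).
  by apply/funext => h /=; rewrite [h *: 1]mulr1.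
split; rewrite /derivable /derive E1.
  by apply/cvg_ex; exists (p a b - p a l).
exact/cvg_lim.
Qed.

End OneVariableIntegrals.

(** * Closed 1-forms in the plane are locally exact *)

Section Poincare.
Context {R : realType}.
Local Notation V := 'rV[R]_2.
Local Notation mu := (@lebesgue_measure R).
Local Notation d0 := (delta_mx 0 0 : V).
Local Notation d1 := (delta_mx 0 1 : V).

(** The converse of [derivable_line]. *)
Lemma is_derive_line (V' W : normedModType R) (f : V' -> W) a v (t : R) l :
  is_derive t 1 (fun s : R => f (a + s *: v)) l -> is_derive (a + t *: v) v f l.
Proof.
have E : (fun h : R => h^-1 *: (((fun s => f (a + s *: v)) \o shift t) (h *: (1 : R)) - f (a + t *: v))) =
    (fun h : R => h^-1 *: ((f \o shift (a + t *: v)) (h *: v) - f (a + t *: v))).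
  apply/funext => h /=; congr (_ *: (f _ - _)).
  by rewrite [h *: (1 : R)]mulr1 scalerDl addrCA.
move=> []; rewrite /derivable /derive E => dl El.
by split.
Qed.

Definition pt (a b : R) : V := a *: d0 + b *: d1.

Lemma pt0 a b : (pt a b) 0 0 = a.
Proof. by rewrite !mxE /= mulr1 mulr0 addr0. Qed.

Lemma pt1 a b : (pt a b) 0 1 = b.
Proof. by rewrite !mxE /= mulr1 mulr0 add0r. Qed.

Lemma ptE (x : V) : x = pt (x 0 0) (x 0 1).
Proof. exact: rV2E. Qed.

Lemma ball_pt (x : V) (e a b : R) : 0 < e ->
  `|x 0 0 - a| < e -> `|x 0 1 - b| < e -> ball x e (pt a b).
Proof.
move=> e0 ha hb; rewrite -ball_normE /ball_/=; apply: norm_lt_coord => // i j.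
have -> : (x - pt a b) i j = x 0 j - pt a b 0 j by rewrite ord1 mxE [X in _ + X]mxE.
by case: (ord2E j) => ->; rewrite ?pt0 ?pt1.
Qed.

Lemma ball_coord (x z : V) (e : R) j : ball x e z -> `|x 0 j - z 0 j| < e.
Proof.
rewrite -ball_normE /ball_/= => /(le_lt_trans _); apply.
by have := coord_le_norm (x - z) 0 j; rewrite !mxE.
Qed.

Lemma is_derive_pt1 (W : normedModType R) (f : V -> W) (a b : R) :
  differentiable f (pt a b) -> is_derive b 1 (fun t => f (pt a t)) ('D_d1 f (pt a b)).
Proof. by move=> df; apply: derivable_line; exact: diff_derivable. Qed.

Lemma is_derive_pt0 (W : normedModType R) (f : V -> W) (a b : R) :
  differentiable f (pt a b) -> is_derive a 1 (fun t => f (pt t b)) ('D_d0 f (pt a b)).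
Proof.
have -> : (fun t => f (pt t b)) = (fun t => f (b *: d1 + t *: d0)).
  by apply/funext => t; rewrite /pt addrC.
have -> : pt a b = b *: d1 + a *: d0 by rewrite /pt addrC.
by move=> df; apply: derivable_line; exact: diff_derivable.
Qed.

Lemma is_derive_pt1_inv (W : normedModType R) (f : V -> W) (a b : R) l :
  is_derive b 1 (fun t => f (pt a t)) l -> is_derive (pt a b) d1 f l.
Proof. exact: is_derive_line. Qed.

Lemma is_derive_pt0_inv (W : normedModType R) (f : V -> W) (a b : R) l :
  is_derive a 1 (fun t => f (pt t b)) l -> is_derive (pt a b) d0 f l.
Proof.
have -> : (fun t => f (pt t b)) = (fun t => f (b *: d1 + t *: d0)).
  by apply/funext => t; rewrite /pt addrC.
have -> : pt a b = b *: d1 + a *: d0 by rewrite /pt addrC.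
exact: is_derive_line.
Qed.

Lemma is_derive_continuous (f : R -> R) (t l : R) :
  is_derive t 1 f l -> {for t, continuous f}.
Proof. by move=> [dpt _]; apply/differentiable_continuous/derivable1_diffP. Qed.

(** The primitive is the integral of the form along the path which first
    goes in the first and then in the second coordinate direction, starting
    from the corner (la, l) of a square around x0. *)
Lemma closed_form_exact (O : set V) (P Q : V -> R) (x0 : V) : open O -> O x0 ->
  Ck 2 O P -> Ck 2 O Q ->
  (forall x, O x -> 'D_d1 P x = 'D_d0 Q x) ->
  exists2 e : R, 0 < e & ball x0 e `<=` O /\ exists u : V -> R,
    forall x, ball x0 e x -> is_derive x d0 u (P x) /\ is_derive x d1 u (Q x).
Proof.
move=> oO Ox0 CP CQ PQ.
pose dQ := 'D_d0 Q.
have ddQ x : O x -> differentiable dQ x by exact: (CQ.2 d0).1.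
have /nbhs_ballP[d /= d_gt0 dP] : \forall z \near x0, O z /\ `|dQ z| <= `|dQ x0| + 1.
  have h1 : \forall z \near x0, O z by exact: open_nbhs_nbhs.
  have h2 : \forall z \near x0, `|dQ x0 - dQ z| < 1.
    by have /cvgrPdist_lt := differentiable_continuous (ddQ _ Ox0); apply.
  apply: filterS2 h1 h2 => z Oz dz; split => //.
  rewrite -[dQ z](subrK (dQ x0)) addrC (le_trans (ler_normD _ _))// lerD2l.
  by rewrite distrC ltW.
have [e [e0 ed]] : exists e, 0 < e /\ e < d.
  by exists (d / 2); rewrite divr_gt0// ltr_pdivrMr// ltr_pMr// ltr1n.
have inO a b : `|x0 0 0 - a| <= e -> `|x0 0 1 - b| <= e -> ball x0 d (pt a b).
  by move=> ha hb; apply: ball_pt => //; exact: le_lt_trans ed.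
exists e => //; split.
  by move=> z /(le_ball (ltW ed)) /dP[].
pose la := x0 0 0 - e; pose ua := x0 0 0 + e; pose l := x0 0 1 - e; pose ub := x0 0 1 + e.
have ina a : la <= a <= ua -> `|x0 0 0 - a| <= e.
  by move=> /andP[h1 h2]; rewrite ler_norml; apply/andP; rewrite /la /ua in h1 h2; split; lra.
have inb b : l <= b <= ub -> `|x0 0 1 - b| <= e.
  by move=> /andP[h1 h2]; rewrite ler_norml; apply/andP; rewrite /l /ub in h1 h2; split; lra.
have box a b : la <= a <= ua -> l <= b <= ub -> O (pt a b) /\ `|dQ (pt a b)| <= `|dQ x0| + 1.
  by move=> /ina ha /inb hb; apply: dP; exact: inO.
pose H (x : V) := \int[mu]_(t in `[l, x 0 1]) Q (pt (x 0 0) t).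
pose G (x : V) := \int[mu]_(t in `[la, x 0 0]) P (pt t l).
exists (fun x => G x + H x) => x xe.
have xa : la < x 0 0 < ua.
  have := ball_coord 0 xe; rewrite ltr_norml /la /ua => /andP[h1 h2].
  by apply/andP; split; lra.
have xb : l < x 0 1 < ub.
  have := ball_coord 1 xe; rewrite ltr_norml /l /ub => /andP[h1 h2].
  by apply/andP; split; lra.
move: xa xb; rewrite [x]ptE; move: (x 0 0) (x 0 1) => {x xe} a b; rewrite pt0 pt1 => xa xb.
have xa' : la <= a <= ua by case/andP: xa => ? ?; rewrite !ltW.
have xb' : l <= b <= ub by case/andP: xb => ? ?; rewrite !ltW.
have [lb bu] := andP xb.
have ll : l <= l <= ub by rewrite lexx (ltW (lt_trans lb bu)).
have wa c : la < c < ua -> la <= c <= ua by case/andP => h1 h2; rewrite !ltW.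
have wb c : l <= c <= b -> l <= c <= ub by case/andP => -> h /=; rewrite (le_trans h (ltW bu)).
split.
- apply: is_derive_pt0_inv.
  have -> : (fun t => G (pt t b) + H (pt t b)) =
      (fun t => \int[mu]_(s in `[la, t]) P (pt s l)) +
      (fun t => \int[mu]_(s in `[l, b]) Q (pt t s)).
    by apply/funext => t; rewrite /G /H !pt0 !pt1.
  have -> : P (pt a b) = P (pt a l) + (P (pt a b) - P (pt a l)) by ring.
  apply: is_deriveD.
    apply: (is_derive_primitive xa) => t ta.
    have [Ot _] := box t l ta ll.
    exact: (is_derive_continuous (is_derive_pt0 (CP.1 _ Ot))).
  have M0 : 0 <= `|dQ x0| + 1 by rewrite addr_ge0.
  apply: (@is_derive_under_integral _ (fun s t => Q (pt s t)) (fun s t => P (pt s t))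
     (fun s t => dQ (pt s t)) a la ua l b _ xa lb M0).
  + move=> s t /wa sa /wb tb; have [Ot _] := box s t sa tb.
    exact: (is_derive_continuous (is_derive_pt1 (CQ.1 _ Ot))).
  + move=> s t /wa sa /wb tb; have [Ot _] := box s t sa tb.
    exact: (is_derive_pt0 (CQ.1 _ Ot)).
  + by move=> s t /wa sa /wb tb; have [] := box s t sa tb.
  + move=> t /wb tb; have [Ot _] := box a t xa' tb.
    exact: (is_derive_continuous (is_derive_pt1 (ddQ _ Ot))).
  + move=> t /wb tb; have [Ot _] := box a t xa' tb.
    rewrite /dQ -PQ//; exact: (is_derive_pt1 (CP.1 _ Ot)).
- apply: is_derive_pt1_inv.
  have -> : (fun t => G (pt a t) + H (pt a t)) =
      cst (\int[mu]_(s in `[la, a]) P (pt s l)) +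
      (fun t => \int[mu]_(s in `[l, t]) Q (pt a s)).
    by apply/funext => t; rewrite /G /H !pt0 !pt1.
  rewrite -[X in is_derive _ _ _ X]add0r; apply: is_deriveD.
  apply: (is_derive_primitive xb) => t tb.
  have [Ot _] := box a t xa' tb.
  exact: (is_derive_continuous (is_derive_pt1 (CQ.1 _ Ot))).
Qed.

(** Once the differential of u is P da + Q db, every directional derivative
    of u is a combination of P and Q. *)
Lemma smooth_primitive (O : set V) (P Q u : V -> R) : open O ->
  (forall k, Ck k O P) -> (forall k, Ck k O Q) ->
  (forall x, O x -> is_derive x d0 u (P x) /\ is_derive x d1 u (Q x)) ->
  (forall k, Ck k O u) /\
  forall x v, O x -> 'D_v u x = v 0 0 * P x + v 0 1 * Q x.
Proof.
move=> oO CP CQ du.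
have dif x : O x -> is_diff x u (gradient_form (P x) (Q x)).
  move=> Ox; apply: differentiable_partials.
  - exact: (open_nbhs_near oO Ox).
  - exact: Ck_continuous (CP 1%N) Ox.
  - exact: Ck_continuous (CQ 1%N) Ox.
have Dv x v : O x -> 'D_v u x = v 0 0 * P x + v 0 1 * Q x.
  move=> Ox; have [d1 d2] := dif x Ox.
  by rewrite deriveE// d2 /gradient_form mulrC [Q x * _]mulrC.
split=> // -[//|k]; split=> [x Ox|v]; first by have [] := dif x Ox.
apply: (@Ck_ext _ _ _ _ (fun x => v 0 0 * P x + v 0 1 * Q x)) => // [x Ox|].
  by rewrite Dv.
by apply: CkD => //; exact: Ck_mulc.
Qed.

End Poincare.

(** * The inverse function theorem in the plane *)

(** Matrices are complete as a uniform space; the contraction principle needs this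
    together with their norm. *)
HB.instance Definition _ (R : realType) (m n : nat) :=
  Uniform_isComplete.Build 'M[R]_(m, n) (@cauchy_cvg _).

Section InverseFunction.
Context {R : realType}.
Local Notation V := 'rV[R]_2.
Local Notation d0 := (delta_mx 0 0 : V).
Local Notation d1 := (delta_mx 0 1 : V).

Lemma norm_mulmx_le m n p (A : 'M[R]_(m, n)) (B : 'M[R]_(n, p)) :
  `|A *m B| <= n%:R * `|A| * `|B|.
Proof.
apply: norm_le_coord => [|i j]; first by rewrite !mulr_ge0.
rewrite mxE (le_trans (ler_norm_sum _ _ _))//.
apply: (@le_trans _ _ (\sum_(k < n) `|A| * `|B|)).
  by apply: ler_sum => k _; rewrite normrM ler_pM// coord_le_norm.
by rewrite sumr_const card_ord -[X in X <= _]mulr_natl mulrA.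
Qed.

Lemma mulmxr_continuous (A : 'M[R]_2) : continuous (mulmxr A : V -> V).
Proof.
apply/linear_bounded_continuous/bounded_funP => r; exists (2 * r * `|A|) => z zr.
by apply: (le_trans (norm_mulmx_le _ _)); rewrite ler_wpM2r// ler_wpM2l.
Qed.

Lemma derive_mulmxr (Phi : V -> V) (A : 'M[R]_2) x : differentiable Phi x ->
  is_diff x (fun z => Phi z *m A) (fun v => 'D_v Phi x *m A).
Proof.
move=> dP.
have cA := @mulmxr_continuous A.
have dA z : differentiable (mulmxr A : V -> V) z by exact: linear_differentiable.
have -> : (fun z => Phi z *m A) = mulmxr A \o Phi by [].
have dc : differentiable (mulmxr A \o Phi) x by exact: (differentiable_comp dP (dA _)).
split; first exact: dc.
apply/funext => w; rewrite -(deriveE w dc) (derive_chain w dP (dA _)).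
by rewrite (deriveE _ (dA _)) (diff_lin _ cA).
Qed.

Lemma ball_convex (x0 a b : V) (r t : R) : ball x0 r a -> ball x0 r b -> 0 <= t <= 1 ->
  ball x0 r (a + t *: (b - a)).
Proof.
rewrite -!ball_normE /ball_/= => ha hb /andP[t0 t1].
have -> : x0 - (a + t *: (b - a)) = (1 - t) *: (x0 - a) + t *: (x0 - b).
  by apply/rowP => i; rewrite !mxE; ring.
apply: (le_lt_trans (ler_normD _ _)).
have n1 : `|(1 - t) *: (x0 - a)| = (1 - t) * `|x0 - a| by rewrite normrZ ger0_norm ?subr_ge0.
have n2 : `|t *: (x0 - b)| = t * `|x0 - b| by rewrite normrZ ger0_norm.
rewrite n1 n2; have [->|tn] := eqVneq t 0; first by rewrite subr0 mul1r mul0r addr0.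
have t_gt0 : 0 < t by rewrite lt_neqAle eq_sym tn.
apply: (@lt_le_trans _ _ ((1 - t) * r + t * r)); last by rewrite -mulrDl subrK mul1r.
by apply: ler_ltD; [rewrite ler_wpM2l ?subr_ge0// ltW|rewrite ltr_pM2l].
Qed.

(** The bounds 1/4 on the two partial derivatives add up to 1/2 on each
    coordinate in the maximum norm. *)
Lemma lipschitz_ball (H : V -> V) (x0 : V) (r : R) :
  (forall z, ball x0 r z -> differentiable H z) ->
  (forall z, ball x0 r z -> `|'D_d0 H z| <= 4^-1 /\ `|'D_d1 H z| <= 4^-1) ->
  forall x x', ball x0 r x -> ball x0 r x' -> `|H x - H x'| <= 2^-1 * `|x - x'|.
Proof.
move=> dH bH x x' xr x'r; apply: norm_le_coord => [|i j]; first by rewrite mulr_ge0.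
rewrite !mxE ord1.
have dHj z : ball x0 r z -> differentiable (fun z => H z 0 j) z.
  by move=> /dH /differentiable_mxP; apply.
have inb t : 0 <= t <= 1 -> ball x0 r (x' + (t * 1) *: (x - x')).
  by rewrite mulr1; exact: ball_convex.
have [t t01] := @MVT_lineZ _ _ (fun z => H z 0 j) x' (x - x') 1 (fun t t01 => dHj _ (inb t t01)).
rewrite scale1r [x' + _]addrC subrK mul1r => ->.
have zr := inb t t01; move: (x' + _) zr => z zr.
rewrite derive_coord2; last exact: dHj.
have hD v : `|'D_v (fun z => H z 0 j) z| <= `|'D_v H z|.
  rewrite -derive_mxE; first exact: coord_le_norm.
  exact/diff_derivable/dH.
have [b0 b1] := bH _ zr.
have c0 := coord_le_norm (x - x') 0 0; have c1 := coord_le_norm (x - x') 0 1.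
have {b0}p0 := le_trans (hD d0) b0; have {b1}p1 := le_trans (hD d1) b1.
move: (_ 0 0) (_ 0 1) ('D_d0 _ _) ('D_d1 _ _) (`|x - x'|) c0 c1 p0 p1.
clear=> a b p q m ha hb hp hq.
rewrite (le_trans (ler_normD _ _))// !normrM.
have -> : 2^-1 * m = m * 4^-1 + m * 4^-1 by field.
by rewrite lerD// ler_pM.
Qed.

(** E x is the inverse of the Jacobian of Phi at x. The map H = id - Phi
    E(x0) has derivative 0 at x0, hence is a contraction with factor 1/2
    near x0. This makes Phi injective with Lipschitz inverse, and for y near
    Phi(x1) the equation Phi x = y is the fixed point equation x = H x + y
    E(x0), which the contraction principle solves. The inverse Psi has
    derivative E o Psi, so its order of differentiability grows by
    induction. *)
Lemma inverse_function (O : set V) (Phi : V -> V) (E : V -> 'M[R]_2) (x0 : V) :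
  open O -> O x0 -> (forall k, Ck k O Phi) -> (forall k, Ck k O E) ->
  (forall x v, O x -> 'D_v Phi x *m E x = v) ->
  exists (W : set V) (Psi : V -> V),
    [/\ open W /\ W `<=` O, W x0, open (Phi @` W),
      forall x, W x -> Psi (Phi x) = x &
      (forall k, Ck k (Phi @` W) Psi) /\
      forall x v, W x -> 'D_v Psi (Phi x) = v *m E x].
Proof.
move=> oO Ox0 CP CE EP.
have dP x : O x -> differentiable Phi x by move=> /(CP 1%N).1.
have DPJ x v : O x -> 'D_v Phi x = v *m jacobian Phi x.
  by move=> Ox; rewrite deriveEjacobian//; exact: dP.
have JE x : O x -> jacobian Phi x *m E x = 1%:M.
  move=> Ox; apply/row_matrixP => i.
  by rewrite rowE mulmxA -DPJ// EP// rowE mulmx1.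
have EJ x : O x -> E x *m jacobian Phi x = 1%:M by move=> /JE /mulmx1C.
pose E0 := E x0.
pose H x := x - Phi x *m E0.
have CH k : Ck k O H.
  apply/Ck_mxP => // i j.
  have -> : (fun x => H x i j) = (fun x => x i j - \sum_l Phi x i l * E0 l j).
    by apply/funext => x; rewrite !mxE.
  have CPij l : Ck k O (fun x => Phi x i l) by move: i l; exact/(Ck_mxP _ _ oO).
  apply: CkB => //; first by move: i j {CPij}; apply/(Ck_mxP _ _ oO); exact: Ck_id.
  apply: Ck_sum => // l; under eq_fun do rewrite mulrC.
  exact: Ck_mulc.
have dH x : O x -> differentiable H x by move=> /(CH 1%N).1.
have DH0 v : 'D_v H x0 = 0.
  have dPE := derive_mulmxr E0 (dP x0 Ox0).
  have dPE' : differentiable (fun z => Phi z *m E0) x0 by case: dPE.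
  apply: (etrans (deriveB (@derivable_id _ _ x0 v) (diff_derivable dPE'))).
  by rewrite derive_id (deriveE _ dPE') diff_val EP// subrr.
have /nbhs_ballP[r /= r_gt0 rP] : \forall z \near x0, O z /\ (`|'D_d0 H z| <= 4^-1 /\ `|'D_d1 H z| <= 4^-1).
  have h1 : \forall z \near x0, O z by exact: open_nbhs_nbhs.
  have h2 v : \forall z \near x0, `|'D_v H z| <= 4^-1.
    have cD : {for x0, continuous (fun z => 'D_v H z)} by exact: (Ck_continuous ((CH 2%N).2 v) Ox0).
    move/cvgrPdist_le : cD => /(_ 4^-1); rewrite DH0 invr_gt0 ltr0n => /(_ isT).
    by apply: filterS => z; rewrite sub0r normrN.
  by apply: filterS3 h1 (h2 d0) (h2 d1) => z.
have Hlip := lipschitz_ball (fun z zr => dH z (rP z zr).1) (fun z zr => (rP z zr).2).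
have rO z : ball x0 r z -> O z by move=> /rP[].
pose K := 2 * (2 * `|E0|).
have K0 : 0 <= K by rewrite !mulr_ge0.
have Phi_inv x x' : ball x0 r x -> ball x0 r x' -> `|x - x'| <= K * `|Phi x - Phi x'|.
  move=> xr x'r; have := Hlip x x' xr x'r.
  have E1 : H x - H x' = (x - x') - (Phi x - Phi x') *m E0.
    by rewrite /H mulmxBl; apply/rowP => i; rewrite !mxE; ring.
  have h1 : `|x - x'| - `|(Phi x - Phi x') *m E0| <= `|H x - H x'| by rewrite E1; exact: lerB_dist.
  have h2 := norm_mulmx_le (Phi x - Phi x') E0.
  rewrite /K; move: h1 h2; move: (`|x - x'|) (`|(_ - _) *m _|) (`|H _ - _|) (`|Phi _ - _|) (`|E0|).
  by move=> a b c d e h1 h2 h3; nra.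
have Phi_inj x x' : ball x0 r x -> ball x0 r x' -> Phi x = Phi x' -> x = x'.
  move=> xr x'r e; apply/eqP; rewrite -subr_eq0 -normr_eq0 eq_le normr_ge0 andbT.
  by have := Phi_inv x x' xr x'r; rewrite e subrr normr0 mulr0.
have E0_inj v : v *m E0 = 0 -> v = 0.
  by move=> h; rewrite -[v]mulmx1 -(EJ x0 Ox0) mulmxA h mul0mx.
exists (ball x0 r).
have oW : open (ball x0 r) by exact: ball_open.
have oPW : open (Phi @` ball x0 r).
  rewrite openE => _ [x1 x1r <-].
  have /nbhs_ballP[s0 /= s0_gt0 s0P] : nbhs x1 (ball x0 r) by exact: open_nbhs_nbhs.
  have [s [s_gt0 ss0]] : exists s, 0 < s /\ s < s0.
    by exists (s0 / 2); rewrite divr_gt0// ltr_pdivrMr// ltr_pMr// ltr1n.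
  pose U := [set z : V | `|x1 - z| <= s].
  have Ur z : U z -> ball x0 r z.
    by move=> zU; apply: s0P; rewrite -ball_normE /ball_/=; exact: le_lt_trans ss0.
  apply/nbhs_ballP; exists (s / (K + 1)) => /=; first by rewrite divr_gt0// ltr_wpDl.
  move=> y; rewrite -ball_normE /ball_/= => yr.
  (* a fixed point z of T satisfies Phi z E0 = y E0 *)
  pose T z := H z + y *m E0.
  have TU : set_fun U U T.
    move=> z zU; rewrite /U/=.
    have -> : x1 - T z = (H x1 - H z) - (y - Phi x1) *m E0.
      by rewrite /T /H mulmxBl; apply/rowP => i; rewrite !mxE; ring.
    apply: (le_trans (ler_normB _ _)).
    have h1 := Hlip _ _ x1r (Ur z zU).
    have h2 := norm_mulmx_le (y - Phi x1) E0.
    have h3 : `|y - Phi x1| * (K + 1) <= s.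
      by rewrite distrC -ler_pdivlMr ?ltW// ltr_wpDl.
    move: h1 h2 h3 zU; rewrite /U/= /K.
    have n1 := normr_ge0 (y - Phi x1); have n2 := normr_ge0 E0; move: n1 n2.
    move: (`|(_ - _) *m _|) (`|H _ - _|) (`|y - _|) (`|E0|) (`|x1 - z|).
    by move=> a b c e f n1 n2 h1 h2 h3 h4; nra.
  pose f := @mkfun _ _ U U T TU.
  have fc : is_contraction f.
    exists (2^-1)%:nng; split=> /=; first by rewrite invf_lt1// ltr1n.
    move=> [z z'] [/= zU z'U]; rewrite /f /mkfun /T opprD addrACA subrr addr0.
    by apply: Hlip; exact: Ur.
  have Ucl : closed U.
    have -> : U = closed_ball_ (fun z : V => `|z|) x1 s by [].
    by rewrite -closed_ballE//; exact: closed_ball_closed.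
  have [|p Up pE] := banach_fixed_point fc Ucl.
    by exists x1; rewrite /U/= subrr normr0 ltW.
  exists p; first by move: (Ur p Up); rewrite -ball_normE.
  apply/eqP; rewrite -subr_eq0; apply/eqP/E0_inj.
  have /eqP : p = p - Phi p *m E0 + y *m E0 by exact: pE.
  rewrite -subr_eq0 -addrA opprD addrA subrr add0r oppr_eq0 addrC => /eqP h.
  by rewrite mulmxBl -opprB h oppr0.
pose Psi y := xget x0 [set x | ball x0 r x /\ Phi x = y].
have PsiK x : ball x0 r x -> Psi (Phi x) = x.
  move=> xr; rewrite /Psi; case: xgetP => [z _ [zr zE]|/(_ x)]; last by case.
  exact: Phi_inj.
exists Psi.
have dPsi x : ball x0 r x -> is_diff (Phi x) Psi (mulmxr (E x)).
  move=> xr; have Ox := rO _ xr.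
  have cE := @mulmxr_continuous (E x).
  apply: differentiable_epsP => // e e_gt0.
  pose C := 2 * `|E x| * K + 1.
  have C_gt0 : 0 < C by rewrite ltr_wpDl ?mulr_ge0.
  have [e' [e'_gt0 e'C]] : exists e', 0 < e' /\ e' * C = e.
    by exists (e / C); rewrite divr_gt0// divfK// lt0r_neq0.
  have /nbhs_ballP[d /= d_gt0 dd] := differentiable_eps (dP x Ox) e'_gt0.
  have h1 : \forall k \near (0 : V), (Phi @` ball x0 r) (k + Phi x).
    have : \forall k \near Phi x, (Phi @` ball x0 r) k by apply: open_nbhs_nbhs; split=> //; exists x.
    by rewrite (near_shift (0 : V)) subr0.
  have h2 : \forall k \near (0 : V), `|k| < d / (K + 1).
    apply/nbhs_ballP; exists (d / (K + 1)) => /=; first by rewrite divr_gt0// ltr_wpDl.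
    by move=> k; rewrite -ball_normE /ball_/= sub0r normrN.
  apply: filterS2 h1 h2 => k [x' x'r kE] kd.
  have kE' : k = Phi x' - Phi x by rewrite kE addrK.
  rewrite PsiK// -kE PsiK//.
  have hk := Phi_inv _ _ x'r xr; rewrite -kE' in hk.
  pose h := x' - x.
  have hd : `|h| < d.
    apply: (le_lt_trans hk); move: kd; rewrite ltr_pdivlMr ?ltr_wpDl//.
    by have := normr_ge0 k; move: (`|k|) => a a0; nra.
  have := dd h; rewrite -ball_normE /ball_/= sub0r normrN => /(_ hd).
  rewrite /h subrK -kE' -/h.
  rewrite -deriveE; last exact: dP.
  rewrite DPJ//; set rho := k - _ => hrho.
  have -> : h - k *m E x = - (rho *m E x).
    by rewrite /rho mulmxBl -mulmxA JE// mulmx1 opprB.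
  rewrite normrN; apply: (le_trans (norm_mulmx_le _ _)).
  rewrite -e'C /C; have n1 := normr_ge0 (E x); have n2 := normr_ge0 k.
  have n3 : `|rho| <= e' * (K * `|k|) by apply: (le_trans hrho); rewrite ler_pM2l.
  apply: (@le_trans _ _ (2 * (e' * (K * `|k|)) * `|E x|)).
    by rewrite ler_wpM2r// ler_wpM2l.
  have : 0 <= e' * `|k| by rewrite mulr_ge0// ltW.
  move: (`|E x|) (`|k|) => a b; nra.
have DPsi x v : ball x0 r x -> 'D_v Psi (Phi x) = v *m E x.
  by move=> xr; have [d1 d2] := dPsi x xr; rewrite deriveE// d2.
split=> //; first exact: ballxx.
split=> //; elim=> [//|k IH]; split=> [_ [x xr <-]|v].
  by have [] := dPsi x xr.
apply: (@Ck_ext _ _ _ _ (fun y => v *m E (Psi y))) => // [_ [x xr <-]|].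
  by rewrite DPsi// PsiK.
apply/Ck_mxP => // i j.
have -> : (fun y => (v *m E (Psi y)) i j) = (fun y => \sum_l v i l * E (Psi y) l j).
  by apply/funext => y; rewrite mxE.
apply: Ck_sum => // l; apply: Ck_mulc => //.
have CEP : Ck k (Phi @` ball x0 r) (E \o Psi).
  apply: (Ck_comp oPW oO _ IH (CE k)) => _ [x xr <-].
  by rewrite PsiK//; exact: rO.
exact: ((Ck_mxP _ _ oPW).1 CEP).
Qed.

End InverseFunction.

(** * Commuting frames are coordinate frames *)

Section Rectification.
Context {R : realType}.
Local Notation V := 'rV[R]_2.
Local Notation d0 := (delta_mx 0 0 : V).
Local Notation d1 := (delta_mx 0 1 : V).

Lemma derive_mul (U : normedModType R) (f g : U -> R) x v :
  differentiable f x -> differentiable g x ->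
  'D_v (fun z => f z * g z) x = f x * 'D_v g x + g x * 'D_v f x.
Proof. by move=> df dg; exact: (deriveM (diff_derivable df) (diff_derivable dg)). Qed.

Lemma derive_sub (U : normedModType R) (f g : U -> R) x v :
  differentiable f x -> differentiable g x ->
  'D_v (fun z => f z - g z) x = 'D_v f x - 'D_v g x.
Proof. by move=> df dg; exact: (deriveB (diff_derivable df) (diff_derivable dg)). Qed.

Lemma derive_opp (U : normedModType R) (f : U -> R) x v : differentiable f x ->
  'D_v (fun z => - f z) x = - 'D_v f x.
Proof. by move=> df; exact: (deriveN (diff_derivable df)). Qed.

Lemma derive_div (U : normedModType R) (f g : U -> R) x v :
  differentiable f x -> differentiable g x -> g x != 0 ->
  'D_v (fun z => f z / g z) x = ('D_v f x * g x - f x * 'D_v g x) / g x ^+ 2.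
Proof.
move=> df dg g0; have dVg : differentiable (fun z => (g z)^-1) x by exact: differentiableV.
rewrite (derive_mul v df dVg) (deriveV g0 (diff_derivable dg)) /GRing.scale/=.
by field.
Qed.

(** The 1-forms dual to e1, e2 are closed because the frame commutes. Their
    primitives u, w have du(e1) = dw(e2) = 1 and du(e2) = dw(e1) = 0, so
    that (u, w) are coordinates whose coordinate fields are e1 and e2. *)
Lemma commuting_frame_coordinates (O : set V) (e1 e2 : V -> V) (x0 : V) :
  open O -> O x0 -> (forall k, Ck k O e1) -> (forall k, Ck k O e2) ->
  (forall x, O x -> e1 x 0 0 * e2 x 0 1 - e1 x 0 1 * e2 x 0 0 != 0) ->
  (forall x, O x -> 'D_(e1 x) e2 x = 'D_(e2 x) e1 x) ->
  exists (W : set V) (Phi Psi : V -> V),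
    [/\ open W /\ W `<=` O, W x0, open (Phi @` W),
      forall x, W x -> Psi (Phi x) = x &
      [/\ forall k, Ck k W Phi, forall k, Ck k (Phi @` W) Psi,
      forall x, W x -> 'D_d0 Psi (Phi x) = e1 x &
      forall x, W x -> 'D_d1 Psi (Phi x) = e2 x]].
Proof.
move=> oO Ox0 Ce1 Ce2 det0 comm.
pose a x := e1 x 0 0; pose b x := e1 x 0 1; pose c x := e2 x 0 0; pose d x := e2 x 0 1.
have Ca k : Ck k O a by exact: ((Ck_mxP _ _ oO).1 (Ce1 k)).
have Cb k : Ck k O b by exact: ((Ck_mxP _ _ oO).1 (Ce1 k)).
have Cc k : Ck k O c by exact: ((Ck_mxP _ _ oO).1 (Ce2 k)).
have Cd k : Ck k O d by exact: ((Ck_mxP _ _ oO).1 (Ce2 k)).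
pose D x := a x * d x - b x * c x.
have CD k : Ck k O D by apply: CkB => //; apply: CkM.
have CDV k : Ck k O (fun x => (D x)^-1) by exact: CkV.
(* the coefficients of the dual 1-forms, by the formula for the inverse of
   the 2x2 matrix with rows e1, e2 *)
pose P1 x := d x / D x; pose Q1 x := - (c x / D x).
pose P2 x := - (b x / D x); pose Q2 x := a x / D x.
have CP1 k : Ck k O P1 by apply: CkM.
have CQ1 k : Ck k O Q1 by apply: CkN => //; apply: CkM.
have CP2 k : Ck k O P2 by apply: CkN => //; apply: CkM.
have CQ2 k : Ck k O Q2 by apply: CkM.
have dif (f : V -> R) x : (forall k, Ck k O f) -> O x -> differentiable f x.
  by move=> Cf Ox; exact: (Cf 1%N).1.
have commE x : O x ->
    a x * 'D_d0 c x + b x * 'D_d1 c x = c x * 'D_d0 a x + d x * 'D_d1 a x /\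
    a x * 'D_d0 d x + b x * 'D_d1 d x = c x * 'D_d0 b x + d x * 'D_d1 b x.
  move=> Ox; have dd1 : derivable e1 x (e2 x) by exact/diff_derivable/((Ce1 1%N).1 x Ox).
  have dd2 : derivable e2 x (e1 x) by exact/diff_derivable/((Ce2 1%N).1 x Ox).
  have h i j : ('D_(e1 x) e2 x) i j = ('D_(e2 x) e1 x) i j by rewrite comm.
  have Ec := derive_coord2 (e1 x) (dif _ x Cc Ox); have Ed := derive_coord2 (e1 x) (dif _ x Cd Ox).
  have Ea := derive_coord2 (e2 x) (dif _ x Ca Ox); have Eb := derive_coord2 (e2 x) (dif _ x Cb Ox).
  split.
    apply: etrans (esym Ec) (etrans _ Ea).
    by have := h 0 0; rewrite (derive_mxE _ _ dd1) (derive_mxE _ _ dd2).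
  apply: etrans (esym Ed) (etrans _ Eb).
  by have := h 0 1; rewrite (derive_mxE _ _ dd1) (derive_mxE _ _ dd2).
have DD x v : O x -> 'D_v D x = a x * 'D_v d x + d x * 'D_v a x - (b x * 'D_v c x + c x * 'D_v b x).
  move=> Ox; have da := dif _ x Ca Ox; have db := dif _ x Cb Ox.
  have dc := dif _ x Cc Ox; have ddx := dif _ x Cd Ox.
  have dad : differentiable (fun z => a z * d z) x by exact: differentiableM.
  have dbc : differentiable (fun z => b z * c z) x by exact: differentiableM.
  by rewrite (derive_sub v dad dbc) (derive_mul v da ddx) (derive_mul v db dc).
have closed1 x : O x -> 'D_d1 P1 x = 'D_d0 Q1 x.
  move=> Ox; have dD := dif _ x CD Ox; have D0 : D x != 0 by exact: det0.
  have dc := dif _ x Cc Ox; have ddx := dif _ x Cd Ox.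
  have dcD : differentiable (fun z => c z / D z) x by apply: dif => // k; exact: CkM.
  rewrite (derive_div _ ddx dD D0) (derive_opp _ dcD) (derive_div _ dc dD D0) !DD//.
  have [h1 h2] := commE x Ox; rewrite -[RHS]mulNr; congr (_ / _); apply/eqP; rewrite -subr_eq0.
  rewrite /D; apply/eqP; transitivity
   (d x * ((a x * 'D_d0 c x + b x * 'D_d1 c x) - (c x * 'D_d0 a x + d x * 'D_d1 a x)) -
    c x * ((a x * 'D_d0 d x + b x * 'D_d1 d x) - (c x * 'D_d0 b x + d x * 'D_d1 b x))); last first.
    by rewrite h1 h2 !subrr !mulr0 subr0.
  move: (a x) (b x) (c x) (d x) ('D_d0 a x) ('D_d0 b x) ('D_d0 c x) ('D_d0 d x)
    ('D_d1 a x) ('D_d1 b x) ('D_d1 c x) ('D_d1 d x); clear=> *; ring.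
have closed2 x : O x -> 'D_d1 P2 x = 'D_d0 Q2 x.
  move=> Ox; have dD := dif _ x CD Ox; have D0 : D x != 0 by exact: det0.
  have da := dif _ x Ca Ox; have db := dif _ x Cb Ox.
  have dbD : differentiable (fun z => b z / D z) x by apply: dif => // k; exact: CkM.
  rewrite (derive_opp _ dbD) (derive_div _ db dD D0) (derive_div _ da dD D0) !DD//.
  have [h1 h2] := commE x Ox; rewrite -[LHS]mulNr; congr (_ / _); apply/eqP; rewrite -subr_eq0.
  rewrite /D; apply/eqP; transitivity
   (- b x * ((a x * 'D_d0 c x + b x * 'D_d1 c x) - (c x * 'D_d0 a x + d x * 'D_d1 a x)) +
    a x * ((a x * 'D_d0 d x + b x * 'D_d1 d x) - (c x * 'D_d0 b x + d x * 'D_d1 b x))); last first.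
    by rewrite h1 h2 !subrr !mulr0 addr0.
  move: (a x) (b x) (c x) (d x) ('D_d0 a x) ('D_d0 b x) ('D_d0 c x) ('D_d0 d x)
    ('D_d1 a x) ('D_d1 b x) ('D_d1 c x) ('D_d1 d x); clear=> *; ring.
have [r1 r1_gt0 [r1O [u du]]] := closed_form_exact oO Ox0 (CP1 2%N) (CQ1 2%N) closed1.
have [r2 r2_gt0 [r2O [w dw]]] := closed_form_exact oO Ox0 (CP2 2%N) (CQ2 2%N) closed2.
pose B := ball x0 r1 `&` ball x0 r2.
have oB : open B by apply: openI; exact: ball_open.
have B1 : B `<=` ball x0 r1 by move=> ? [].
have B2 : B `<=` ball x0 r2 by move=> ? [].
have BO : B `<=` O by move=> x /B1 /r1O.
have Bx0 : B x0 by split; exact: ballxx.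
have sub f : (forall k, Ck k O f) -> forall k, Ck k B (f : V -> R).
  by move=> Cf k; exact: (Ck_sub BO).
have [Cu Du] := smooth_primitive oB (sub _ CP1) (sub _ CQ1) (fun x xB => du x (B1 x xB)).
have [Cw Dw] := smooth_primitive oB (sub _ CP2) (sub _ CQ2) (fun x xB => dw x (B2 x xB)).
pose Phi x := pt (u x) (w x).
have CPhi k : Ck k B Phi.
  apply/Ck_mxP => // i j; rewrite ord1; case: (ord2E j) => ->.
    by under eq_fun do rewrite pt0.
  by under eq_fun do rewrite pt1.
pose E x : 'M[R]_2 := \matrix_(i, j) (if i == 0 then e1 x 0 j else e2 x 0 j).
have CE k : Ck k B E.
  apply/Ck_mxP => // i j.
  have -> : (fun x => E x i j) = (fun x => if i == 0 then e1 x 0 j else e2 x 0 j).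
    by apply/funext => x; rewrite mxE.
  by case: (i == 0); apply: (Ck_sub BO); [exact: ((Ck_mxP _ _ oO).1 (Ce1 k))|exact: ((Ck_mxP _ _ oO).1 (Ce2 k))].
have DPhi x v : B x -> 'D_v Phi x = pt (v 0 0 * P1 x + v 0 1 * Q1 x) (v 0 0 * P2 x + v 0 1 * Q2 x).
  move=> xB; have dPhi : derivable Phi x v by exact/diff_derivable/((CPhi 1%N).1 x xB).
  rewrite [LHS]ptE !(derive_mxE _ _ dPhi) -Du// -Dw//.
  congr pt; [congr ('D_v _ x)|congr ('D_v _ x)]; apply/funext => z.
    by rewrite pt0.
  by rewrite pt1.
have DPhiE x v : B x -> 'D_v Phi x *m E x = v.
  move=> xB; have D0 : D x != 0 by apply: det0; exact: BO.
  rewrite DPhi// [v in RHS]ptE; apply/rowP => j.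
  rewrite !mxE !big_ord_recl big_ord0 !mxE/= /P1 /Q1 /P2 /Q2.
  have {}D0 : a x * d x - b x * c x != 0 by [].
  rewrite /D; case: (ord2E j) => ->; rewrite -/(a x) -/(b x) -/(c x) -/(d x) /=; by field.
have [W [Psi [[oW WB] Wx0 oPW PsiK [CPsi DPsi]]]] := inverse_function oB Bx0 CPhi CE DPhiE.
have rowE0 x : d0 *m E x = e1 x by rewrite -rowE; apply/rowP => j; rewrite !mxE.
have rowE1 x : d1 *m E x = e2 x by rewrite -rowE; apply/rowP => j; rewrite !mxE.
exists W, Phi, Psi; split=> //.
  by split=> // x /WB /BO.
split=> // [k|x Wx|x Wx]; first exact: (Ck_sub WB).
  by rewrite DPsi.
by rewrite DPsi.
Qed.

End Rectification.

(** * The inner product and derivatives along vector fields *)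

Section InnerProduct.
Context {R : realType} (m s : nat).
Local Notation W := 'cV[R]_m.
Local Notation ip := (@ip R m s).
Implicit Types (x y : W) (a : R).

Lemma ipC x y : ip x y = ip y x.
Proof. by apply: eq_bigr => i _; rewrite mulrAC. Qed.

Lemma ip_linl a x y z : ip (a *: x + y) z = a * ip x z + ip y z.
Proof.
rewrite /Defs.ip mulr_sumr -big_split/=; apply: eq_bigr => i _.
by rewrite !mxE; ring.
Qed.

Lemma ipDl x y z : ip (x + y) z = ip x z + ip y z.
Proof. by rewrite -[x]scale1r ip_linl scale1r mul1r. Qed.
Lemma ip0l x : ip 0 x = 0.
Proof. by rewrite /Defs.ip big1// => i _; rewrite mxE mulr0 mul0r. Qed.
Lemma ipZl a x y : ip (a *: x) y = a * ip x y.
Proof. by rewrite -[a *: x]addr0 ip_linl ip0l addr0. Qed.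
Lemma ipNl x y : ip (- x) y = - ip x y.
Proof. by rewrite -scaleN1r ipZl mulN1r. Qed.
Lemma ipBl x y z : ip (x - y) z = ip x z - ip y z.
Proof. by rewrite ipDl ipNl. Qed.
Lemma ipDr x y z : ip z (x + y) = ip z x + ip z y.
Proof. by rewrite !(ipC z) ipDl. Qed.
Lemma ipZr a x y : ip x (a *: y) = a * ip x y.
Proof. by rewrite !(ipC x) ipZl. Qed.
Lemma ipNr x y : ip x (- y) = - ip x y.
Proof. by rewrite !(ipC x) ipNl. Qed.
Lemma ipBr x y z : ip z (x - y) = ip z x - ip z y.
Proof. by rewrite !(ipC z) ipBl. Qed.
Lemma ip0r x : ip x 0 = 0.
Proof. by rewrite ipC ip0l. Qed.

Definition ipE := (ipDl, ipDr, ipBl, ipBr, ipZl, ipZr, ipNl, ipNr, ip0l, ip0r).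

Lemma ip_delta x i : ip x (delta_mx i 0) = (-1) ^+ (m - s <= i)%N * x i 0.
Proof.
rewrite /Defs.ip (bigD1 i)//= big1 => [|j ji]; last by rewrite mxE (negPf ji) mulr0.
by rewrite mxE !eqxx mulr1 addr0.
Qed.

(** Each coordinate of x is, up to sign, its product with a basis vector. *)
Lemma ip_nondeg x : (forall y, ip x y = 0) -> x = 0.
Proof.
move=> x0; apply/matrixP => i j; rewrite (ord1 j) mxE.
by have := x0 (delta_mx i 0); rewrite ip_delta => /eqP; rewrite mulf_eq0 signr_eq0 => /eqP.
Qed.

Section Calculus.
Variable U : normedModType R.
Implicit Types (f g : U -> W) (u v : U).

Lemma differentiable_ip f g u : differentiable f u -> differentiable g u ->
  differentiable (fun z => ip (f z) (g z)) u.
Proof.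
move=> /differentiable_mxP df /differentiable_mxP dg.
have -> : (fun z => ip (f z) (g z)) = \sum_(i < m) (fun z => (-1) ^+ (m - s <= i)%N * f z i 0 * g z i 0).
  by apply/funext => z; rewrite fct_sumE.
apply: differentiable_sum => i.
have dc : differentiable (fun z => (-1) ^+ (m - s <= i)%N * f z i 0) u.
  by apply: (differentiableM (f := cst _)) => //; exact: df.
exact: (differentiableM dc (dg i 0)).
Qed.

Lemma derive_ip f g u v : differentiable f u -> differentiable g u ->
  'D_v (fun z => ip (f z) (g z)) u = ip ('D_v f u) (g u) + ip (f u) ('D_v g u).
Proof.
move=> df dg.
have dfi i : differentiable (fun z => f z i 0) u by move/differentiable_mxP : df; apply.
have dgi i : differentiable (fun z => g z i 0) u by move/differentiable_mxP : dg; apply.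
have dc (i : 'I_m) : differentiable (fun z => (-1) ^+ (m - s <= i)%N * f z i 0) u.
  by apply: (differentiableM (f := cst _)) => //; exact: dfi.
have -> : (fun z => ip (f z) (g z)) = \sum_(i < m) (fun z => (-1) ^+ (m - s <= i)%N * f z i 0 * g z i 0).
  by apply/funext => z; rewrite fct_sumE.
rewrite derive_sum; last first.
  by move=> i; apply: diff_derivable; exact: (differentiableM (dc i) (dgi i)).
rewrite /Defs.ip -big_split/=; apply: eq_bigr => i _.
rewrite (derive_mul v (dc i) (dgi i)) (derive_mul v (differentiable_cst _ u) (dfi i)).
rewrite derive_cst mulr0 addr0.
rewrite (derive_mxE _ _ (diff_derivable df)) (derive_mxE _ _ (diff_derivable dg)).
by rewrite addrC; congr (_ + _); rewrite mulrC.
Qed.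

End Calculus.

Lemma Ck_ip k (O : set 'rV[R]_2) (f g : 'rV[R]_2 -> W) : open O ->
  Ck k O f -> Ck k O g -> Ck k O (fun z => ip (f z) (g z)).
Proof.
move=> oO Cf Cg; apply: Ck_sum => // i.
have Cfi : Ck k O (fun z => f z i 0) by exact: ((Ck_mxP _ _ oO).1 Cf).
have Cgi : Ck k O (fun z => g z i 0) by exact: ((Ck_mxP _ _ oO).1 Cg).
by apply: CkM => //; exact: Ck_mulc.
Qed.

End InnerProduct.

Section MatrixLeibniz.
Context {R : realType} (U : normedModType R) (m n : nat).
Implicit Types (a : U -> R) (f g : U -> 'M[R]_(m, n)) (u v : U).

Lemma differentiable_scale a f u : differentiable a u -> differentiable f u ->
  differentiable (fun z => a z *: f z) u.
Proof.
move=> da /differentiable_mxP df; apply/differentiable_mxP => i j.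
have -> : (fun z => (a z *: f z) i j) = a * (fun z => f z i j).
  by apply/funext => z; rewrite mxE.
exact: (differentiableM da (df i j)).
Qed.

Lemma derive_scale a f u v : differentiable a u -> differentiable f u ->
  'D_v (fun z => a z *: f z) u = 'D_v a u *: f u + a u *: 'D_v f u.
Proof.
move=> da df; have daf := differentiable_scale da df.
apply/matrixP => i j; rewrite (derive_mxE _ _ (diff_derivable daf)) !mxE.
have dfij : differentiable (fun z => f z i j) u by move/differentiable_mxP : df; apply.
rewrite (derive_mxE _ _ (diff_derivable df)) [_ * f u i j]mulrC addrC.
rewrite -(derive_mul v da dfij); congr ('D_v _ u).
by apply/funext => z; rewrite mxE.
Qed.

Lemma derive_addm f g u v : differentiable f u -> differentiable g u ->
  'D_v (fun z => f z + g z) u = 'D_v f u + 'D_v g u.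
Proof. by move=> df dg; exact: (deriveD (diff_derivable df) (diff_derivable dg)). Qed.

Lemma derive_subm f g u v : differentiable f u -> differentiable g u ->
  'D_v (fun z => f z - g z) u = 'D_v f u - 'D_v g u.
Proof. by move=> df dg; exact: (deriveB (diff_derivable df) (diff_derivable dg)). Qed.

End MatrixLeibniz.

Lemma CkBm {R : realType} k (O : set 'rV[R]_2) m n (f g : 'rV[R]_2 -> 'M[R]_(m, n)) : open O ->
  Ck k O f -> Ck k O g -> Ck k O (fun z => f z - g z).
Proof.
move=> oO Cf Cg.
have -> : (fun z => f z - g z) = (fun z => f z + (-1) *: g z).
  by apply/funext => z; rewrite scaleN1r.
by apply: CkD => //; apply: (Ck_scale (a := cst _)) => //; exact: Ck_cst.
Qed.

Lemma derive_locally_cst {R : realType} (V W : normedModType R) (O : set V) (h : V -> W) c x v :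
  open O -> O x -> (forall z, O z -> h z = c) -> 'D_v h x = 0.
Proof.
move=> oO Ox hc; rewrite -[RHS](derive_cst c x v); apply: near_eq_derive.
exact: (open_nbhs_near oO Ox).
Qed.

Section Along.
Context {R : realType} (m n : nat).
Local Notation V := 'rV[R]_2.
Implicit Types (e : V -> V) (f : V -> 'M[R]_(m, n)).

Definition along e f : V -> 'M[R]_(m, n) := fun x => 'D_(e x) f x.

Lemma Ck_along k (O : set V) e f : open O -> Ck k O e -> Ck k.+1 O f -> Ck k O (along e f).
Proof.
move=> oO Ce [df Df].
apply: (@Ck_ext _ _ _ _ (fun x => e x 0 0 *: 'D_(delta_mx 0 0) f x + e x 0 1 *: 'D_(delta_mx 0 1) f x)) => //.
  by move=> x Ox; rewrite /along [RHS]derive_coord2//; exact: df.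
have Cei j : Ck k O (fun x => e x 0 j) by exact: ((Ck_mxP _ _ oO).1 Ce).
by apply: CkD => //; [exact: (Ck_scale oO (Cei 0) (Df _))|exact: (Ck_scale oO (Cei 1) (Df _))].
Qed.

Lemma smooth_along (O : set V) e f : open O -> (forall k, Ck k O e) ->
  (forall k, Ck k O f) -> forall k, Ck k O (along e f).
Proof. by move=> oO Ce Cf k; exact: (Ck_along oO (Ce k) (Cf k.+1)). Qed.

End Along.

(** The second derivatives of f enter only through its Hessian H, which is
    symmetric and cancels; what is left is the derivative of f along the
    bracket [e1, e2]. *)
Lemma along_bracket {R : realType} m n (O : set 'rV[R]_2) (e1 e2 : 'rV[R]_2 -> 'rV[R]_2)
    (f : 'rV[R]_2 -> 'M[R]_(m, n)) x : open O -> O x ->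
  (forall k, Ck k O e1) -> (forall k, Ck k O e2) -> (forall k, Ck k O f) ->
  along e1 (along e2 f) x - along e2 (along e1 f) x = 'D_(along e1 e2 x - along e2 e1 x) f x.
Proof.
move=> oO Ox Ce1 Ce2 Cf.
have df : differentiable f x by exact: (Cf 1%N).1.
have dDf v : differentiable (fun z => 'D_v f z) x by exact: ((Cf 2%N).2 v).1.
have [H [Hsym HE]] : exists H : 'I_2 -> 'I_2 -> 'M[R]_(m, n), H 1 0 = H 0 1 /\
    forall v j, 'D_v (fun z => 'D_(delta_mx 0 j) f z) x = v 0 0 *: H 0 j + v 0 1 *: H 1 j.
  exists (fun i j => 'D_(delta_mx 0 i) (fun z => 'D_(delta_mx 0 j) f z) x); split.
    exact: (derive_comm _ _ oO (Cf 3%N)).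
  by move=> v j; exact: (derive_coord2 v (dDf _)).
have second (e : 'rV[R]_2 -> 'rV[R]_2) v : (forall k, Ck k O e) ->
    'D_v (along e f) x = 'D_('D_v e x) f x +
      (e x 0 0 *: (v 0 0 *: H 0 0 + v 0 1 *: H 1 0) + e x 0 1 *: (v 0 0 *: H 0 1 + v 0 1 *: H 1 1)).
  move=> Ce; have de : differentiable e x by exact: (Ce 1%N).1.
  have dei j : differentiable (fun z => e z 0 j) x by move/differentiable_mxP : de; apply.
  have E : \forall z \near x, along e f z =
     e z 0 0 *: 'D_(delta_mx 0 0) f z + e z 0 1 *: 'D_(delta_mx 0 1) f z.
    by apply: (open_nbhs_near oO Ox) => z Oz; exact: (derive_coord2 (e z) ((Cf 1%N).1 z Oz)).
  have E0 := derive_scale v (dei 0) (dDf (delta_mx 0 0)).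
  have E1 := derive_scale v (dei 1) (dDf (delta_mx 0 1)).
  apply: (etrans (near_eq_derive v E)).
  apply: (etrans (derive_addm v (differentiable_scale (dei 0) (dDf (delta_mx 0 0))) (differentiable_scale (dei 1) (dDf (delta_mx 0 1))))).
  have {}E0 := etrans E0 (congr1 (fun t => _ + e x 0 0 *: t) (HE v 0)).
  have {}E1 := etrans E1 (congr1 (fun t => _ + e x 0 1 *: t) (HE v 1)).
  apply: (etrans (congr2 +%R E0 E1)).
  apply: (etrans _ (congr1 (+%R^~ _) (esym (derive_coord2 ('D_v e x) df)))).
  rewrite addrACA; congr (_ *: _ + _ *: _ + _).
    exact: (esym (derive_mxE _ _ (diff_derivable de))).
  exact: (esym (derive_mxE _ _ (diff_derivable de))).
have DB v w : 'D_(v - w) f x = 'D_v f x - 'D_w f x by rewrite !(deriveE _ df) linearB.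
rewrite DB {1}/along (second e2 (e1 x) Ce2) {1}/along (second e1 (e2 x) Ce1).
rewrite Hsym /along.
move: ('D_('D_(e1 x) e2 x) f x) ('D_('D_(e2 x) e1 x) f x) => A B.
apply/matrixP => i j; rewrite !mxE; ring.
Qed.

(** * The normalized null frame of a flat pair commutes *)

Lemma frame_span {R : realType} (a b v : 'rV[R]_2) : a 0 0 * b 0 1 - a 0 1 * b 0 0 != 0 ->
  exists l1 l2 : R, v = l1 *: a + l2 *: b.
Proof.
move=> D0; pose D := a 0 0 * b 0 1 - a 0 1 * b 0 0.
exists ((v 0 0 * b 0 1 - v 0 1 * b 0 0) / D), ((a 0 0 * v 0 1 - a 0 1 * v 0 0) / D).
apply/rowP => j; rewrite !mxE /D; case: (ord2E j) => ->; by field.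
Qed.

Section Commutator.
Context {R : realType} (m s : nat).
Local Notation V := 'rV[R]_2.
Local Notation W := 'cV[R]_m.
Local Notation ip := (@ip R m s).

(** Z1, Zh1 stand for first derivatives along the frame, Z12 for the
    derivative along e1 of the derivative along e2, and l1, l2 for the
    coefficients of [e1, e2]. Substituting the structure equations into the
    two mixed derivatives of Zh expresses c2 Z11 - c1 Z22 by Z1, Z2, Z and
    Zh, where the coefficients of Z1 and Z2 are l2 c2 and l1 c1. Its
    products with Z1 and Z2, known from differentiating the normalization
    <Z1, Z1> = <Z2, Z2> = 0, <Z1, Z2> = 1/2, give l1 = l2 = 0. The
    corrections of Z1, Z2 by multiples of Z serve to kill the Zh-component
    in these products. *)
Lemma commutator_algebra (Z Zh Z1 Z2 Z11 Z12 Z21 Z22 Zh1 Zh2 Zh12 Zh21 : W)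
    (c1 c2 l1 l2 r11 r12 r21 r22 : R) : c1 != 0 -> c2 != 0 ->
  ip Z Z = 0 -> ip Z Zh = 1 -> ip Z1 Z = 0 -> ip Z2 Z = 0 ->
  ip Z1 Z1 = 0 -> ip Z2 Z2 = 0 -> ip Z1 Z2 = 2^-1 ->
  ip Z11 Z + ip Z1 Z1 = 0 -> ip Z22 Z + ip Z2 Z2 = 0 ->
  ip Z11 Z1 + ip Z1 Z11 = 0 -> ip Z22 Z2 + ip Z2 Z22 = 0 ->
  ip Z21 Z1 + ip Z1 Z21 = 0 -> ip Z12 Z2 + ip Z2 Z12 = 0 ->
  ip Z11 Z2 + ip Z1 Z12 = 0 -> ip Z21 Z2 + ip Z1 Z22 = 0 ->
  Z12 - Z21 = l1 *: Z1 + l2 *: Z2 -> Zh12 - Zh21 = l1 *: Zh1 + l2 *: Zh2 ->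
  Zh1 = c1 *: (Z2 - ip Z2 Zh *: Z) - ip Z1 Zh *: Zh ->
  Zh2 = c2 *: (Z1 - ip Z1 Zh *: Z) - ip Z2 Zh *: Zh ->
  Zh12 = c2 *: (Z11 - (r11 *: Z + ip Z1 Zh *: Z1)) - (r12 *: Zh + ip Z2 Zh *: Zh1) ->
  Zh21 = c1 *: (Z22 - (r22 *: Z + ip Z2 Zh *: Z2)) - (r21 *: Zh + ip Z1 Zh *: Zh2) ->
  [/\ l1 = 0, l2 = 0 & exists a b, c2 *: Z11 - c1 *: Z22 = a *: Z + b *: Zh].
Proof.
move=> c1n0 c2n0 zz zzh z1z z2z z11 z22 z12 k1 k2 k11 k22 k12 k21 k3 k4 bZ bZh F1 F2 E12 E21.
have [a [b key]] : exists a b, c2 *: Z11 - c1 *: Z22 =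
    (l1 * c1) *: Z2 + (l2 * c2) *: Z1 + (a *: Z + b *: Zh).
  move: bZh; rewrite E12 E21 F1 F2; move: (ip Z1 Zh) (ip Z2 Zh) => rho1 rho2 h.
  exists (c2 * r11 - c1 * r22 + c2 * rho1 ^+ 2 - c1 * rho2 ^+ 2 - l1 * c1 * rho2 - l2 * c2 * rho1),
    (r12 - r21 - l1 * rho1 - l2 * rho2).
  move/eqP: h; rewrite -subr_eq0 => /eqP h; apply/eqP; rewrite -subr_eq0; apply/eqP.
  by rewrite -[RHS]h; apply/matrixP => i j; rewrite !mxE; ring.
have bZ1 := congr1 (ip Z1) bZ; have bZ2 := congr1 (ip Z2) bZ.
have key1 := congr1 (ip (Z1 - ip Z1 Zh *: Z)) key.
have key2 := congr1 (ip (Z2 - ip Z2 Zh *: Z)) key.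
rewrite !ipE in bZ1 bZ2 key1 key2.
rewrite ?[ip Z11 _]ipC ?[ip Z12 _]ipC ?[ip Z21 _]ipC ?[ip Z22 _]ipC in k1 k2 k11 k12 k21 k22 k3 k4.
rewrite ?[ip Z Z1]ipC ?[ip Z Z2]ipC ?[ip Z2 Z1]ipC z1z z2z z11 z22 z12 zz zzh in bZ1 bZ2 key1 key2 k1 k2.
have l2c : c2 * l2 = 0.
  have e1 : ip Z2 Z11 = - (l2 / 2) by lra.
  have e2 : ip Z2 Z22 = 0 by lra.
  have e3 : ip Z Z11 = 0 by lra.
  have e4 : ip Z Z22 = 0 by lra.
  by rewrite e1 e2 e3 e4 in key2; lra.
have l1c : c1 * l1 = 0.
  have e1 : ip Z1 Z22 = l1 / 2 by lra.
  have e2 : ip Z1 Z11 = 0 by lra.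
  have e3 : ip Z Z11 = 0 by lra.
  have e4 : ip Z Z22 = 0 by lra.
  by rewrite e1 e2 e3 e4 in key1; lra.
have l20 : l2 = 0 by apply/eqP; move/eqP: l2c; rewrite mulf_eq0 (negPf c2n0).
have l10 : l1 = 0 by apply/eqP; move/eqP: l1c; rewrite mulf_eq0 (negPf c1n0).
split=> //; exists a, b; rewrite key l10 l20 !mul0r !scale0r !add0r //.
Qed.

(** The structure equations express the derivatives of Zh by those of Z;
    their integrability condition is the whole content, by
    [commutator_algebra]. *)
Lemma canonical_frame_commutes (O : set V) (e1 e2 : V -> V) (Z Zh : V -> W) (c1 c2 : R) :
  open O -> (forall k, Ck k O e1) -> (forall k, Ck k O e2) ->
  (forall k, Ck k O Z) -> (forall k, Ck k O Zh) -> c1 != 0 -> c2 != 0 ->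
  (forall x, O x -> e1 x 0 0 * e2 x 0 1 - e1 x 0 1 * e2 x 0 0 != 0) ->
  (forall x, O x -> [/\ ip (Z x) (Z x) = 0, ip (Zh x) (Zh x) = 0 & ip (Z x) (Zh x) = 1]) ->
  (forall x, O x -> [/\ ip (along e1 Z x) (along e1 Z x) = 0,
      ip (along e2 Z x) (along e2 Z x) = 0 & ip (along e1 Z x) (along e2 Z x) = 2^-1]) ->
  (forall x, O x ->
    along e1 Zh x = c1 *: (along e2 Z x - ip (along e2 Z x) (Zh x) *: Z x)
                    - ip (along e1 Z x) (Zh x) *: Zh x /\
    along e2 Zh x = c2 *: (along e1 Z x - ip (along e1 Z x) (Zh x) *: Z x)
                    - ip (along e2 Z x) (Zh x) *: Zh x) ->
  forall x, O x -> along e1 e2 x = along e2 e1 x /\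
    exists a b, c2 *: along e1 (along e1 Z) x - c1 *: along e2 (along e2 Z) x
                = a *: Z x + b *: Zh x.
Proof.
move=> oO Ce1 Ce2 CZ CZh c1n0 c2n0 det0 nulls metric flat x Ox.
pose Z1 := along e1 Z; pose Z2 := along e2 Z.
have CZ1 : forall k, Ck k O Z1 by exact: smooth_along.
have CZ2 : forall k, Ck k O Z2 by exact: smooth_along.
have dif p (f : V -> 'cV[R]_p) : (forall k, Ck k O f) -> forall z, O z -> differentiable f z.
  by move=> Cf z Oz; exact: (Cf 1%N).1.
have dZ := dif _ _ CZ; have dZh := dif _ _ CZh; have dZ1 := dif _ _ CZ1; have dZ2 := dif _ _ CZ2.
pose rho1 z := ip (Z1 z) (Zh z); pose rho2 z := ip (Z2 z) (Zh z).
have drho1 z : O z -> differentiable rho1 z.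
  by move=> Oz; exact: (differentiable_ip s (dZ1 z Oz) (dZh z Oz)).
have drho2 z : O z -> differentiable rho2 z.
  by move=> Oz; exact: (differentiable_ip s (dZ2 z Oz) (dZh z Oz)).
(* differentiating a pairing which is constant on O *)
have const f g c v z : (forall z, O z -> differentiable f z) -> (forall z, O z -> differentiable g z) ->
    (forall z, O z -> ip (f z) (g z) = c) -> O z -> ip ('D_v f z) (g z) + ip (f z) ('D_v g z) = 0.
  move=> df dg fgc Oz; rewrite -(derive_ip s v (df z Oz) (dg z Oz)).
  exact: (derive_locally_cst _ oO Oz fgc).
have nZZ z : O z -> ip (Z z) (Z z) = 0 by move=> /nulls[].
have nZv z v : O z -> ip ('D_v Z z) (Z z) = 0.
  by move=> Oz; have := const Z Z 0 v z dZ dZ nZZ Oz; rewrite [X in _ + X]ipC; lra.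
have n1Z z : O z -> ip (Z1 z) (Z z) = 0 by exact: nZv.
have n2Z z : O z -> ip (Z2 z) (Z z) = 0 by exact: nZv.
have m11 z : O z -> ip (Z1 z) (Z1 z) = 0 by move=> Oz; have [h _ _] := metric z Oz; exact: h.
have m22 z : O z -> ip (Z2 z) (Z2 z) = 0 by move=> Oz; have [_ h _] := metric z Oz; exact: h.
have m12 z : O z -> ip (Z1 z) (Z2 z) = 2^-1 by move=> Oz; have [_ _ h] := metric z Oz; exact: h.
have [l1 [l2 bracketE]] := frame_span (along e1 e2 x - along e2 e1 x) (det0 x Ox).
have bracketZ : along e1 Z2 x - along e2 Z1 x = l1 *: Z1 x + l2 *: Z2 x.
  apply: (etrans (along_bracket oO Ox Ce1 Ce2 CZ)); rewrite bracketE.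
  by rewrite (derive_lin _ _ _ (dZ x Ox)) (deriveZv _ _ (dZ x Ox)).
have bracketZh : along e1 (along e2 Zh) x - along e2 (along e1 Zh) x =
    l1 *: along e1 Zh x + l2 *: along e2 Zh x.
  apply: (etrans (along_bracket oO Ox Ce1 Ce2 CZh)); rewrite bracketE.
  exact: (etrans (derive_lin _ _ _ (dZh x Ox))
    (congr1 (fun t => l1 *: along e1 Zh x + t) (deriveZv _ _ (dZh x Ox)))).
have second (f : V -> W) (rhoa rhob : V -> R) (c : R) v : (forall z, O z -> differentiable f z) ->
    (forall z, O z -> differentiable rhoa z) -> (forall z, O z -> differentiable rhob z) ->
    'D_v (fun z => c *: (f z - rhoa z *: Z z) - rhob z *: Zh z) x =
    c *: ('D_v f x - ('D_v rhoa x *: Z x + rhoa x *: 'D_v Z x))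
      - ('D_v rhob x *: Zh x + rhob x *: 'D_v Zh x).
  move=> df da db.
  have d1 := differentiable_scale (da x Ox) (dZ x Ox).
  have d2 := differentiable_scale (db x Ox) (dZh x Ox).
  have d3 : differentiable (fun z => f z - rhoa z *: Z z) x by exact: (differentiableB (df x Ox) d1).
  have d4 : differentiable (fun z => c *: (f z - rhoa z *: Z z)) x by exact: (differentiableZ c d3).
  apply: (etrans (derive_subm v d4 d2)).
  apply: (congr2 (fun a b => a - b)); last exact: (derive_scale v (db x Ox) (dZh x Ox)).
  apply: (etrans (deriveZ c (diff_derivable d3))); congr (_ *: _).
  apply: (etrans (derive_subm v (df x Ox) d1)); congr (_ - _).
  exact: (derive_scale v (da x Ox) (dZ x Ox)).
have E12 : along e1 (along e2 Zh) x = c2 *: (along e1 Z1 x - ('D_(e1 x) rho1 x *: Z x + rho1 x *: Z1 x))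
      - ('D_(e1 x) rho2 x *: Zh x + rho2 x *: along e1 Zh x).
  apply: (etrans _ (second Z1 rho1 rho2 c2 (e1 x) dZ1 drho1 drho2)).
  by apply: near_eq_derive; apply: (open_nbhs_near oO Ox) => z Oz; exact: (flat z Oz).2.
have E21 : along e2 (along e1 Zh) x = c1 *: (along e2 Z2 x - ('D_(e2 x) rho2 x *: Z x + rho2 x *: Z2 x))
      - ('D_(e2 x) rho1 x *: Zh x + rho1 x *: along e2 Zh x).
  apply: (etrans _ (second Z2 rho2 rho1 c1 (e2 x) dZ2 drho2 drho1)).
  by apply: near_eq_derive; apply: (open_nbhs_near oO Ox) => z Oz; exact: (flat z Oz).1.
have [zz _ zzh] := nulls x Ox.
have := commutator_algebra c1n0 c2n0 zz zzh (n1Z x Ox) (n2Z x Ox) (m11 x Ox) (m22 x Ox) (m12 x Ox)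
  (const _ _ _ (e1 x) x dZ1 dZ n1Z Ox) (const _ _ _ (e2 x) x dZ2 dZ n2Z Ox)
  (const _ _ _ (e1 x) x dZ1 dZ1 m11 Ox) (const _ _ _ (e2 x) x dZ2 dZ2 m22 Ox)
  (const _ _ _ (e2 x) x dZ1 dZ1 m11 Ox) (const _ _ _ (e1 x) x dZ2 dZ2 m22 Ox)
  (const _ _ _ (e1 x) x dZ1 dZ2 m12 Ox) (const _ _ _ (e2 x) x dZ1 dZ2 m12 Ox)
  bracketZ bracketZh (flat x Ox).1 (flat x Ox).2 E12 E21.
move=> [l10 l20 K]; split; last exact: K.
by apply/eqP; rewrite -subr_eq0 bracketE l10 l20 !scale0r addr0.
Qed.

End Commutator.

(** * Flat pairs of null maps and their null frames *)

Lemma shrink_pos {R : realType} (O : set 'rV[R]_2) (x0 : 'rV[R]_2) (h : 'rV[R]_2 -> R) :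
  open O -> O x0 -> (forall k, Ck k O h) -> 0 < h x0 ->
  exists O' : set 'rV[R]_2, [/\ open O', O' `<=` O, O' x0 & forall x, O' x -> 0 < h x].
Proof.
move=> oO Ox0 Ch h0.
have h1 : \forall z \near x0, O z by exact: open_nbhs_nbhs.
have h2 : \forall z \near x0, `|h x0 - h z| < h x0.
  by have /cvgrPdist_lt := Ck_continuous (Ch 1%N) Ox0; apply.
have /nbhs_ballP[e /= e0 eP] : \forall z \near x0, O z /\ 0 < h z.
  apply: filterS2 h1 h2 => z Oz hz; split => //.
  by move: hz; rewrite ltr_norml => /andP[_]; rewrite ltrBlDr ltrDl.
exists (ball x0 e); split; [exact: ball_open| by move=> z /eP[] | exact: ballxx | by move=> z /eP[]].
Qed.

Lemma sg_mul_gt0 {R : realDomainType} (c : R) : c != 0 -> 0 < Num.sg c * c.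
Proof. by move=> c0; rewrite -normrEsg normr_gt0. Qed.

Section FlatPairs.
Context {R : realType} (m s : nat).
Local Notation V := 'rV[R]_2.
Local Notation W := 'cV[R]_m.
Local Notation ip := (@ip R m s).

(** For v orthogonal to the null vector y, this is the orthogonal projection
    of v to the complement of the plane spanned by y and yh. Adding a
    multiple of y to v changes nothing, so rescaling a lift merely rescales
    the projection of its derivative ([tproj_scale]). *)
Definition tproj (y yh v : W) : W := v - (ip v yh / ip y yh) *: y.

Lemma tproj_scale (y yh v : W) (a b da : R) : a != 0 -> b != 0 -> ip y yh != 0 ->
  tproj (a *: y) (b *: yh) (da *: y + a *: v) = a *: tproj y yh v.
Proof.
move=> a0 b0 yyh; rewrite /tproj !ipE; apply/matrixP => i j; rewrite !mxE.
by field; rewrite yyh a0 b0.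
Qed.

Lemma tproj_orthl (y yh v : W) : ip y yh != 0 -> ip (tproj y yh v) yh = 0.
Proof. by move=> h; rewrite /tproj !ipE divfK// subrr. Qed.

Lemma tproj_orthr (y yh v : W) : ip y y = 0 -> ip v y = 0 -> ip (tproj y yh v) y = 0.
Proof. by move=> h1 h2; rewrite /tproj !ipE h1 h2 mulr0 subrr. Qed.

Lemma ip_tproj (y yh v w : W) : ip y y = 0 -> ip v y = 0 -> ip w y = 0 ->
  ip (tproj y yh v) (tproj y yh w) = ip v w.
Proof. by move=> h1 h2 h3; rewrite /tproj !ipE h1 h2 [ip y w]ipC h3; ring. Qed.

(** The vectors N and Nh are the derivatives of the two null lines, seen as
    vectors orthogonal to the plane. The first equation is the block of the
    bracket on the plane, the second its block on the complement. *)
Definition flat_at (Y Yh : V -> W) (x : V) : Prop := forall a b : V,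
  let N v := tproj (Y x) (Yh x) ('D_v Y x) in
  let Nh v := tproj (Yh x) (Y x) ('D_v Yh x) in
  ip (N a) (Nh b) = ip (N b) (Nh a) /\
  forall w, ip w (Y x) = 0 -> ip w (Yh x) = 0 ->
    ip w (Nh b) *: N a + ip w (N b) *: Nh a = ip w (Nh a) *: N b + ip w (N a) *: Nh b.

(** Let t = <N1, Nh2> = <N2, Nh1>. The equation for w = N1 reads t N1 + <N1,
    N2> Nh1 = <N1, Nh1> N2; its product with N2 is 2 t <N1, N2> = 0, so t =
    0 and Nh1 is the stated multiple of N2. The equation for w = N2 does the
    same for Nh2. *)
Lemma flat_null_frame (N1 N2 Nh1 Nh2 : W) :
  ip N1 N1 = 0 -> ip N2 N2 = 0 -> ip N1 N2 != 0 -> ip N1 Nh2 = ip N2 Nh1 ->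
  ip N1 Nh2 *: N1 + ip N1 N2 *: Nh1 = ip N1 Nh1 *: N2 + ip N1 N1 *: Nh2 ->
  ip N2 Nh2 *: N1 + ip N2 N2 *: Nh1 = ip N2 Nh1 *: N2 + ip N2 N1 *: Nh2 ->
  Nh1 = (ip N1 Nh1 / ip N1 N2) *: N2 /\ Nh2 = (ip N2 Nh2 / ip N1 N2) *: N1.
Proof.
move=> n11 n22 th0 sym h1 h2.
have t0 : ip N1 Nh2 = 0.
  have := congr1 (ip N2) h1; rewrite !ipE n11 n22 -sym [ip N2 N1]ipC.
  move: th0; set t := ip N1 Nh2; set th := ip N1 N2 => th0 h.
  by apply/eqP; rewrite -(mulIr_eq0 _ (mulIf th0)); apply/eqP; lra.
move: h1 h2; rewrite -sym t0 n11 n22 [ip N2 N1]ipC !scale0r add0r !addr0 add0r => h1 h2.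
split.
  by rewrite mulrC -scalerA -h1 scalerA mulVf// scale1r.
by rewrite mulrC -scalerA h2 scalerA mulVf// scale1r.
Qed.

Lemma tprojZ (y yh v : W) (c : R) : tproj y yh (c *: v) = c *: tproj y yh v.
Proof. by rewrite /tproj !ipE scalerBr !scalerA mulrA. Qed.

Lemma tproj_eq0 (y yh v : W) : tproj y yh v = 0 -> exists t, v = t *: y.
Proof. by move/eqP; rewrite subr_eq0 => /eqP ->; eexists. Qed.

Lemma flat_tproj_frame (y yh a1 a2 b1 b2 : W) : ip y y = 0 -> ip y yh != 0 ->
  ip a1 y = 0 -> ip a2 y = 0 -> ip a1 a1 = 0 -> ip a2 a2 = 0 -> ip a1 a2 != 0 ->
  let N1 := tproj y yh a1 in let N2 := tproj y yh a2 in
  let Nh1 := tproj yh y b1 in let Nh2 := tproj yh y b2 in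
  ip N1 Nh2 = ip N2 Nh1 ->
  (forall w, ip w y = 0 -> ip w yh = 0 ->
    ip w Nh2 *: N1 + ip w N2 *: Nh1 = ip w Nh1 *: N2 + ip w N1 *: Nh2) ->
  Nh1 = (ip N1 Nh1 / ip y yh * ip y yh / ip a1 a2) *: N2 /\
  Nh2 = (ip N2 Nh2 / ip y yh * ip y yh / ip a1 a2) *: N1.
Proof.
move=> yy yyh a1y a2y a11 a22 a12 N1 N2 Nh1 Nh2 sym fl.
have n11 : ip N1 N1 = 0 by rewrite ip_tproj.
have n22 : ip N2 N2 = 0 by rewrite ip_tproj.
have n12 : ip N1 N2 = ip a1 a2 by rewrite ip_tproj.
have o1 := fl N1 (tproj_orthr yh yy a1y) (tproj_orthl a1 yyh).
have o2 := fl N2 (tproj_orthr yh yy a2y) (tproj_orthl a2 yyh).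
rewrite -n12 !divfK//; apply: flat_null_frame => //.
by rewrite n12.
Qed.

Lemma derive_null (O : set V) (Y : V -> W) x v : open O -> O x ->
  (forall z, O z -> differentiable Y z) -> (forall z, O z -> ip (Y z) (Y z) = 0) ->
  ip ('D_v Y x) (Y x) = 0.
Proof.
move=> oO Ox dY nY; have h := derive_ip s v (dY x Ox) (dY x Ox).
have := derive_locally_cst v oO Ox nY.
by rewrite h [X in _ + X]ipC; lra.
Qed.

Lemma det0_dependent (a b : V) : a 0 0 * b 0 1 - a 0 1 * b 0 0 = 0 ->
  a 0 0 *: b - b 0 0 *: a = 0 /\ a 0 1 *: b - b 0 1 *: a = 0.
Proof.
move=> det0; split; apply/rowP => j; rewrite !mxE;
  by case: (ord2E j) => ->; move: (a 0 0) (a 0 1) (b 0 0) (b 0 1) det0 => *; lra.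
Qed.

(** If a and b were dependent, <dY(a), dY(b)> would be a multiple of
    <dY(a), dY(a)> = 0, unless a = 0, where it vanishes too. *)
Lemma metric_det (Y : V -> W) (x a b : V) : differentiable Y x ->
  ip ('D_a Y x) ('D_a Y x) = 0 -> ip ('D_a Y x) ('D_b Y x) != 0 ->
  a 0 0 * b 0 1 - a 0 1 * b 0 0 != 0.
Proof.
move=> dY n11 th0; apply/eqP => det0; move/eqP: (th0); apply.
have lin (c d : R) : c *: b - d *: a = 0 -> c * ip ('D_a Y x) ('D_b Y x) = 0.
  move=> h; have : 'D_(c *: b - d *: a) Y x = 0 by rewrite h derive0.
  rewrite -scaleNr derive_lin// deriveZv// => /(congr1 (ip ('D_a Y x))).
  by move: ('D_a Y x) ('D_b Y x) n11 => A B AA; rewrite !ipE AA mulr0 addr0.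
have [dep0 dep1] := det0_dependent det0.
have a0 : a 0 0 = 0 by apply: (mulIf th0); rewrite mul0r; exact: lin dep0.
have a1 : a 0 1 = 0 by apply: (mulIf th0); rewrite mul0r; exact: lin dep1.
have -> : a = 0 by apply/rowP => j; rewrite mxE; case: (ord2E j) => ->.
by rewrite derive0 ip0l.
Qed.

(** With <Z, Zh> = 1 and <Z1, Z2> = 1/2 the coefficient of the structure
    equation becomes the constant 2 s1, and tproj can be written out; d1,
    d2, m1 are the derivatives of the scaling factors. *)
Lemma rescaled_flat (y yh a1 a2 b1 : W) (la mu d1 d2 m1 s1 : R) :
  la != 0 -> mu != 0 -> la * mu * ip y yh = 1 -> la * la * ip a1 a2 = 2^-1 ->
  tproj yh y b1 = (s1 * ip y yh / ip a1 a2) *: tproj y yh a2 ->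
  let Z := la *: y in let Zh := mu *: yh in
  let Z1 := d1 *: y + la *: a1 in let Z2 := d2 *: y + la *: a2 in
  let Zh1 := m1 *: yh + mu *: b1 in
  ip Zh1 Z + ip Zh Z1 = 0 ->
  Zh1 = (2 * s1) *: (Z2 - ip Z2 Zh *: Z) - ip Z1 Zh *: Zh.
Proof.
move=> la0 mu0 norm th E Z Zh Z1 Z2 Zh1 h.
have yyh : ip y yh != 0.
  by apply/eqP => e; move: norm; rewrite e mulr0 => /eqP; rewrite eq_sym oner_eq0.
have ZZh : ip Z Zh = 1 by rewrite /Z /Zh !ipE mulrA.
have th0 : ip a1 a2 != 0.
  by apply/eqP => e; move: th; rewrite e mulr0 => /eqP; rewrite eq_sym invr_eq0 pnatr_eq0.
have t1 : Zh1 + ip Z1 Zh *: Zh = mu *: tproj yh y b1.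
  rewrite -(tproj_scale b1 m1 mu0 la0); last by rewrite ipC.
  rewrite -/Zh -/Z -/Zh1 /tproj [ip Zh Z]ipC ZZh divr1.
  have -> : ip Zh1 Z = - ip Z1 Zh by rewrite [ip Z1 Zh]ipC; lra.
  by rewrite scaleNr opprK.
have t2 : Z2 - ip Z2 Zh *: Z = la *: tproj y yh a2.
  by rewrite -(tproj_scale a2 d2 la0 mu0 yyh) -/Zh -/Z -/Z2 /tproj ZZh divr1.
rewrite t2; apply/eqP; rewrite eq_sym subr_eq eq_sym t1 E !scalerA; apply/eqP; congr (_ *: _).
have mE : mu = (la * ip y yh)^-1.
  by apply: (mulIf (mulf_neq0 la0 yyh)); rewrite mulVf ?mulf_neq0// -norm; ring.
have thE : ip a1 a2 = (2 * (la * la))^-1.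
  apply: (mulfI (mulf_neq0 la0 la0)); rewrite th; by field.
by rewrite mE thE; field; rewrite la0 yyh.
Qed.

Lemma null_scaled (a b : W) (c d t : R) : ip a a = 0 -> ip b b = 0 -> ip a b = t ->
  [/\ ip (c *: a) (c *: a) = 0, ip (d *: b) (d *: b) = 0 & ip (c *: a) (d *: b) = c * d * t].
Proof. by move=> aa bb ab; rewrite !ipE aa bb ab !mulr0 mulrA. Qed.

Lemma invsqrt_sq (c : R) : 0 < c -> (Num.sqrt c)^-1 * (Num.sqrt c)^-1 = c^-1.
Proof. by move=> c0; rewrite -invfM -expr2 sqr_sqrtr// ltW. Qed.

Lemma normalized_sign (y yh v w : W) (e : R) : e * e = 1 ->
  let q := ip (tproj y yh v) (tproj yh y w) / ip y yh in 0 < e * q ->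
  let r := (Num.sqrt (e * q))^-1 in
  ip (tproj y yh (r *: v)) (tproj yh y (r *: w)) / ip y yh = e.
Proof.
move=> ee q eq0 r; rewrite !tprojZ ipZl ipZr.
have -> : r * (r * ip (tproj y yh v) (tproj yh y w)) / ip y yh = r * r * q by rewrite /q; ring.
rewrite invsqrt_sq//; apply: (mulfI (lt0r_neq0 eq0)); rewrite mulVKf ?lt0r_neq0//.
by rewrite mulrAC ee mul1r.
Qed.

Lemma rescaled_metric (y a1 a2 : W) (la d1 d2 : R) : ip y y = 0 -> ip a1 y = 0 -> ip a2 y = 0 ->
  ip (d1 *: y + la *: a1) (d2 *: y + la *: a2) = la * la * ip a1 a2.
Proof. by move=> yy a1y a2y; rewrite !ipE [ip y a2]ipC yy a1y a2y; ring. Qed.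

(** The roots of the quadratic equation <t a + b, t a + b> = 0, scaled by
    <a, a> so that they depend smoothly on a and b without a division. *)
Lemma null_directions (a b : W) (S : R) : S * S = ip a b * ip a b - ip a a * ip b b ->
  [/\ ip ((S - ip a b) *: a + ip a a *: b) ((S - ip a b) *: a + ip a a *: b) = 0,
      ip ((S + ip a b) *: a + (- ip a a) *: b) ((S + ip a b) *: a + (- ip a a) *: b) = 0 &
      ip ((S - ip a b) *: a + ip a a *: b) ((S + ip a b) *: a + (- ip a a) *: b)
        = 2 * ip a a * (ip a b * ip a b - ip a a * ip b b)].
Proof.
rewrite !ipE ![ip b a]ipC; move: (ip a a) (ip a b) (ip b b) => E F G h; split.
- transitivity (E * (S * S - (F * F - E * G))); first by ring.
  by rewrite h subrr mulr0.
- transitivity (E * (S * S - (F * F - E * G))); first by ring.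
  by rewrite h subrr mulr0.
- transitivity (E * (S * S + (F * F - E * G))); first by ring.
  by rewrite h; ring.
Qed.

(** The null directions f1, f2 are explicit functions of the Gram matrix (E,
    F, G) of a fixed basis, hence smooth. They are scaled to e1, e2 by the
    values of the quadratic form q and the lifts by the factors la, mu. The
    sign s_i of q on e_i is constant near x0. *)
Lemma flat_model (O : set V) (x0 : V) (Y Yh : V -> W) : open O -> O x0 ->
  (forall k, Ck k O Y) -> (forall k, Ck k O Yh) ->
  (forall x, O x -> [/\ ip (Y x) (Y x) = 0, ip (Yh x) (Yh x) = 0 & ip (Y x) (Yh x) != 0]) ->
  (forall x, O x -> flat_at Y Yh x) ->
  lorentzian (fun a b => ip ('D_a Y x0) ('D_b Y x0)) (fun _ : V => True) ->
  (forall a t, 'D_a Yh x0 = t *: Yh x0 -> a = 0) ->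
  exists (O' : set V) (e1 e2 : V -> V) (la mu : V -> R) (s1 s2 : R),
    [/\ [/\ open O', O' `<=` O & O' x0],
        [/\ forall k, Ck k O' e1, forall k, Ck k O' e2, forall k, Ck k O' la & forall k, Ck k O' mu],
        s1 * s1 = 1 /\ s2 * s2 = 1,
        forall x, O' x -> [/\ la x != 0, mu x != 0 & la x * mu x * ip (Y x) (Yh x) = 1] &
    let Z x := la x *: Y x in let Zh x := mu x *: Yh x in
    forall x, O' x ->
    [/\ e1 x 0 0 * e2 x 0 1 - e1 x 0 1 * e2 x 0 0 != 0,
       ip (along e1 Z x) (along e1 Z x) = 0 /\ ip (along e2 Z x) (along e2 Z x) = 0,
       ip (along e1 Z x) (along e2 Z x) = 2^-1,
       along e1 Zh x = (2 * s1) *: (along e2 Z x - ip (along e2 Z x) (Zh x) *: Z x)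
                    - ip (along e1 Z x) (Zh x) *: Zh x &
       along e2 Zh x = (2 * s2) *: (along e1 Z x - ip (along e1 Z x) (Zh x) *: Z x)
                    - ip (along e2 Z x) (Zh x) *: Zh x]].
Proof.
move=> oO Ox0 CY CYh nulls flat [v1 [v2 [_ _ g11 g22 g12]]] immh.
have CD v : forall k, Ck k O (fun x => 'D_v Y x) by move=> k; exact: (CY k.+1).2.
have dY x : O x -> differentiable Y x by move=> /(CY 1%N).1.
have dYh x : O x -> differentiable Yh x by move=> /(CYh 1%N).1.
pose E x := ip ('D_v1 Y x) ('D_v1 Y x); pose F x := ip ('D_v1 Y x) ('D_v2 Y x).
pose G x := ip ('D_v2 Y x) ('D_v2 Y x).
have CE k : Ck k O E by exact: (Ck_ip s oO (CD v1 k) (CD v1 k)).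
have CF k : Ck k O F by exact: (Ck_ip s oO (CD v1 k) (CD v2 k)).
have CG k : Ck k O G by exact: (Ck_ip s oO (CD v2 k) (CD v2 k)).
pose D x := F x * F x - E x * G x.
have CDD k : Ck k O D by exact: (CkB oO (CkM oO (CF k) (CF k)) (CkM oO (CE k) (CG k))).
have [|O1 [oO1 O1O O1x0 Epos]] := shrink_pos oO Ox0 CE; first by rewrite /E g11 ltr01.
have [|O2 [oO2 O2O1 O2x0 Dpos]] := shrink_pos oO1 O1x0 (fun k => Ck_sub O1O (CDD k)).
  have -> : D x0 = 0 * 0 - 1 * -1.
    exact: (congr2 (fun a b => a - b) (congr2 *%R g12 g12) (congr2 *%R g11 g22)).
  by rewrite mul0r mul1r opprK add0r ltr01.
have O2O : O2 `<=` O by move=> x /O2O1 /O1O.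
(* the basis v1, v2 is orthonormal at x0, where E = 1 and D = 1; both stay
   positive nearby *)
pose S x := Num.sqrt (D x).
have CS k : Ck k O2 S by exact: (Ck_sqrt oO2 Dpos (Ck_sub O2O (CDD k))).
have SS x : O2 x -> S x * S x = D x by move=> /Dpos Dx; rewrite -expr2 sqr_sqrtr// ltW.
pose f1 x := (S x - F x) *: v1 + E x *: v2.
pose f2 x := (S x + F x) *: v1 + (- E x) *: v2.
have CE2 k : Ck k O2 E by exact: (Ck_sub O2O (CE k)).
have CF2 k : Ck k O2 F by exact: (Ck_sub O2O (CF k)).
have Cf1 k : Ck k O2 f1.
  exact: (CkD oO2 (Ck_scale oO2 (CkB oO2 (CS k) (CF2 k)) (Ck_cst _ _ _)) (Ck_scale oO2 (CE2 k) (Ck_cst _ _ _))).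
have Cf2 k : Ck k O2 f2.
  exact: (CkD oO2 (Ck_scale oO2 (CkD oO2 (CS k) (CF2 k)) (Ck_cst _ _ _)) (Ck_scale oO2 (CkN oO2 (CE2 k)) (Ck_cst _ _ _))).
have alongf (a b : R) (U : V -> W) x : differentiable U x ->
    'D_(a *: v1 + b *: v2) U x = a *: 'D_v1 U x + b *: 'D_v2 U x.
  by move=> dU; rewrite derive_lin// deriveZv.
have alongf1 (U : V -> W) x : differentiable U x ->
    along f1 U x = (S x - F x) *: 'D_v1 U x + E x *: 'D_v2 U x by exact: alongf.
have alongf2 (U : V -> W) x : differentiable U x ->
    along f2 U x = (S x + F x) *: 'D_v1 U x + (- E x) *: 'D_v2 U x by exact: alongf.
have gf x : O2 x -> [/\ ip (along f1 Y x) (along f1 Y x) = 0, ip (along f2 Y x) (along f2 Y x) = 0 &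
     ip (along f1 Y x) (along f2 Y x) = 2 * E x * D x].
  move=> Ox; rewrite (alongf1 _ _ (dY x (O2O x Ox))) (alongf2 _ _ (dY x (O2O x Ox))).
  exact: (null_directions (SS x Ox)).
pose N (f : V -> V) x := tproj (Y x) (Yh x) (along f Y x).
pose Nh (f : V -> V) x := tproj (Yh x) (Y x) (along f Yh x).
have nY x : O x -> ip (Y x) (Y x) = 0 by move=> /nulls[].
have nYh x : O x -> ip (Yh x) (Yh x) = 0 by move=> /nulls[].
have nYYh x : O x -> ip (Y x) (Yh x) != 0 by move=> /nulls[].
have yv x v : O x -> ip ('D_v Y x) (Y x) = 0 by move=> Ox; exact: (derive_null v oO Ox dY nY).
(* q is unchanged when the lifts are rescaled *)
pose q f x := ip (N f x) (Nh f x) / ip (Y x) (Yh x).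
have CYYh k : Ck k O (fun x => (ip (Y x) (Yh x))^-1).
  exact: (CkV oO nYYh (Ck_ip s oO (CY k) (CYh k))).
have Cq f O' : open O' -> O' `<=` O -> (forall k, Ck k O' f) -> forall k, Ck k O' (q f).
  move=> oO' O'O Cf k.
  have CY' : forall k, Ck k O' Y by move=> l; exact: (Ck_sub O'O (CY l)).
  have CYh' : forall k, Ck k O' Yh by move=> l; exact: (Ck_sub O'O (CYh l)).
  have CV' : Ck k O' (fun x => (ip (Y x) (Yh x))^-1) by exact: (Ck_sub O'O (CYYh k)).
  have CV'' : Ck k O' (fun x => (ip (Yh x) (Y x))^-1).
    by apply: (Ck_ext oO' _ CV') => x _; rewrite ipC.
  have aY := smooth_along oO' Cf CY' k; have aYh := smooth_along oO' Cf CYh' k.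
  have CN : Ck k O' (N f).
    exact: (CkBm oO' aY (Ck_scale oO' (CkM oO' (Ck_ip s oO' aY (CYh' k)) CV') (CY' k))).
  have CNh : Ck k O' (Nh f).
    exact: (CkBm oO' aYh (Ck_scale oO' (CkM oO' (Ck_ip s oO' aYh (CY' k)) CV'') (CYh' k))).
  exact: (CkM oO' (Ck_ip s oO' CN CNh) CV').
have frame g1 g2 x : O x -> ip (along g1 Y x) (along g1 Y x) = 0 ->
    ip (along g2 Y x) (along g2 Y x) = 0 -> ip (along g1 Y x) (along g2 Y x) != 0 ->
    Nh g1 x = (q g1 x * ip (Y x) (Yh x) / ip (along g1 Y x) (along g2 Y x)) *: N g2 x /\
    Nh g2 x = (q g2 x * ip (Y x) (Yh x) / ip (along g1 Y x) (along g2 Y x)) *: N g1 x.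
  move=> Ox m11 m22 th0; have [sym fl] := flat x Ox (g1 x) (g2 x).
  exact: (flat_tproj_frame (nY x Ox) (nYYh x Ox) (yv x (g1 x) Ox) (yv x (g2 x) Ox) m11 m22 th0 sym fl).
have ED0 x : O2 x -> 2 * E x * D x != 0.
  by move=> Ox; rewrite !mulf_neq0 ?pnatr_eq0// lt0r_neq0//; [exact: (Epos _ (O2O1 _ Ox))|exact: Dpos].
have [fx1 fx2 fx12] := gf x0 O2x0.
have fr0 := frame f1 f2 x0 Ox0 fx1 fx2; rewrite fx12 in fr0.
have [fr1 fr2] := fr0 (ED0 _ O2x0).
(* yh is an immersion at x0, so a nonzero direction has a nonzero Nh *)
have q0 g : Nh g x0 = 0 -> along g Y x0 = 0.
  by move=> /tproj_eq0[t /immh g0]; rewrite /along g0 derive0.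
have q10 : q f1 x0 != 0.
  apply/eqP => h; move: (ED0 _ O2x0); rewrite -fx12 q0 ?ip0l ?eqxx//.
  by rewrite fr1 h !mul0r scale0r.
have q20 : q f2 x0 != 0.
  apply/eqP => h; move: (ED0 _ O2x0); rewrite -fx12 (q0 f2) ?ip0r ?eqxx//.
  by rewrite fr2 h !mul0r scale0r.
pose s1 := Num.sg (q f1 x0); pose s2 := Num.sg (q f2 x0).
have ss1 : s1 * s1 = 1 by rewrite -expr2 sqr_sg q10.
have ss2 : s2 * s2 = 1 by rewrite -expr2 sqr_sg q20.
pose h1 x := s1 * q f1 x; pose h2 x := s2 * q f2 x.
have Ch1 k : Ck k O2 h1 by exact: (Ck_mulc _ oO2 (Cq f1 _ oO2 O2O Cf1 k)).
have [|O3 [oO3 O3O2 O3x0 h1pos]] := shrink_pos oO2 O2x0 Ch1.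
  exact: (sg_mul_gt0 q10).
have Ch2 k : Ck k O3 h2 by exact: (Ck_sub O3O2 (Ck_mulc _ oO2 (Cq f2 _ oO2 O2O Cf2 k))).
have [|O4 [oO4 O4O3 O4x0 h2pos]] := shrink_pos oO3 O3x0 Ch2.
  exact: (sg_mul_gt0 q20).
have O4O2 : O4 `<=` O2 by move=> x /O4O3 /O3O2.
have O4O : O4 `<=` O by move=> x /O4O2 /O2O.
have {}h1pos x : O4 x -> 0 < h1 x by move=> /O4O3 /h1pos.
pose r1 x := (Num.sqrt (h1 x))^-1; pose r2 x := (Num.sqrt (h2 x))^-1.
have r1pos x : O4 x -> 0 < r1 x by move=> Ox; rewrite invr_gt0 sqrtr_gt0 h1pos.
have r2pos x : O4 x -> 0 < r2 x by move=> Ox; rewrite invr_gt0 sqrtr_gt0 h2pos.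
have sq0 (h : V -> R) x : 0 < h x -> Num.sqrt (h x) != 0 by move=> hx; rewrite lt0r_neq0// sqrtr_gt0.
have Cr1 k : Ck k O4 r1.
  exact: (CkV oO4 (fun x Ox => sq0 h1 x (h1pos x Ox)) (Ck_sqrt oO4 h1pos (Ck_sub O4O2 (Ch1 k)))).
have Cr2 k : Ck k O4 r2.
  exact: (CkV oO4 (fun x Ox => sq0 h2 x (h2pos x Ox)) (Ck_sqrt oO4 h2pos (Ck_sub O4O3 (Ch2 k)))).
pose e1 x := r1 x *: f1 x; pose e2 x := r2 x *: f2 x.
have Ce1 k : Ck k O4 e1 by exact: (Ck_scale oO4 (Cr1 k) (Ck_sub O4O2 (Cf1 k))).
have Ce2 k : Ck k O4 e2 by exact: (Ck_scale oO4 (Cr2 k) (Ck_sub O4O2 (Cf2 k))).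
pose th x := r1 x * r2 x * (2 * E x * D x).
have thpos x : O4 x -> 0 < th x.
  move=> Ox; exact: (mulr_gt0 (mulr_gt0 (r1pos x Ox) (r2pos x Ox)) (mulr_gt0
    (mulr_gt0 (ltr0Sn _ 1) (Epos _ (O2O1 _ (O4O2 _ Ox)))) (Dpos _ (O4O2 _ Ox)))).
have Cth k : Ck k O4 th.
  apply: (CkM oO4 (CkM oO4 (Cr1 k) (Cr2 k))).
  exact: (CkM oO4 (Ck_mulc _ oO4 (Ck_sub O4O (CE k))) (Ck_sub O4O (CDD k))).
pose th2 x := 2 * th x.
have th2pos x : O4 x -> 0 < th2 x by move=> Ox; exact: (mulr_gt0 (ltr0Sn _ 1) (thpos x Ox)).
pose la x := (Num.sqrt (th2 x))^-1.
have la0 x : O4 x -> la x != 0 by move=> Ox; rewrite invr_eq0; exact: (sq0 th2 x (th2pos x Ox)).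
have Cla k : Ck k O4 la.
  exact: (CkV oO4 (fun x Ox => sq0 th2 x (th2pos x Ox)) (Ck_sqrt oO4 th2pos (Ck_mulc _ oO4 (Cth k)))).
pose mu x := (la x * ip (Y x) (Yh x))^-1.
have lay0 x : O4 x -> la x * ip (Y x) (Yh x) != 0.
  by move=> Ox; exact: (mulf_neq0 (la0 x Ox) (nYYh x (O4O x Ox))).
have Cmu k : Ck k O4 mu.
  exact: (CkV oO4 lay0 (CkM oO4 (Cla k) (Ck_sub O4O (Ck_ip s oO (CY k) (CYh k))))).
have mu0 x : O4 x -> mu x != 0 by move=> Ox; rewrite invr_eq0; exact: lay0.
have norm x : O4 x -> la x * mu x * ip (Y x) (Yh x) = 1.
  by move=> Ox; rewrite mulrAC; exact: (divff (lay0 x Ox)).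
have a1E (U : V -> W) x : differentiable U x -> along e1 U x = r1 x *: along f1 U x by exact: deriveZv.
have a2E (U : V -> W) x : differentiable U x -> along e2 U x = r2 x *: along f2 U x by exact: deriveZv.
have ge x : O4 x -> [/\ ip (along e1 Y x) (along e1 Y x) = 0, ip (along e2 Y x) (along e2 Y x) = 0 &
     ip (along e1 Y x) (along e2 Y x) = th x].
  move=> Ox; have [g1 g2 g12'] := gf x (O4O2 x Ox).
  rewrite (a1E _ _ (dY x (O4O x Ox))) (a2E _ _ (dY x (O4O x Ox))).
  exact: (null_scaled _ _ g1 g2 g12').
have qe1 x : O4 x -> q e1 x = s1.
  move=> Ox; have Ox' := O4O x Ox.
  rewrite /q /N /Nh (a1E _ _ (dY x Ox')) (a1E _ _ (dYh x Ox')).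
  exact: (normalized_sign ss1 (h1pos x Ox)).
have qe2 x : O4 x -> q e2 x = s2.
  move=> Ox; have Ox' := O4O x Ox.
  rewrite /q /N /Nh (a2E _ _ (dY x Ox')) (a2E _ _ (dYh x Ox')).
  exact: (normalized_sign ss2 (h2pos x Ox)).
have lala x : O4 x -> la x * la x * th x = 2^-1.
  move=> Ox; have -> : la x * la x = (2 * th x)^-1 by exact: (invsqrt_sq (th2pos x Ox)).
  by rewrite invfM; exact: (mulfVK (lt0r_neq0 (thpos x Ox))).
exists O4, e1, e2, la, mu, s1, s2; split.
- exact: And3 oO4 O4O O4x0.
- exact: And4 Ce1 Ce2 Cla Cmu.
- exact: conj ss1 ss2.
- by move=> x Ox; exact: And3 (la0 x Ox) (mu0 x Ox) (norm x Ox).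
move=> Z Zh x Ox; have Ox' := O4O x Ox.
have dla : differentiable la x by exact: (Cla 1%N).1.
have dmu : differentiable mu x by exact: (Cmu 1%N).1.
have ZE e : along e Z x = 'D_(e x) la x *: Y x + la x *: along e Y x.
  exact: (derive_scale _ dla (dY x Ox')).
have ZhE e : along e Zh x = 'D_(e x) mu x *: Yh x + mu x *: along e Yh x.
  exact: (derive_scale _ dmu (dYh x Ox')).
have dZ z : O4 z -> differentiable Z z.
  by move=> Oz; exact: (differentiable_scale ((Cla 1%N).1 z Oz) (dY z (O4O z Oz))).
have dZh z : O4 z -> differentiable Zh z.
  by move=> Oz; exact: (differentiable_scale ((Cmu 1%N).1 z Oz) (dYh z (O4O z Oz))).
have ZZh z : O4 z -> ip (Z z) (Zh z) = 1 by move=> Oz; rewrite /Z /Zh ipZl ipZr mulrA; exact: norm.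
have dual e : ip (along e Zh x) (Z x) + ip (Zh x) (along e Z x) = 0.
  have h := derive_ip s (e x) (dZ x Ox) (dZh x Ox).
  have := derive_locally_cst (e x) oO4 Ox ZZh; rewrite h => <-.
  by rewrite addrC; congr (_ + _); exact: ipC.
have [m11 m22 m12] := ge x Ox.
have th0 : ip (along e1 Y x) (along e2 Y x) != 0 by rewrite m12 lt0r_neq0// thpos.
have [F1 F2] := frame e1 e2 x Ox' m11 m22 th0; rewrite (qe1 x Ox) in F1; rewrite (qe2 x Ox) in F2.
have yx e : ip (along e Y x) (Y x) = 0 by exact: yv.
have lm : la x * la x * ip (along e1 Y x) (along e2 Y x) = 2^-1 by rewrite m12; exact: lala.
have lm' : la x * la x * ip (along e2 Y x) (along e1 Y x) = 2^-1 by rewrite [ip (along e2 Y x) _]ipC.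
have F2' : Nh e2 x = (s2 * ip (Y x) (Yh x) / ip (along e2 Y x) (along e1 Y x)) *: N e1 x.
  by rewrite [ip (along e2 Y x) _]ipC.
have D1 := dual e1; have D2 := dual e2.
rewrite ZE ZhE in D1; rewrite ZE ZhE in D2.
have mt e e' := rescaled_metric (la x) ('D_(e x) la x) ('D_(e' x) la x) (nY x Ox') (yx e) (yx e').
rewrite (ZE e1) (ZE e2) (ZhE e1) (ZhE e2); split.
- exact: (metric_det (dY x Ox') m11 th0).
- have z t : t = 0 -> la x * la x * t = 0 by move=> ->; exact: mulr0.
  exact: (conj (etrans (mt e1 e1) (z _ m11)) (etrans (mt e2 e2) (z _ m22))).
- exact: (etrans (mt _ _) lm).
- exact: (rescaled_flat _ (la0 x Ox) (mu0 x Ox) (norm x Ox) lm F1 D1).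
- exact: (rescaled_flat _ (la0 x Ox) (mu0 x Ox) (norm x Ox) lm' F2' D2).
Qed.

End FlatPairs.

(** * Adapted coordinates of a flat pair *)

Section FlatCoordinates.
Context {R : realType} (m s : nat).
Local Notation V := 'rV[R]_2.
Local Notation W := 'cV[R]_m.
Local Notation ip := (@ip R m s).
Local Notation d0 := (delta_mx 0 0 : V).
Local Notation d1 := (delta_mx 0 1 : V).

(** The normal form of a flat pair: y and yh are lifts with <y, yh> = 1, y
    is the canonical lift in asymptotic coordinates, the derivatives of yh
    satisfy the Darboux relations with explicit coefficients, and the second
    derivatives of y are related as they must be for an isothermic surface. *)
Definition adapted_pair (U : set V) (y yh : V -> W) (s1 s2 : R) : Prop :=
  forall u, U u ->
  [/\ [/\ ip (y u) (y u) = 0, ip (yh u) (yh u) = 0 & ip (y u) (yh u) = 1],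
      [/\ ip ('D_d0 y u) ('D_d0 y u) = 0, ip ('D_d1 y u) ('D_d1 y u) = 0 &
          ip ('D_d0 y u) ('D_d1 y u) = 2^-1],
      'D_d0 yh u = (2 * s1) *: ('D_d1 y u - ip ('D_d1 y u) (yh u) *: y u)
                    - ip ('D_d0 y u) (yh u) *: yh u,
      'D_d1 yh u = (2 * s2) *: ('D_d0 y u - ip ('D_d0 y u) (yh u) *: y u)
                    - ip ('D_d1 y u) (yh u) *: yh u &
      exists a b, s2 *: 'D_d0 (fun z => 'D_d0 y z) u - s1 *: 'D_d1 (fun z => 'D_d1 y z) u
                  = a *: y u + b *: yh u].

Lemma halve_relation (A B C D : W) (s1 s2 a b : R) :
  (2 * s2) *: A - (2 * s1) *: B = a *: C + b *: D ->
  s2 *: A - s1 *: B = (a / 2) *: C + (b / 2) *: D.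
Proof.
move=> h; apply: (scalerI (a := 2)); first by rewrite pnatr_eq0.
rewrite scalerBr scalerDr !scalerA h; congr (_ *: _ + _ *: _); by field.
Qed.

(** The frame of [flat_model] commutes, so it is the coordinate frame of
    some coordinates Phi; the equations along e1, e2 become equations
    between partial derivatives. *)
Lemma flat_coordinates (O : set V) (x0 : V) (Y Yh : V -> W) : open O -> O x0 ->
  (forall k, Ck k O Y) -> (forall k, Ck k O Yh) ->
  (forall x, O x -> [/\ ip (Y x) (Y x) = 0, ip (Yh x) (Yh x) = 0 & ip (Y x) (Yh x) != 0]) ->
  (forall x, O x -> flat_at s Y Yh x) ->
  lorentzian (fun a b => ip ('D_a Y x0) ('D_b Y x0)) (fun _ : V => True) ->
  (forall a t, 'D_a Yh x0 = t *: Yh x0 -> a = 0) ->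
  exists (B : set V) (Phi Psi : V -> V) (la mu : V -> R) (s1 s2 : R),
    [/\ [/\ open B, B `<=` O & B x0],
        [/\ open (Phi @` B), forall x, B x -> Psi (Phi x) = x,
            forall k, Ck k B Phi & forall k, Ck k (Phi @` B) Psi],
        s1 * s1 = 1 /\ s2 * s2 = 1,
        [/\ forall x, B x -> la x != 0, forall x, B x -> mu x != 0,
            forall k, Ck k B la & forall k, Ck k B mu] &
        adapted_pair (Phi @` B) (fun u => la (Psi u) *: Y (Psi u))
          (fun u => mu (Psi u) *: Yh (Psi u)) s1 s2].
Proof.
move=> oO Ox0 CY CYh nulls flat lor imm.
have := flat_model oO Ox0 CY CYh nulls flat lor imm.
move=> [ O' [e1 [e2 [la [mu [s1 [s2 [H1 H2 H3 scal model]]]]]]]].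
have [oO' O'O O'x0] := H1; have [Ce1 Ce2 Cla Cmu] := H2; have [ss1 ss2] := H3.
pose Z x := la x *: Y x; pose Zh x := mu x *: Yh x.
have CZ k : Ck k O' Z by exact: (Ck_scale oO' (Cla k) (Ck_sub O'O (CY k))).
have CZh k : Ck k O' Zh by exact: (Ck_scale oO' (Cmu k) (Ck_sub O'O (CYh k))).
have det0 x : O' x -> e1 x 0 0 * e2 x 0 1 - e1 x 0 1 * e2 x 0 0 != 0 by move=> /model[].
have nullZ x : O' x -> [/\ ip (Z x) (Z x) = 0, ip (Zh x) (Zh x) = 0 & ip (Z x) (Zh x) = 1].
  move=> Ox; have [n1 n2 _] := nulls x (O'O x Ox); have [_ _ n3] := scal x Ox.
  by rewrite /Z /Zh !ipE n1 n2 !mulr0 mulrA n3.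
have metric x : O' x -> [/\ ip (along e1 Z x) (along e1 Z x) = 0,
      ip (along e2 Z x) (along e2 Z x) = 0 & ip (along e1 Z x) (along e2 Z x) = 2^-1].
  by move=> /model[_ [m1 m2] m3 _ _]; exact: And3 m1 m2 m3.
have c10 : 2 * s1 != 0.
  by apply/eqP => h; move: ss1 => /eqP; rewrite (_ : s1 = 0) ?mul0r ?(eq_sym 0) ?oner_eq0//; lra.
have c20 : 2 * s2 != 0.
  by apply/eqP => h; move: ss2 => /eqP; rewrite (_ : s2 = 0) ?mul0r ?(eq_sym 0) ?oner_eq0//; lra.
have struct x : O' x -> along e1 Zh x = (2 * s1) *: (along e2 Z x - ip (along e2 Z x) (Zh x) *: Z x)
                    - ip (along e1 Z x) (Zh x) *: Zh x /\
    along e2 Zh x = (2 * s2) *: (along e1 Z x - ip (along e1 Z x) (Zh x) *: Z x)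
                    - ip (along e2 Z x) (Zh x) *: Zh x.
  by move=> /model[_ _ _ h1 h2]; exact: conj h1 h2.
have comm := canonical_frame_commutes oO' Ce1 Ce2 CZ CZh c10 c20 det0 nullZ metric struct.
have [B [Phi [Psi [[oB BO'] Bx0 oPB PsiK [CPhi CPsi DPsi1 DPsi2]]]]] :=
  commuting_frame_coordinates oO' O'x0 Ce1 Ce2 det0 (fun x Ox => (comm x Ox).1).
have PB y : (Phi @` B) y -> B (Psi y) by move=> [x Bx <-]; rewrite PsiK.
have chain1 (g : V -> W) x : (forall k, Ck k O' g) -> B x -> 'D_d0 (g \o Psi) (Phi x) = along e1 g x.
  move=> Cg Bx; have PBx : (Phi @` B) (Phi x) by exists x.
  have dg : differentiable g (Psi (Phi x)) by rewrite PsiK//; exact: ((Cg 1%N).1 x (BO' x Bx)).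
  rewrite (derive_chain d0 ((CPsi 1%N).1 _ PBx) dg) DPsi1// PsiK//.
have chain2 (g : V -> W) x : (forall k, Ck k O' g) -> B x -> 'D_d1 (g \o Psi) (Phi x) = along e2 g x.
  move=> Cg Bx; have PBx : (Phi @` B) (Phi x) by exists x.
  have dg : differentiable g (Psi (Phi x)) by rewrite PsiK//; exact: ((Cg 1%N).1 x (BO' x Bx)).
  rewrite (derive_chain d1 ((CPsi 1%N).1 _ PBx) dg) DPsi2// PsiK//.
have CZ1 : forall k, Ck k O' (along e1 Z) by exact: smooth_along.
have CZ2 : forall k, Ck k O' (along e2 Z) by exact: smooth_along.
have second1 x : B x -> 'D_d0 (fun z => 'D_d0 (Z \o Psi) z) (Phi x) = along e1 (along e1 Z) x.
  move=> Bx; have PBx : (Phi @` B) (Phi x) by exists x.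
  apply: (etrans _ (chain1 _ x CZ1 Bx)); apply: near_eq_derive.
  apply: (open_nbhs_near oPB PBx) => _ [z Bz <-]; rewrite (chain1 _ z CZ Bz) /comp PsiK//.
have second2 x : B x -> 'D_d1 (fun z => 'D_d1 (Z \o Psi) z) (Phi x) = along e2 (along e2 Z) x.
  move=> Bx; have PBx : (Phi @` B) (Phi x) by exists x.
  apply: (etrans _ (chain2 _ x CZ2 Bx)); apply: near_eq_derive.
  apply: (open_nbhs_near oPB PBx) => _ [z Bz <-]; rewrite (chain2 _ z CZ Bz) /comp PsiK//.
exists B, Phi, Psi, la, mu, s1, s2; split.
- exact: And3 oB (subset_trans BO' O'O) Bx0.
- exact: And4 oPB PsiK CPhi CPsi.
- exact: conj ss1 ss2.
- split.
  + by move=> x /BO' /scal[].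
  + by move=> x /BO' /scal[].
  + by move=> k; exact: (Ck_sub BO' (Cla k)).
  + by move=> k; exact: (Ck_sub BO' (Cmu k)).
move=> _ [x Bx <-].
have Ox := BO' x Bx.
rewrite -/(Z (Psi (Phi x))) -/(Zh (Psi (Phi x))) PsiK//.
rewrite -[fun u => _]/(Z \o Psi) -[fun u => mu (Psi u) *: _]/(Zh \o Psi).
rewrite (chain1 _ x CZ Bx) (chain2 _ x CZ Bx) (chain1 _ x CZh Bx) (chain2 _ x CZh Bx).
have [_ [a [b key]]] := comm x Ox; have [h1 h2] := struct x Ox.
split; [exact: nullZ|exact: metric|exact: h1|exact: h2|].
exists (a / 2), (b / 2).
exact: (etrans (congr2 (fun A B => s2 *: A - s1 *: B) (second1 x Bx) (second2 x Bx))
  (halve_relation key)).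
Qed.

End FlatCoordinates.

(** * Second derivatives in adapted coordinates *)

Section SecondFundamentalForm.
Context {R : realType} (m s : nat).
Local Notation V := 'rV[R]_2.
Local Notation W := 'cV[R]_m.
Local Notation ip := (@ip R m s).
Local Notation d0 := (delta_mx 0 0 : V).
Local Notation d1 := (delta_mx 0 1 : V).

(** The coefficients of y in k1, k2 make them orthogonal to y01, as <y, y01>
    = -1/2; the remaining orthogonality comes from the differentiated
    normalization. Then k1 - e1 e2 k2 is a combination of y and yh, and its
    products with y and y01 show that both coefficients vanish, because <yh,
    y> = 1 and <y, y01> = -1/2. *)
Lemma kappa_algebra (y yh yu yv y00 y11 y01 : W) (e1 e2 a b : R) : e2 * e2 = 1 ->
  ip y y = 0 -> ip y yh = 1 -> ip y00 y = 0 -> ip y11 y = 0 -> ip yu y = 0 -> ip yv y = 0 ->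
  ip y00 yu = 0 -> ip y00 yv = 0 -> ip y11 yu = 0 -> ip y11 yv = 0 -> ip y01 y = - 2^-1 ->
  e2 *: y00 - e1 *: y11 = a *: y + b *: yh ->
  let k1 := y00 + (4 * ip y00 y01 / 2) *: y in
  let k2 := y11 + (4 * ip y11 y01 / 2) *: y in
  [/\ [/\ ip k1 y = 0, ip k1 yu = 0, ip k1 yv = 0 & ip k1 y01 = 0],
      [/\ ip k2 y = 0, ip k2 yu = 0, ip k2 yv = 0 & ip k2 y01 = 0] &
      k1 = (e1 * e2) *: k2].
Proof.
move=> ee yy yyh a0 a1 a2 a3 b1 b2 b3 b4 y01y key k1 k2.
have ny01 : ip y y01 = - 2^-1 by rewrite ipC.
have ortho z : ip z y = 0 -> ip z yu = 0 -> ip z yv = 0 ->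
   let k := z + (4 * ip z y01 / 2) *: y in [/\ ip k y = 0, ip k yu = 0, ip k yv = 0 & ip k y01 = 0].
  move=> h1 h2 h3 k; rewrite /k !ipE h1 h2 h3 yy ny01 ![ip y yu]ipC ![ip y yv]ipC a2 a3.
  by split; field.
have [p1 p1u p1v p1w] := ortho y00 a0 b1 b2; have [p2 p2u p2v p2w] := ortho y11 a1 b3 b4.
rewrite -/k1 -/k2 in p1 p1u p1v p1w p2 p2u p2v p2w.
split; [by split|by split|].
have [al [be E]] : exists al be, k1 - (e1 * e2) *: k2 = al *: y + be *: yh.
  exists (e2 * a + 2 * ip y00 y01 - (e1 * e2) * (2 * ip y11 y01)), (e2 * b).
  have key2 : y00 - (e1 * e2) *: y11 = (e2 * a) *: y + (e2 * b) *: yh.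
    by rewrite -!scalerA -scalerDr -key scalerBr !scalerA ee scale1r [e2 * e1]mulrC.
  have -> : k1 - (e1 * e2) *: k2 = (y00 - (e1 * e2) *: y11) + (2 * ip y00 y01 - e1 * e2 * (2 * ip y11 y01)) *: y.
    by rewrite /k1 /k2; apply/matrixP => i j; rewrite !mxE; field.
  by rewrite key2; apply/matrixP => i j; rewrite !mxE; ring.
have be0 : be = 0.
  have := congr1 (ip ^~ y) E; rewrite /= ipBl ipZl p1 p2 ipDl !ipZl yy [ip yh y]ipC yyh.
  by lra.
have al0 : al = 0.
  have := congr1 (ip ^~ y01) E; rewrite /= ipBl ipZl p1w p2w be0 ipDl !ipZl ny01.
  by lra.
by apply/eqP; rewrite -subr_eq0 E al0 be0 !scale0r addr0.
Qed.

(** The products required by [kappa_algebra], from the derivatives of the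
    constant products of y, yu and yv; y01 stands for the mixed derivative
    in either order. *)
Lemma kappa_differentiated (y yh yu yv y00 y11 y01 : W) (e1 e2 a b : R) : e2 * e2 = 1 ->
  ip y y = 0 -> ip y yh = 1 -> ip yu yu = 0 -> ip yv yv = 0 -> ip yu yv = 2^-1 ->
  ip yu y = 0 -> ip yv y = 0 ->
  ip y00 y + ip yu yu = 0 -> ip y11 y + ip yv yv = 0 -> ip y01 y + ip yv yu = 0 ->
  ip y00 yu + ip yu y00 = 0 -> ip y01 yu + ip yu y01 = 0 ->
  ip y01 yv + ip yv y01 = 0 -> ip y11 yv + ip yv y11 = 0 ->
  ip y00 yv + ip yu y01 = 0 -> ip y01 yv + ip yu y11 = 0 ->
  e2 *: y00 - e1 *: y11 = a *: y + b *: yh ->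
  let k1 := y00 + (4 * ip y00 y01 / 2) *: y in
  let k2 := y11 + (4 * ip y11 y01 / 2) *: y in
  [/\ [/\ ip k1 y = 0, ip k1 yu = 0, ip k1 yv = 0 & ip k1 y01 = 0],
      [/\ ip k2 y = 0, ip k2 yu = 0, ip k2 yv = 0 & ip k2 y01 = 0] &
      k1 = (e1 * e2) *: k2].
Proof.
move=> ee yy yyh n0 n1 n01 n0y n1y.
rewrite n0 n1 [ip yv yu]ipC n01 ![ip yu _]ipC ![ip yv _]ipC => c1 c2 c3 c4 c5 c6 c7 c8 c9 key.
have half (t : R) : t + t = 0 -> t = 0 by lra.
apply: (kappa_algebra ee yy yyh _ _ n0y n1y _ _ _ _ _ key); try exact: half; try lra; by move: (half _ c5) (half _ c6); lra.
Qed.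

(** In the notation of the canonical lift, the coefficient s_1 of Y_uu is 4
    <Y_uu, Y_uv>. *)
Definition kappa_relations (y yu yv y00 y11 y01 : W) (e : R) : Prop :=
  let k1 := y00 + (4 * ip y00 y01 / 2) *: y in
  let k2 := y11 + (4 * ip y11 y01 / 2) *: y in
  [/\ [/\ ip k1 y = 0, ip k1 yu = 0, ip k1 yv = 0 & ip k1 y01 = 0],
      [/\ ip k2 y = 0, ip k2 yu = 0, ip k2 yv = 0 & ip k2 y01 = 0] &
      k1 = e *: k2].

(** Differentiating the normal form supplies the hypotheses of
    [kappa_differentiated]; the two mixed derivatives agree by
    [derive_comm]. *)
Lemma adapted_kappa (U : set V) (y yh : V -> W) (e1 e2 : R) (u : V) : open U -> U u ->
  (forall k, Ck k U y) -> e2 * e2 = 1 -> adapted_pair s U y yh e1 e2 ->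
  kappa_relations (y u) ('D_d0 y u) ('D_d1 y u) ('D_d0 (fun z => 'D_d0 y z) u)
    ('D_d1 (fun z => 'D_d1 y z) u) ('D_d0 (fun z => 'D_d1 y z) u) (e1 * e2).
Proof.
move=> oU Uu Cy ee ad.
have dif v z : U z -> differentiable (fun z => 'D_v y z) z by exact: ((Cy 2%N).2 v).1.
have dy z : U z -> differentiable y z by exact: (Cy 1%N).1.
have const (f g : V -> W) c v : (forall z, U z -> differentiable f z) ->
    (forall z, U z -> differentiable g z) ->
    (forall z, U z -> ip (f z) (g z) = c) -> ip ('D_v f u) (g u) + ip (f u) ('D_v g u) = 0.
  move=> df dg fgc; rewrite -(derive_ip s v (df u Uu) (dg u Uu)).
  exact: (derive_locally_cst _ oU Uu fgc).
have nyy z : U z -> ip (y z) (y z) = 0 by move=> /ad[[]].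
have nyv v z : U z -> ip ('D_v y z) (y z) = 0 by move=> Uz; exact: (derive_null v oU Uz dy nyy).
have m0 z : U z -> ip ('D_d0 y z) ('D_d0 y z) = 0 by move=> /ad[_ []].
have m1 z : U z -> ip ('D_d1 y z) ('D_d1 y z) = 0 by move=> /ad[_ []].
have m2 z : U z -> ip ('D_d0 y z) ('D_d1 y z) = 2^-1 by move=> /ad[_ []].
have c1 := const _ _ _ d0 (dif d0) dy (nyv d0).
have c2 := const _ _ _ d1 (dif d1) dy (nyv d1).
have c3 := const _ _ _ d0 (dif d1) dy (nyv d1).
have c4 := const _ _ _ d0 (dif d0) (dif d0) m0.
have c5 := const _ _ _ d1 (dif d0) (dif d0) m0.
have c6 := const _ _ _ d0 (dif d1) (dif d1) m1.
have c7 := const _ _ _ d1 (dif d1) (dif d1) m1.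
have c8 := const _ _ _ d0 (dif d0) (dif d1) m2.
have c9 := const _ _ _ d1 (dif d0) (dif d1) m2.
have sym : 'D_d1 (fun z => 'D_d0 y z) u = 'D_d0 (fun z => 'D_d1 y z) u.
  exact: (derive_comm d0 d1 oU (Cy 3%N) Uu).
rewrite sym in c5 c9.
have [[yy _ yyh] [n0 n1 n01] _ _ [a [b key]]] := ad u Uu.
have n0y := nyv d0 u Uu; have n1y := nyv d1 u Uu.
exact: (kappa_differentiated ee yy yyh n0 n1 n01 n0y n1y c1 c2 c3 c4 c5 c6 c7 c8 c9 key).
Qed.

End SecondFundamentalForm.

(** * The symmetric decomposition of the orthogonal Lie algebra *)

Section Frames.
Context {R : realType} (n r : nat).
Local Notation W := 'cV[R]_n.+2.
Local Notation Mat := 'M[R]_n.+2.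
Local Notation ip := (@ip R n.+2 r.+1).

Definition planar (i : 'I_n.+2) : bool := (i == ord0) || (i == ord_max).
(** The plane and its complement are described by vanishing coordinates,
    which makes the action of the involution and of the eigenspaces
    immediate. *)
Definition in_plane (x : W) : Prop := forall i, ~~ planar i -> x i 0 = 0.
Definition off_plane (x : W) : Prop := forall i, planar i -> x i 0 = 0.

Lemma base_planeP (x : W) : x \in base_plane R n <-> in_plane x.
Proof.
split=> [/memv_addP[_ /vlineP[a ->] [_ /vlineP[b ->] ->]] i|xp].
  by rewrite negb_or !mxE => /andP[/negPf -> /negPf ->]; rewrite !mulr0 addr0.
have -> : x = x ord0 0 *: delta_mx ord0 ord0 + x ord_max 0 *: delta_mx ord_max ord0.
  apply/matrixP => i j; rewrite (ord1 j) !mxE !eqxx !andbT.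
  have [->|i0] := eqVneq i ord0; first by rewrite mulr1 mulr0 addr0.
  have [->|im] := eqVneq i ord_max; first by rewrite mulr0 mulr1 add0r.
  by rewrite !mulr0 addr0 xp// /planar negb_or i0 im.
by apply: memv_add; apply: rpredZ; exact: memv_line.
Qed.

Lemma ip_in_off (x w : W) : in_plane x -> off_plane w -> ip x w = 0.
Proof.
move=> xp wo; rewrite /Defs.ip big1// => i _.
by case pi : (planar i); [rewrite wo// mulr0|rewrite xp ?pi// mulr0 mul0r].
Qed.

Lemma off_planeP (w : W) : (forall x, in_plane x -> ip x w = 0) -> off_plane w.
Proof.
move=> h i pi; have := h (delta_mx i 0).
rewrite ipC ip_delta => /(_ _)/eqP; rewrite mulf_eq0 signr_eq0 => /= e; apply/eqP/e => j.
by rewrite mxE eqxx andbT; have [->|//] := eqVneq j i; rewrite pi.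
Qed.

Lemma in_planeP (w : W) : (forall i, ~~ planar i -> ip w (delta_mx i 0) = 0) -> in_plane w.
Proof.
by move=> h i pi; have /eqP := h i pi; rewrite ip_delta mulf_eq0 signr_eq0 => /eqP.
Qed.

Lemma off_delta i : ~~ planar i -> off_plane (delta_mx i 0).
Proof. by move=> pi j pj; rewrite mxE eqxx andbT; case: eqVneq pj pi => // -> ->. Qed.

Lemma base_involution_mul (x : W) i :
  (base_involution R n *m x) i 0 = (if planar i then -1 else 1) * x i 0.
Proof.
rewrite mxE (bigD1 i)//= big1 ?addr0 => [|j ji]; first by rewrite !mxE eqxx.
by rewrite mxE eq_sym (negPf ji) mul0r.
Qed.

Lemma base_involutionK (x : W) : base_involution R n *m (base_involution R n *m x) = x.
Proof.
apply/matrixP => i j; rewrite (ord1 j) !base_involution_mul.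
by case: (planar i); ring.
Qed.

Lemma ip_base_involution (x y : W) :
  ip (base_involution R n *m x) (base_involution R n *m y) = ip x y.
Proof.
apply: eq_bigr => i _; rewrite !base_involution_mul.
by case: (planar i); ring.
Qed.

Lemma p_part_mul (X : Mat) (x : W) : Defs.p_part X *m x =
  2^-1 *: (X *m x - base_involution R n *m (X *m (base_involution R n *m x))).
Proof. by rewrite /Defs.p_part /sigma -scalemxAl mulmxBl !mulmxA. Qed.

Lemma involution_in (x : W) : in_plane x -> base_involution R n *m x = - x.
Proof.
move=> xp; apply/matrixP => i j; rewrite (ord1 j) base_involution_mul mxE.
by case pi : (planar i); [ring|rewrite xp ?pi//; ring].
Qed.

Lemma involution_off (x : W) : off_plane x -> base_involution R n *m x = x.
Proof.
move=> xp; apply/matrixP => i j; rewrite (ord1 j) base_involution_mul.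
by case pi : (planar i); [rewrite xp//; ring|ring].
Qed.

Lemma p_part_in (X : Mat) (x : W) : in_plane x -> off_plane (Defs.p_part X *m x).
Proof.
move=> xp i pi; rewrite p_part_mul (involution_in xp) mulmxN mulmxN opprK.
by rewrite [in LHS]mxE [in LHS]mxE base_involution_mul pi; ring.
Qed.

Lemma p_part_off (X : Mat) (x : W) : off_plane x -> in_plane (Defs.p_part X *m x).
Proof.
move=> xp i /negPf pi; rewrite p_part_mul (involution_off xp).
by rewrite [in LHS]mxE [in LHS]mxE [X in _ + X]mxE base_involution_mul pi; ring.
Qed.

(** The component of X in the +1-eigenspace preserves the plane. *)
Lemma p_part_diff (X : Mat) (x : W) : in_plane x -> in_plane (X *m x - Defs.p_part X *m x).
Proof.
move=> xp i /negPf pi; rewrite p_part_mul (involution_in xp) mulmxN mulmxN opprK.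
rewrite mxE [X in _ + X]mxE [X in _ - X]mxE [X in _ - _ * X]mxE base_involution_mul pi.
by field.
Qed.

Lemma p_part_in_g (X : Mat) : in_g r X -> in_g r (Defs.p_part X).
Proof.
move=> gX x y; rewrite !p_part_mul !ipE.
pose S := base_involution R n.
have -> : ip (S *m (X *m (S *m x))) y = ip (X *m (S *m x)) (S *m y).
  by rewrite -{1}[y]base_involutionK ip_base_involution.
have -> : ip x (S *m (X *m (S *m y))) = ip (S *m x) (X *m (S *m y)).
  by rewrite -{1}[x]base_involutionK ip_base_involution.
have h1 := gX x y; have h2 := gX (S *m x) (S *m y).
by rewrite -/S; lra.
Qed.

Lemma p_part_linear : linear (@Defs.p_part R n).
Proof.
move=> a X Y; rewrite /Defs.p_part /sigma !(mulmxDr, mulmxDl) -!(scalemxAr, scalemxAl).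
by apply/matrixP => i j; rewrite !mxE; ring.
Qed.

(** An isometry of a non-degenerate form has trivial kernel. *)
Lemma in_G_unit (g : Mat) : in_G r g -> g \in unitmx.
Proof.
move=> Gg; rewrite -unitmx_tr -row_free_unit; apply/row_freeP.
suff /row_freeP[B BE] : row_free g^T by exists B.
rewrite -kermx_eq0; apply/eqP/row_matrixP => i; rewrite row0.
set v := row i _; have vK : v *m g^T = 0 by rewrite /v -row_mul mulmx_ker row0.
have gv : g *m v^T = 0 by rewrite -[LHS]trmxK trmx_mul trmxK vK trmx0.
suff : v^T = 0 by move=> e; rewrite -[v]trmxK e trmx0.
by apply: (@ip_nondeg _ _ r.+1) => y; rewrite -(Gg v^T y) gv ip0l.
Qed.

Lemma mem_image_plane (F : Mat) (x : W) : in_plane x ->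
  F *m x \in (linfun (mulmx F) @: base_plane R n)%VS.
Proof. by move=> /base_planeP xp; rewrite -[F *m x]/(mulmx F x) -(lfunE (mulmx F)) memv_img. Qed.

Lemma image_planeP (F : Mat) (x : W) : x \in (linfun (mulmx F) @: base_plane R n)%VS ->
  exists2 z, in_plane z & x = F *m z.
Proof. by move=> /memv_imgP[z /base_planeP zp ->]; exists z => //; rewrite lfunE. Qed.

End Frames.

(** * Commuting elements of the -1-eigenspace *)

Section FlatAlgebra.
Context {R : realType} (n r : nat).
Local Notation W := 'cV[R]_n.+2.
Local Notation Mat := 'M[R]_n.+2.
Local Notation ip := (@ip R n.+2 r.+1).

(** Flatness for single tangent vectors, so that it can be moved by
    isometries and compared with brackets. *)
Definition flat_vec (y yh na nb nha nhb : W) : Prop :=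
  ip na nhb = ip nb nha /\
  forall w, ip w y = 0 -> ip w yh = 0 ->
    ip w nhb *: na + ip w nb *: nha = ip w nha *: nb + ip w na *: nhb.

Lemma flat_vec_G (F : Mat) (y yh na nb nha nhb : W) : in_G r F ->
  flat_vec (F *m y) (F *m yh) (F *m na) (F *m nb) (F *m nha) (F *m nhb) <->
  flat_vec y yh na nb nha nhb.
Proof.
move=> GF; have FU := in_G_unit GF; split=> [[h1 h2]|[h1 h2]]; split.
- by move: h1; rewrite !GF.
- move=> w wy wyh; have := h2 (F *m w); rewrite !GF => /(_ wy wyh).
  rewrite !scalemxAr -!mulmxDr => /(congr1 (mulmx (invmx F))).
  by rewrite !mulmxA mulVmx// !mul1mx.
- by rewrite !GF.
- move=> w wy wyh; have e v : ip w (F *m v) = ip (invmx F *m w) v.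
    by rewrite -(GF (invmx F *m w) v) mulmxA mulmxV// mul1mx.
  rewrite !e !scalemxAr -!mulmxDr; congr (_ *m _); apply: h2; by rewrite -e.
Qed.

Section LieBracket.
Variables (y yh : W) (P Q : Mat).
Hypotheses (yp : in_plane y) (yhp : in_plane yh).
Hypotheses (yy : ip y y = 0) (yhyh : ip yh yh = 0) (yyh : ip y yh != 0).
Hypothesis spanP : forall x : W, in_plane x -> exists a b, x = a *: y + b *: yh.
Hypotheses (gP : in_g r P) (gQ : in_g r Q).
Hypotheses (Pio : forall x, in_plane x -> off_plane (P *m x))
           (Poi : forall x, off_plane x -> in_plane (P *m x)).
Hypotheses (Qio : forall x, in_plane x -> off_plane (Q *m x))
           (Qoi : forall x, off_plane x -> in_plane (Q *m x)).

Lemma plane_coords (x : W) : in_plane x ->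
  x = (ip x yh / ip y yh) *: y + (ip x y / ip y yh) *: yh.
Proof.
move=> /spanP[a [b ->]]; rewrite !ipE [ip yh y]ipC yy yhyh.
by rewrite !mulr0 addr0 add0r !mulfK.
Qed.

Lemma skewP (X : Mat) (u v : W) : in_g r X -> ip (X *m u) v = - ip u (X *m v).
Proof. by move=> /(_ u v) h; apply/eqP; rewrite -addr_eq0 h. Qed.

(** As X' is skew, the coordinates of X' w in the basis y, yh are, up to the
    factor -1/<y, yh>, the products of w with X' yh and X' y. *)
Lemma product_off (X X' : Mat) (w : W) : in_g r X' -> in_plane (X' *m w) ->
  X *m (X' *m w) = - (ip y yh)^-1 *:
    (ip w (X' *m yh) *: (X *m y) + ip w (X' *m y) *: (X *m yh)).
Proof.
move=> gX' /plane_coords ->.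
rewrite mulmxDr -!scalemxAr !(skewP _ _ gX') scalerDr !scalerA.
by congr (_ *: _ + _ *: _); ring.
Qed.

Lemma off_of_orth (w : W) : ip w y = 0 -> ip w yh = 0 -> off_plane w.
Proof.
move=> wy wyh; apply: (off_planeP (r := r)) => x /spanP[a [b ->]].
by rewrite !ipE [ip y w]ipC [ip yh w]ipC wy wyh !mulr0 addr0.
Qed.

(** Both products P Q and Q P preserve the plane and its complement. On the
    complement [product_off] turns commuting into the second equation of
    flatness. On the plane the bracket is a skew endomorphism of a
    2-dimensional space, which has a single entry; its vanishing is the
    first equation. *)
Lemma lie_flat : lie P Q = 0 <-> flat_vec y yh (P *m y) (Q *m y) (P *m yh) (Q *m yh).
Proof.
have c0 : - (ip y yh)^-1 != 0 by rewrite oppr_eq0 invr_eq0.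
split=> [/eqP|[sym fl]].
  rewrite subr_eq0 => /eqP PQ; split.
    have := congr1 (fun Z : Mat => ip (Z *m y) yh) PQ; rewrite /= -!mulmxA.
    rewrite [LHS](skewP _ _ gP) [RHS](skewP _ _ gQ) => /eqP; rewrite eqr_opp => /eqP.
    exact: esym.
  move=> w wy wyh; have wo := off_of_orth wy wyh.
  apply: (scalerI c0); rewrite -(product_off P gQ (Qoi wo)).
  by rewrite [X in _ *: X]addrC [X in _ *: X]addrC -(product_off Q gP (Poi wo)) !mulmxA PQ.
have off w : off_plane w -> P *m (Q *m w) = Q *m (P *m w).
  move=> wo; rewrite (product_off P gQ (Qoi wo)) (product_off Q gP (Poi wo)); congr (_ *: _).
  by apply: fl; rewrite ipC; exact: ip_in_off.
have eP u v : ip (P *m (Q *m u)) v = - ip (Q *m u) (P *m v) by exact: skewP.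
have eQ u v : ip (Q *m (P *m u)) v = - ip (P *m u) (Q *m v) by exact: skewP.
have iny : P *m (Q *m y) = Q *m (P *m y).
  rewrite [LHS]plane_coords; last exact/Poi/Qio.
  rewrite [RHS]plane_coords; last exact/Qoi/Pio.
  by rewrite !eP !eQ sym [ip (P *m y) (Q *m y)]ipC.
have inyh : P *m (Q *m yh) = Q *m (P *m yh).
  rewrite [LHS]plane_coords; last exact/Poi/Qio.
  rewrite [RHS]plane_coords; last exact/Qoi/Pio.
  by rewrite !eP !eQ [ip (Q *m yh) (P *m y)]ipC sym [ip (Q *m y) _]ipC [ip (P *m yh) (Q *m yh)]ipC.
apply/matrixP => i j; rewrite [RHS]mxE.
pose x : W := delta_mx j 0.
suff : lie P Q *m x = 0 by move=> /(congr1 (fun v : W => v i 0)); rewrite /x -colE !mxE.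
rewrite /lie mulmxBl -!mulmxA; apply/eqP; rewrite subr_eq0; apply/eqP.
have [jp|jp] := boolP (planar j); last by apply: off; exact: off_delta.
have /spanP[a [b ->]] : in_plane x.
  by move=> k kp; rewrite /x mxE eqxx andbT; case: eqVneq kp => // ->; rewrite jp.
by rewrite !mulmxDr -!scalemxAr iny inyh.
Qed.

End LieBracket.
End FlatAlgebra.

(** * The Maurer-Cartan form of a frame *)

Section MaurerCartan.
Context {R : realType} (n r : nat).
Local Notation V := 'rV[R]_2.
Local Notation W := 'cV[R]_n.+2.
Local Notation Mat := 'M[R]_n.+2.
Local Notation ip := (@ip R n.+2 r.+1).

Lemma is_diff_mulmx_vec (F : V -> Mat) (u : W) x : differentiable F x ->
  differentiable (fun z => F z *m u) x /\ forall a, 'D_a (fun z => F z *m u) x = 'D_a F x *m u.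
Proof.
move=> dF.
have dFij i j : differentiable (fun z => F z i j) x by move/differentiable_mxP : dF; apply.
have dFu i j : differentiable (fun z => F z i j * u j 0) x.
  exact: (differentiableM (dFij i j) (differentiable_cst (u j 0) x)).
have E i j : (fun z => (F z *m u) i j) = \sum_(k < n.+2) (fun z => F z i k * u k 0).
  by apply/funext => z; rewrite (ord1 j) mxE fct_sumE.
have dFu' : differentiable (fun z => F z *m u) x.
  by apply/differentiable_mxP => i j; rewrite E; apply: differentiable_sum => k; exact: dFu.
split=> // a; apply/matrixP => i j.
apply: (etrans (derive_mxE i j (diff_derivable dFu'))).
rewrite E derive_sum; last by move=> k; apply: diff_derivable; exact: dFu.
rewrite mxE (ord1 j); apply: eq_bigr => k _.
apply: (etrans (derive_mul a (dFij i k) (differentiable_cst (u k 0) x))).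
rewrite derive_cst mulr0 add0r mulrC; congr (_ * _).
exact: esym (derive_mxE i k (diff_derivable dF)).
Qed.

(** The Maurer-Cartan form F^-1 dF. *)
Definition mc (F : V -> Mat) (x a : V) : Mat := invmx (F x) *m 'D_a F x.

Variables (O : set V) (F : V -> Mat).
Hypotheses (oO : open O) (dF : forall z, O z -> differentiable F z)
  (GF : forall z, O z -> in_G r (F z)).

Lemma mul_mc x a : O x -> F x *m mc F x a = 'D_a F x.
Proof. by move=> Ox; rewrite /mc mulmxA mulmxV ?mul1mx//; exact/in_G_unit/GF. Qed.

(** The derivative of <F u, F v> = <u, v>. *)
Lemma mc_in_g x a : O x -> in_g r (mc F x a).
Proof.
move=> Ox u v; have [du Du] := is_diff_mulmx_vec u (dF Ox).
have [dv Dv] := is_diff_mulmx_vec v (dF Ox).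
have := derive_locally_cst a oO Ox (fun z Oz => GF Oz u v).
rewrite (derive_ip r.+1 a du dv) Du Dv -!(mul_mc a Ox) -!mulmxA !GF//.
Qed.

(** Write Y = F w with w in the plane. The product of Y with the image under
    F of the complement is zero; its derivative shows that F^-1 dY and the
    p-part of F^-1 dF applied to eta differ by a vector in the plane. Its
    component along yh vanishes because Y is null, and tproj removes the
    component along Y. *)
Lemma frame_tangent (Y : V -> W) (yh : W) x a (eta etah : W) : O x ->
  (forall z, O z -> differentiable Y z) ->
  (forall z, O z -> exists2 w, in_plane w & Y z = F z *m w) ->
  Y x = F x *m eta -> yh = F x *m etah -> in_plane eta -> in_plane etah ->
  (forall w, in_plane w -> exists s t, w = s *: eta + t *: etah) ->
  ip (Y x) (Y x) = 0 -> ip (Y x) yh != 0 -> ip ('D_a Y x) (Y x) = 0 ->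
  tproj r.+1 (Y x) yh ('D_a Y x) = F x *m (Defs.p_part (mc F x a) *m eta).
Proof.
move=> Ox dY Yp Ye yhe ep ehp span yy yyh yay.
have GFx := GF Ox; have FU := in_G_unit GFx.
have [s [t E]] : exists s t, invmx (F x) *m 'D_a Y x - Defs.p_part (mc F x a) *m eta = s *: eta + t *: etah.
  apply: span; apply: (in_planeP (r := r)) => j pj.
  have dj : off_plane (delta_mx j 0 : W) by exact: off_delta.
  have [dFj DFj] := is_diff_mulmx_vec (delta_mx j 0) (dF Ox).
  have h : forall z, O z -> ip (Y z) (F z *m delta_mx j 0) = 0.
    by move=> z Oz; have [w wp ->] := Yp z Oz; rewrite GF//; exact: ip_in_off.
  have := derive_locally_cst a oO Ox h; rewrite (derive_ip r.+1 a (dY x Ox) dFj) DFj.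
  rewrite -(mul_mc a Ox) Ye -mulmxA GFx => k.
  have gX := mc_in_g a Ox eta (delta_mx j 0).
  have k2 : ip ('D_a Y x) (F x *m delta_mx j 0) = ip (invmx (F x) *m 'D_a Y x) (delta_mx j 0).
    by rewrite -(GFx _ (delta_mx j 0)) mulmxA mulmxV// mul1mx.
  have k3 := ip_in_off r (p_part_diff (mc F x a) ep) dj.
  by rewrite k2 in k; rewrite ipBl in k3; rewrite ipBl; lra.
have DE : 'D_a Y x = F x *m (Defs.p_part (mc F x a) *m eta) + s *: Y x + t *: yh.
  rewrite Ye yhe !scalemxAr -addrA -!mulmxDr -E addrC subrK mulmxA mulmxV// mul1mx//.
have po : off_plane (Defs.p_part (mc F x a) *m eta) by exact: p_part_in.
have orth w : in_plane w -> ip (F x *m (Defs.p_part (mc F x a) *m eta)) (F x *m w) = 0.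
  by move=> wp; rewrite GFx ipC; exact: ip_in_off.
have oy : ip (F x *m (Defs.p_part (mc F x a) *m eta)) (Y x) = 0 by rewrite Ye; exact: orth.
have oyh : ip (F x *m (Defs.p_part (mc F x a) *m eta)) yh = 0 by rewrite yhe; exact: orth.
move: (F x *m _) DE oy oyh => N DE oy oyh.
have t0 : t = 0.
  move: yay; rewrite DE !ipE oy yy mulr0 !add0r => /eqP.
  by rewrite mulf_eq0 [ip yh _]ipC (negPf yyh) orbF => /eqP.
rewrite /tproj DE t0 scale0r addr0 !ipE oyh add0r mulfK//.
by rewrite addrK.
Qed.

Section PlaneField.
Variables (Y Yh : V -> W) (x : V).
Hypotheses (Ox : O x) (dY : forall z, O z -> differentiable Y z)
  (dYh : forall z, O z -> differentiable Yh z)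
  (FP : forall z, O z -> (linfun (mulmx (F z)) @: base_plane R n)%VS = (<[Y z]> + <[Yh z]>)%VS)
  (yy : forall z, O z -> ip (Y z) (Y z) = 0)
  (yhyh : forall z, O z -> ip (Yh z) (Yh z) = 0)
  (yyh : ip (Y x) (Yh x) != 0).

Lemma plane_lift_l z : O z -> exists2 w, in_plane w & Y z = F z *m w.
Proof.
by move=> Oz; apply: image_planeP; rewrite FP//; apply: subvP (addvSl _ _) _ (memv_line _).
Qed.

Lemma plane_lift_r z : O z -> exists2 w, in_plane w & Yh z = F z *m w.
Proof.
by move=> Oz; apply: image_planeP; rewrite FP//; apply: subvP (addvSr _ _) _ (memv_line _).
Qed.

Lemma plane_span eta etah w : Y x = F x *m eta -> Yh x = F x *m etah -> in_plane w ->
  exists s t, w = s *: eta + t *: etah.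
Proof.
have FU := in_G_unit (GF Ox) => Ye Yhe.
move=> /(mem_image_plane (F x)); rewrite FP// => /memv_addP[_ /vlineP[s ->] [_ /vlineP[t ->]]].
rewrite Ye Yhe !scalemxAr -mulmxDr => /(congr1 (mulmx (invmx (F x)))).
by rewrite !mulmxA mulVmx// !mul1mx => ->; exists s, t.
Qed.

Lemma frame_tproj_l a : tproj r.+1 (Y x) (Yh x) ('D_a Y x) =
  F x *m (Defs.p_part (mc F x a) *m (invmx (F x) *m Y x)).
Proof.
have [eta ep Ye] := plane_lift_l Ox; have [etah ehp Yhe] := plane_lift_r Ox.
have span w := @plane_span eta etah w Ye Yhe.
have yay : ip ('D_a Y x) (Y x) = 0 by exact: derive_null oO Ox dY yy.
rewrite (frame_tangent Ox dY plane_lift_l Ye Yhe ep ehp span (yy Ox) yyh yay).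
by rewrite Ye mulKmx//; exact/in_G_unit/GF.
Qed.

Lemma frame_tproj_r a : tproj r.+1 (Yh x) (Y x) ('D_a Yh x) =
  F x *m (Defs.p_part (mc F x a) *m (invmx (F x) *m Yh x)).
Proof.
have [eta ep Ye] := plane_lift_l Ox; have [etah ehp Yhe] := plane_lift_r Ox.
have span w : in_plane w -> exists s t, w = s *: etah + t *: eta.
  by move=> /(plane_span Ye Yhe)[s [t ->]]; exists t, s; rewrite addrC.
have yay : ip ('D_a Yh x) (Yh x) = 0 by exact: derive_null oO Ox dYh yhyh.
have yhy : ip (Yh x) (Y x) != 0 by rewrite ipC.
rewrite (frame_tangent Ox dYh plane_lift_r Yhe Ye ehp ep span (yhyh Ox) yhy yay).
by rewrite Yhe mulKmx//; exact/in_G_unit/GF.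
Qed.

(** The isometry F x moves everything to the fixed plane, where [lie_flat]
    applies. *)
Lemma flat_at_lie : flat_at r.+1 Y Yh x <->
  forall a b, lie (Defs.p_part (mc F x a)) (Defs.p_part (mc F x b)) = 0.
Proof.
have GFx := GF Ox; have FU := in_G_unit GFx.
have [eta ep Ye] := plane_lift_l Ox; have [etah ehp Yhe] := plane_lift_r Ox.
have span w := @plane_span eta etah w Ye Yhe.
have pg a : in_g r (Defs.p_part (mc F x a)) by apply: p_part_in_g; exact: mc_in_g.
have ee : ip eta eta = 0 by have := yy Ox; rewrite Ye GFx.
have eheh : ip etah etah = 0 by have := yhyh Ox; rewrite Yhe GFx.
have eeh : ip eta etah != 0 by move: yyh; rewrite Ye Yhe GFx.
have pio a w : in_plane w -> off_plane (Defs.p_part (mc F x a) *m w) by exact: p_part_in.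
have poi a w : off_plane w -> in_plane (Defs.p_part (mc F x a) *m w) by exact: p_part_off.
have key a b := lie_flat ep ehp ee eheh eeh span (pg a) (pg b) (pio a) (poi a) (pio b) (poi b).
have T a : tproj r.+1 (Y x) (Yh x) ('D_a Y x) = F x *m (Defs.p_part (mc F x a) *m eta).
  by apply: (etrans (frame_tproj_l a)); rewrite Ye (mulKmx FU).
have Th a : tproj r.+1 (Yh x) (Y x) ('D_a Yh x) = F x *m (Defs.p_part (mc F x a) *m etah).
  by apply: (etrans (frame_tproj_r a)); rewrite Yhe (mulKmx FU).
have vec a b : flat_vec r (Y x) (Yh x) (tproj r.+1 (Y x) (Yh x) ('D_a Y x)) (tproj r.+1 (Y x) (Yh x) ('D_b Y x))
    (tproj r.+1 (Yh x) (Y x) ('D_a Yh x)) (tproj r.+1 (Yh x) (Y x) ('D_b Yh x)) <->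
    lie (Defs.p_part (mc F x a)) (Defs.p_part (mc F x b)) = 0.
  rewrite !T !Th {1}Ye {1}Yhe.
  apply: iff_trans (flat_vec_G _ _ _ _ _ _ GFx) _.
  exact: iff_sym (key a b).
split=> [fl a b|fl a b]; first by apply/vec; exact: (fl a b).
exact/vec/fl.
Qed.

End PlaneField.

End MaurerCartan.

(** * Charts and changes of coordinates *)

Section Charts.
Context {R : realType} (M : surface R).
Local Notation V := 'rV[R]_2.
Implicit Types (c d e : chart R M) (p : M).

Lemma crange_cmap c p : cdom c p -> crange c (cmap c p).
Proof. by exists p. Qed.

Lemma cinvK c x : is_chart c -> crange c x -> cdom c (cinv c x) /\ cmap c (cinv c x) = x.
Proof. by move=> [_ _ K _ _] [p pc <-]; rewrite K. Qed.

Lemma open_chart_image c (U : set M) : is_chart c -> open U ->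
  open (cmap c @` (cdom c `&` U)).
Proof.
move=> [oc orc K cm ci] oU; rewrite openE => _ [p [pc pU] <-].
have ci' := ci _ (crange_cmap pc).
have h1 : \forall x \near cmap c p, crange c x.
  by apply: open_nbhs_nbhs; split=> //; exact: crange_cmap.
have h2 : \forall x \near cmap c p, (cdom c `&` U) (cinv c x).
  apply: ci'; rewrite K//; apply: open_nbhs_nbhs; split; [exact: openI|by split].
apply: filterS2 h1 h2 => x [q qc qx] xU.
by exists (cinv c x) => //; rewrite -qx K.
Qed.

Lemma open_chart_preimage c (B : set V) : is_chart c -> open B ->
  open (cdom c `&` cmap c @^-1` B).
Proof.
move=> [oc _ _ cm _] oB; rewrite openE => p [pc pB].
have h1 : \forall q \near p, cdom c q by apply: open_nbhs_nbhs.
have h2 : \forall q \near p, B (cmap c q).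
  by apply: (cm p pc); apply: open_nbhs_nbhs.
by apply: filterS2 h1 h2 => q qc qB; split.
Qed.

Lemma transition_smooth c d : atlas c -> atlas d ->
  forall k, Ck k (cmap c @` (cdom c `&` cdom d)) (cmap d \o cinv c).
Proof. by move=> ac ad; apply/smooth_onP; case: (atlas_compatible ac ad). Qed.

Lemma open_transition c d : atlas c -> atlas d -> open (cmap c @` (cdom c `&` cdom d)).
Proof.
move=> ac ad; apply: open_chart_image; first exact: atlas_chart.
by case: (atlas_chart ad).
Qed.

Definition reparam c (B : set V) (Phi Psi : V -> V) : chart R M :=
  Chart (cdom c `&` cmap c @^-1` B) (Phi \o cmap c) (cinv c \o Psi).

Section Reparametrization.
Variables (c : chart R M) (B : set V) (Phi Psi : V -> V).
Hypotheses (ac : atlas c) (oB : open B) (BO : B `<=` crange c)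
  (oPB : open (Phi @` B)) (PsiK : forall x, B x -> Psi (Phi x) = x)
  (CPhi : forall k, Ck k B Phi) (CPsi : forall k, Ck k (Phi @` B) Psi).
Let d := reparam c B Phi Psi.

Lemma crange_reparam : crange d = Phi @` B.
Proof.
apply/seteqP; split=> [_ [p [pc pB] <-]|_ [x Bx <-]]; first by exists (cmap c p).
have [h1 h2] := cinvK (atlas_chart ac) (BO Bx).
by exists (cinv c x); [split=> //; rewrite /preimage/= h2|rewrite /= h2].
Qed.

Lemma is_chart_reparam : is_chart d.
Proof.
have ic := atlas_chart ac; have [oc orc K cm ci] := ic.
split.
- exact: open_chart_preimage.
- by rewrite crange_reparam.
- by move=> p [pc pB]; rewrite /= PsiK// K.
- move=> p [pc pB]; apply: continuous_comp; first exact: cm.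
  exact: (Ck_continuous (CPhi 1%N) pB).
- move=> y; rewrite crange_reparam => yB; have [x Bx xE] := yB.
  apply: continuous_comp; first exact: (Ck_continuous (CPsi 1%N) yB).
  by apply: ci; rewrite -xE PsiK//; exact: BO.
Qed.

(** Members of the atlas are exactly the local coordinate systems:
    compatibility with every chart is the chain rule, and the atlas is
    maximal. *)
Lemma atlas_reparam : atlas d.
Proof.
apply: atlas_maximal => [|e ae]; first exact: is_chart_reparam.
have id := is_chart_reparam; have [ode _ _ _ _] := id.
have ic := atlas_chart ac; have ie := atlas_chart ae.
have [oc orc Kc _ _] := ic; have [oe ore Ke _ _] := ie.
split; apply/smooth_onP => k.
- have oO := open_chart_image id oe.
  rewrite /= -[cmap e \o _]/((cmap e \o cinv c) \o Psi).
  apply: (Ck_comp oO (open_transition ac ae)).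
  + by move=> _ [p [[pc pB] pe] <-]; exists p => //=; rewrite PsiK.
  + apply: Ck_sub (CPsi k) => _ [p [[pc pB] pe] <-]; by exists (cmap c p).
  + exact: transition_smooth.
- have oO := open_chart_image ie ode.
  rewrite /= -[(Phi \o _) \o _]/(Phi \o (cmap c \o cinv e)).
  apply: (Ck_comp oO oB _ _ (CPhi k)).
  + by move=> _ [p [pe [pc pB]] <-] /=; rewrite Ke.
  + by apply: Ck_sub (transition_smooth ae ac k) => _ [p [pe [pc pB]] <-]; exists p.
Qed.

End Reparametrization.

Lemma smooth_fun_chart m n (c : chart R M) (U : set M) (g : M -> 'M[R]_(m, n)) :
  atlas c -> smooth_fun U g -> forall k, Ck k (cmap c @` (cdom c `&` U)) (g \o cinv c).
Proof. by move=> ac sg; apply/smooth_onP; exact: sg. Qed.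

Lemma chart_smooth_fun m n (c : chart R M) (g : M -> 'M[R]_(m, n)) :
  atlas c -> (forall k, Ck k (crange c) (g \o cinv c)) -> smooth_fun (cdom c) g.
Proof.
move=> ac Cg e ae; apply/smooth_onP => k.
have ic := atlas_chart ac; have ie := atlas_chart ae.
have [oc orc Kc _ _] := ic; have [oe ore Ke _ _] := ie.
have oO := open_chart_image ie oc.
apply: (@Ck_ext _ _ _ _ ((g \o cinv c) \o (cmap c \o cinv e))) => //.
  by move=> _ [p [pe pc] <-] /=; rewrite Ke// Kc.
apply: (Ck_comp oO orc _ (transition_smooth ae ac k) (Cg k)).
by move=> _ [p [pe pc] <-] /=; rewrite Ke//; exact: crange_cmap.
Qed.

(** The components in the chart c of the tangent vector with components a in
    the chart d. *)
Definition chart_jacobian c d p (a : V) : V := 'D_a (cmap c \o cinv d) (cmap d p).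

Section ChartChange.
Variables (c d : chart R M) (p : M).
Hypotheses (ac : atlas c) (ad : atlas d) (pc : cdom c p) (pd : cdom d p).

Lemma transition_differentiable : differentiable (cmap c \o cinv d) (cmap d p).
Proof. by apply: ((transition_smooth ad ac) 1%N).1; exists p. Qed.

Lemma dchart_change (W : normedModType R) (g : M -> W) a :
  differentiable (g \o cinv c) (cmap c p) ->
  dchart d a g p = dchart c (chart_jacobian c d p a) g p.
Proof.
have [_ _ Kc _ _] := atlas_chart ac; have [_ _ Kd _ _] := atlas_chart ad.
move=> dg; have dt := transition_differentiable.
have E : (cmap c \o cinv d) (cmap d p) = cmap c p by rewrite /= Kd.
rewrite /dchart -[in RHS]E /chart_jacobian -derive_chain//; last by rewrite E.
apply: near_eq_derive; apply: (open_nbhs_near (open_transition ad ac)); first by exists p.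
by move=> _ [q [qd qc] <-] /=; rewrite Kd// Kc.
Qed.

End ChartChange.

Lemma chart_jacobian_inj c d p a : atlas c -> atlas d -> cdom c p -> cdom d p ->
  chart_jacobian c d p a = 0 -> a = 0.
Proof.
move=> ac ad pc pd ja; have [_ _ Kc _ _] := atlas_chart ac; have [_ _ Kd _ _] := atlas_chart ad.
have := dchart_change ac ad pc pd a (transition_differentiable ad ac pd pc).
rewrite ja /dchart derive0 => <-; rewrite -[LHS](derive_id (cmap d p)).
apply: near_eq_derive; apply: (open_nbhs_near (open_transition ad ac)); first by exists p.
by move=> _ [q [qd qc] <-] /=; rewrite Kd.
Qed.

End Charts.

(** * Lifts, frames and the curved flat equation *)

Section Lifts.
Context {R : realType} (n r : nat) (M : surface R).
Local Notation V := 'rV[R]_2.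
Local Notation W := 'cV[R]_n.+2.
Local Notation Mat := 'M[R]_n.+2.
Local Notation ip := (@ip R n.+2 r.+1).
Variables (f : M -> lorentz_plane R n r) (y yh : M -> quadric R n r).
Hypothesis hfy : forall p : M, lplane (f p) = (qline (y p) + qline (yh p))%VS.

Lemma lift_null (u : M -> quadric R n r) (U : set M) Y p : local_lift u U Y -> U p -> ip (Y p) (Y p) = 0.
Proof.
by move=> [_ _ h] Up; have [_ E] := h p Up; apply: (qline_null (q := u p)); rewrite -E memv_line.
Qed.

(** A plane spanned by two orthogonal null lines is totally null, hence not
    Lorentzian. *)
Lemma lift_pairing (U U' : set M) Y Yh p : local_lift y U Y -> local_lift yh U' Yh ->
  U p -> U' p -> ip (Y p) (Yh p) != 0.
Proof.
move=> lY lYh Up U'p; have n1 := lift_null lY Up; have n2 := lift_null lYh U'p.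
have [_ _ h1] := lY; have [_ _ h2] := lYh.
have [_ E1] := h1 p Up; have [_ E2] := h2 p U'p.
have [x1 [_ [x1f _ x11 _ _]]] := lplane_lorentzian (f p).
move: x1f; rewrite hfy -E1 -E2 => /memv_addP[_ /vlineP[a ->] [_ /vlineP[b ->] xE]].
move: x11; rewrite xE !ipE n1 n2 [ip (Yh p) _]ipC => h; apply/eqP => e.
by move: h; rewrite e !mulr0 !addr0 => /eqP; rewrite eq_sym oner_eq0.
Qed.

Section InChart.
Variables (c : chart R M) (U U1 U2 : set M) (F : M -> Mat) (Y Yh : M -> W).
Hypotheses (ac : atlas c) (lF : local_frame f U F)
  (lY : local_lift y U1 Y) (lYh : local_lift yh U2 Yh).

Let D : set M := U `&` (U1 `&` U2).
Let O : set V := cmap c @` (cdom c `&` D).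
Let Ft := F \o cinv c.
Let Yt := Y \o cinv c.
Let Yht := Yh \o cinv c.

Lemma open_common : open D.
Proof. by case: lF lY lYh => oU _ _ [oU1 _ _] [oU2 _ _]; do 2! apply: openI => //. Qed.

Let oO : open O.
Proof. by apply: open_chart_image open_common; exact: atlas_chart. Qed.

Let cinv_in z : O z -> D (cinv c z).
Proof. by have [_ _ K _ _] := atlas_chart ac; move=> [q [qc qD] <-]; rewrite K. Qed.

(** All functions are restricted to the common domain D, on which they can
    be differentiated together. *)
Lemma coord_smooth (p q : nat) (U' : set M) (g : M -> 'M[R]_(p, q)) :
  smooth_fun U' g -> D `<=` U' -> forall k, Ck k O (g \o cinv c).
Proof.
move=> sg DU k; apply: Ck_sub (smooth_fun_chart ac sg k) => _ [p' [pc pD] <-].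
by exists p' => //; split=> //; exact: DU.
Qed.

Let CF : forall k, Ck k O Ft.
Proof. by case: lF => _ sF _; apply: (coord_smooth sF) => p []. Qed.
Let CY : forall k, Ck k O Yt.
Proof. by case: lY => _ sF _; apply: (coord_smooth sF) => p [_ []]. Qed.
Let CYh : forall k, Ck k O Yht.
Proof. by case: lYh => _ sF _; apply: (coord_smooth sF) => p [_ []]. Qed.

Let GF z : O z -> in_G r (Ft z).
Proof. by move=> /cinv_in[Uz _]; case: lF => _ _ /(_ _ Uz)[]. Qed.

Let FP z : O z -> (linfun (mulmx (Ft z)) @: base_plane R n)%VS = (<[Yt z]> + <[Yht z]>)%VS.
Proof.
move=> /cinv_in[Uz [U1z U2z]]; case: lF => _ _ /(_ _ Uz)[_ E].
case: lY => _ _ /(_ _ U1z)[_ E1]; case: lYh => _ _ /(_ _ U2z)[_ E2].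
by rewrite /Ft/= E hfy /Yt /Yht /= E1 E2.
Qed.

Let nY z : O z -> ip (Yt z) (Yt z) = 0.
Proof. by move=> /cinv_in[_ [U1z _]]; exact: (lift_null lY U1z). Qed.
Let nYh z : O z -> ip (Yht z) (Yht z) = 0.
Proof. by move=> /cinv_in[_ [_ U2z]]; exact: (lift_null lYh U2z). Qed.
Let nYYh z : O z -> ip (Yt z) (Yht z) != 0.
Proof. by move=> /cinv_in[_ [U1z U2z]]; exact: (lift_pairing lY lYh U1z U2z). Qed.

Variable p : M.
Hypotheses (pc : cdom c p) (pU : U p) (pU1 : U1 p) (pU2 : U2 p).

Let Op : O (cmap c p). Proof. by exists p. Qed.
Let Kp : cinv c (cmap c p) = p.
Proof. by have [_ _ K _ _] := atlas_chart ac; rewrite K. Qed.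

Lemma alpha_pE a : alpha_p F c a p = Defs.p_part (mc Ft (cmap c p) a).
Proof. by rewrite /alpha_p /alpha /mc /Ft /= Kp. Qed.

Lemma tangent_frame_l a : tproj r.+1 (Y p) (Yh p) (dchart c a Y p) =
  F p *m (alpha_p F c a p *m (invmx (F p) *m Y p)).
Proof.
have := frame_tproj_l oO (fun z => (CF 1%N).1 z) GF Op (fun z => (CY 1%N).1 z) FP nY (nYYh Op) a.
by rewrite alpha_pE /Ft /Yt /Yht /= Kp.
Qed.

Lemma tangent_frame_r a : tproj r.+1 (Yh p) (Y p) (dchart c a Yh p) =
  F p *m (alpha_p F c a p *m (invmx (F p) *m Yh p)).
Proof.
have := frame_tproj_r oO (fun z => (CF 1%N).1 z) GF Op (fun z => (CYh 1%N).1 z) FP nYh (nYYh Op) a.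
by rewrite alpha_pE /Ft /Yt /Yht /= Kp.
Qed.

Lemma alpha_p_in_g a : in_g r (alpha_p F c a p).
Proof.
rewrite alpha_pE; apply: p_part_in_g.
exact: (mc_in_g oO (fun z => (CF 1%N).1 z) GF _ Op).
Qed.

Lemma flat_at_alpha : flat_at r.+1 Yt Yht (cmap c p) <->
  forall a b, lie (alpha_p F c a p) (alpha_p F c b p) = 0.
Proof.
apply: (iff_trans (flat_at_lie oO (fun z => (CF 1%N).1 z) GF Op (fun z => (CY 1%N).1 z)
  (fun z => (CYh 1%N).1 z) FP nY nYh (nYYh Op))).
by split=> h a b; have := h a b; rewrite !alpha_pE.
Qed.

End InChart.

Lemma frame_differentiable (c : chart R M) U F p : atlas c -> local_frame f U F ->
  cdom c p -> U p -> differentiable (F \o cinv c) (cmap c p).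
Proof.
by move=> ac [_ sF _] pc pU; apply: (smooth_fun_chart ac sF 1%N).1; exists p.
Qed.

(** Hence the set of values of the p-part at a point, and whether they
    commute, does not depend on the chart. *)
Lemma alpha_p_change (c d : chart R M) U F p a : atlas c -> atlas d -> local_frame f U F ->
  cdom c p -> cdom d p -> U p -> alpha_p F d a p = alpha_p F c (chart_jacobian c d p a) p.
Proof.
move=> ac ad lF pc pd pU; rewrite /alpha_p /alpha (dchart_change ac ad pc pd)//.
exact: (frame_differentiable ac lF).
Qed.

Lemma alpha_p_lin (c : chart R M) U F p a b t : atlas c -> local_frame f U F ->
  cdom c p -> U p -> alpha_p F c (t *: a + b) p = t *: alpha_p F c a p + alpha_p F c b p.
Proof.
move=> ac lF pc pU; rewrite /alpha_p /alpha /dchart derive_lin; last exact: (frame_differentiable ac lF).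
by rewrite mulmxDr -scalemxAr p_part_linear.
Qed.

Lemma curved_flat_at (c : chart R M) (U1 U2 : set M) Y Yh p : smooth_grass f -> curved_flat f ->
  atlas c -> local_lift y U1 Y -> local_lift yh U2 Yh -> cdom c p -> U1 p -> U2 p ->
  flat_at r.+1 (Y \o cinv c) (Yh \o cinv c) (cmap c p).
Proof.
move=> hf [_ flat] ac lY lYh pc pU1 pU2.
have [U [F [pU lF]]] := hf p.
apply/(flat_at_alpha ac lF lY lYh pc pU pU1 pU2) => a b.
have [A [_ _ comm] inA] := flat U F c p lF ac pU pc.
exact: comm.
Qed.

End Lifts.

(** * Adapted charts of a curved flat *)

Lemma vline_scale (K : fieldType) (vT : vectType K) (a : K) (v : vT) : a != 0 -> (<[a *: v]> = <[v]>)%VS.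
Proof.
move=> a0; apply/subv_anti/andP; split; rewrite -memvE; first by rewrite rpredZ// memv_line.
by rewrite -[v in v \in _](scalerK a0) rpredZ// memv_line.
Qed.

Section Forward.
Context {R : realType} (n r : nat) (M : surface R).
Local Notation V := 'rV[R]_2.
Local Notation W := 'cV[R]_n.+2.
Local Notation ip := (@ip R n.+2 r.+1).
Local Notation d0 := (delta_mx 0 0 : V).
Local Notation d1 := (delta_mx 0 1 : V).

Lemma adapted_pair_ext (U : set V) (y yh y' yh' : V -> W) (s1 s2 : R) : open U ->
  (forall u, U u -> y u = y' u) -> (forall u, U u -> yh u = yh' u) ->
  adapted_pair r.+1 U y yh s1 s2 -> adapted_pair r.+1 U y' yh' s1 s2.
Proof.
move=> oU Ey Eyh ad u Uu.
have near1 (g g' : V -> W) v z : (forall u, U u -> g u = g' u) -> U z -> 'D_v g z = 'D_v g' z.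
  by move=> E Uz; apply: near_eq_derive; exact: (open_nbhs_near oU Uz).
have := ad u Uu.
rewrite (near1 (fun z => 'D_d0 y z) (fun z => 'D_d0 y' z) d0 u (fun z Uz => near1 y y' d0 z Ey Uz) Uu).
rewrite (near1 (fun z => 'D_d1 y z) (fun z => 'D_d1 y' z) d1 u (fun z Uz => near1 y y' d1 z Ey Uz) Uu).
rewrite (near1 y y' d0 u Ey Uu) (near1 y y' d1 u Ey Uu) (near1 yh yh' d0 u Eyh Uu) (near1 yh yh' d1 u Eyh Uu).
by rewrite (Ey u Uu) (Eyh u Uu).
Qed.

Definition adapted_chart (y yh : M -> quadric R n r) (d : chart R M) (Z Zh : M -> W) (s1 s2 : R) : Prop :=
  [/\ atlas d, local_lift y (cdom d) Z, local_lift yh (cdom d) Zh, s1 * s1 = 1 /\ s2 * s2 = 1 &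
      adapted_pair r.+1 (crange d) (Z \o cinv d) (Zh \o cinv d) s1 s2].

(** In any chart the lifts of y and yh are a flat pair; its adapted
    coordinates give a new chart, in the atlas by maximality, and rescaled
    lifts which are smooth on its domain. *)
Lemma curved_flat_adapted_chart (f : M -> lorentz_plane R n r) (y yh : M -> quadric R n r) p0 :
  (forall p : M, lplane (f p) = (qline (y p) + qline (yh p))%VS) ->
  smooth_grass f -> timelike_immersion y -> timelike_immersion yh -> curved_flat f ->
  exists d Z Zh s1 s2, cdom d p0 /\ adapted_chart y yh d Z Zh s1 s2.
Proof.
move=> hfy hf hy hyh cf.
have [[sy _] ly] := hy; have [[syh iyh] _] := hyh.
have [U1 [Y [pU1 lY]]] := sy p0; have [U2 [Yh [pU2 lYh]]] := syh p0.
have [c ac pc] := atlas_cover p0.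
have ic := atlas_chart ac; have [oc orc Kc _ _] := ic.
have [oU1 sY hY] := lY; have [oU2 sYh hYh] := lYh.
pose D : set M := U1 `&` U2.
have oD : open D by exact: openI.
pose O := cmap c @` (cdom c `&` D).
have oO : open O by exact: open_chart_image.
have Op0 : O (cmap c p0) by exists p0.
pose Yt := Y \o cinv c; pose Yht := Yh \o cinv c.
have CY k : Ck k O Yt.
  by apply: Ck_sub (smooth_fun_chart ac sY k) => _ [q [qc [q1 q2]] <-]; exists q.
have CYh k : Ck k O Yht.
  by apply: Ck_sub (smooth_fun_chart ac sYh k) => _ [q [qc [q1 q2]] <-]; exists q.
have nulls x : O x -> [/\ ip (Yt x) (Yt x) = 0, ip (Yht x) (Yht x) = 0 & ip (Yt x) (Yht x) != 0].
  move=> [q [qc [q1 q2]] <-]; rewrite /Yt /Yht /= Kc//.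
  split; [exact: (lift_null lY q1)|exact: (lift_null lYh q2)|exact: (lift_pairing hfy lY lYh q1 q2)].
have flat x : O x -> flat_at r.+1 Yt Yht x.
  by move=> [q [qc [q1 q2]] <-]; exact: (curved_flat_at hfy hf cf ac lY lYh qc q1 q2).
have lor := ly U1 Y c p0 lY ac pU1 pc.
have imm a t : 'D_a Yht (cmap c p0) = t *: Yht (cmap c p0) -> a = 0.
  move=> h; apply: (iyh U2 Yh c p0 a lYh ac pU2 pc).
  by rewrite /dchart h /Yht /= Kc//; apply: rpredZ; exact: memv_line.
have [B [Phi [Psi [la [mu [s1 [s2 [[oB BO' Bx0] [oPB PsiK CPhi CPsi] ss [la0 mu0 Cla Cmu] ad]]]]]]]] :=
  flat_coordinates oO Op0 CY CYh nulls flat lor imm.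
have Bcr : B `<=` crange c by move=> x /BO'[q [qc _] <-]; exact: crange_cmap.
pose d := reparam c B Phi Psi.
have ad_d : atlas d by exact: (atlas_reparam ac oB Bcr oPB PsiK CPhi CPsi).
have crd : crange d = Phi @` B by exact: (crange_reparam Phi Psi ac Bcr).
have dD q : cdom d q -> D q.
  move=> [qc qB]; have [q' [q'c q'D] E] := BO' _ qB.
  by rewrite -(Kc q qc) -E Kc.
pose Z p := la (cmap c p) *: Y p; pose Zh p := mu (cmap c p) *: Yh p.
have PsiB u : (Phi @` B) u -> B (Psi u) by move=> [x Bx <-]; rewrite PsiK.
have ZE u : (Phi @` B) u -> la (Psi u) *: Yt (Psi u) = (Z \o cinv d) u.
  by move=> /PsiB /Bcr /(cinvK ic)[_ h]; rewrite /Z /= h.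
have ZhE u : (Phi @` B) u -> mu (Psi u) *: Yht (Psi u) = (Zh \o cinv d) u.
  by move=> /PsiB /Bcr /(cinvK ic)[_ h]; rewrite /Zh /= h.
have lift_d (u : M -> quadric R n r) (U : set M) (Y0 : M -> W) (l : V -> R) :
    local_lift u U Y0 -> D `<=` U -> (forall x, B x -> l x != 0) -> (forall k, Ck k B l) ->
    (forall k, Ck k O (Y0 \o cinv c)) ->
    local_lift u (cdom d) (fun p => l (cmap c p) *: Y0 p).
  move=> [_ sY0 hY0] DU l0 Cl CY0; split.
  - by have [] := atlas_chart ad_d.
  - apply: chart_smooth_fun => // k; rewrite crd.
    apply: (@Ck_ext _ _ _ _ ((fun x => l x *: (Y0 \o cinv c) x) \o Psi)) => //.
      by move=> v /PsiB /Bcr /(cinvK ic)[_ h] /=; rewrite h.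
    apply: (Ck_comp oPB oB PsiB (CPsi k)).
    exact: (Ck_scale oB (Cl k) (Ck_sub BO' (CY0 k))).
  - move=> q qd; have [qn qE] := hY0 q (DU _ (dD q qd)); have [qc qB] := qd.
    have lq := l0 _ qB; split; first by rewrite scaler_eq0 negb_or lq qn.
    by rewrite -qE; exact: vline_scale.
exists d, Z, Zh, s1, s2; split; first by split.
split=> //.
- by apply: (lift_d y U1 Y la lY) => // q [].
- by apply: (lift_d yh U2 Yh mu lYh) => // q [].
- by rewrite crd; apply: (adapted_pair_ext oPB ZE ZhE ad).
Qed.

End Forward.

(** * Adapted charts give Darboux pairs of isothermic surfaces *)

Section Transport.
Context {R : realType} (m s : nat).
Local Notation W := 'cV[R]_m.
Local Notation ip := (@ip R m s).

Lemma kappa_transport (y y' yu yv y00 y00' y11 y11' y01 y01' : W) (e : R) :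
  kappa_relations s y yu yv y00 y11 y01 e ->
  y = y' -> y00 = y00' -> y11 = y11' -> y01 = y01' ->
  kappa_relations s y' yu yv y00' y11' y01' e.
Proof. by move=> k <- <- <- <-. Qed.

Lemma ip_span4 (k a b c e x : W) : ip k a = 0 -> ip k b = 0 -> ip k c = 0 -> ip k e = 0 ->
  x \in (<[a]> + <[b]> + <[c]> + <[e]>)%VS -> ip k x = 0.
Proof.
move=> h1 h2 h3 h4 /memv_addP[x123 /memv_addP[x12 /memv_addP[_ /vlineP[t1 ->]
  [_ /vlineP[t2 ->] ->]] [_ /vlineP[t3 ->] ->]] [_ /vlineP[t4 ->] ->]].
by rewrite !ipE h1 h2 h3 h4 !mulr0 !addr0.
Qed.

End Transport.

Section AdaptedCharts.
Context {R : realType} (n r : nat) (M : surface R).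
Local Notation V := 'rV[R]_2.
Local Notation W := 'cV[R]_n.+2.
Local Notation ip := (@ip R n.+2 r.+1).
Local Notation d0 := (delta_mx 0 0 : V).
Local Notation d1 := (delta_mx 0 1 : V).
Variables (y yh : M -> quadric R n r) (d : chart R M) (Z Zh : M -> W) (s1 s2 : R).
Hypothesis ad : adapted_chart y yh d Z Zh s1 s2.

Let atl : atlas d. Proof. by case: ad. Qed.
Let ic : is_chart d. Proof. exact: atlas_chart atl. Qed.
Let lZ : local_lift y (cdom d) Z. Proof. by case: ad. Qed.
Let lZh : local_lift yh (cdom d) Zh. Proof. by case: ad. Qed.
Let ss1 : s1 * s1 = 1. Proof. by case: ad => _ _ _ [h _] _. Qed.
Let ss2 : s2 * s2 = 1. Proof. by case: ad => _ _ _ [_ h] _. Qed.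
Let pair : adapted_pair r.+1 (crange d) (Z \o cinv d) (Zh \o cinv d) s1 s2.
Proof. by case: ad. Qed.
Let orc : open (crange d). Proof. by case: ic. Qed.
Let K p : cdom d p -> cinv d (cmap d p) = p. Proof. by case: ic => _ _ h _ _; exact: h. Qed.
Let CZ k : Ck k (crange d) (Z \o cinv d).
Proof.
by case: lZ => _ sZ _; apply: Ck_sub (smooth_fun_chart atl sZ k) => _ [p pd <-]; exists p.
Qed.

Lemma second_derivative_chart (a b : V) p : cdom d p ->
  dchart d a (dchart d b Z) p = 'D_a (fun z => 'D_b (Z \o cinv d) z) (cmap d p).
Proof.
move=> pd; apply: near_eq_derive; apply: (open_nbhs_near orc (crange_cmap pd)) => z zr.
by rewrite /dchart /=; have [_ ->] := cinvK ic zr.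
Qed.

Lemma adapted_chart_canonical : canonical_lift y d Z.
Proof.
split=> // p pd; have [_ [m0 m1 m2] _ _ _] := pair (crange_cmap pd).
  by split; [exact: m0|exact: m1].
exact: m2.
Qed.

(** The functions s_1, s_2 and the vectors kappa_1, kappa_2 are those of
    [kappa_relations]. *)
Lemma adapted_chart_adapted (b : bool) : s1 * s2 = (-1) ^+ b -> adapted b y d Z.
Proof.
move=> sb; split; first exact: adapted_chart_canonical.
pose y00 p := du d (du d Z) p; pose y11 p := dv d (dv d Z) p; pose y01 p := du d (dv d Z) p.
exists (fun p => 4 * ip (y00 p) (y01 p)), (fun p => 4 * ip (y11 p) (y01 p)).
exists (fun p => y00 p + (4 * ip (y00 p) (y01 p) / 2) *: Z p),
       (fun p => y11 p + (4 * ip (y11 p) (y01 p) / 2) *: Z p) => p pd.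
have KZ : (Z \o cinv d) (cmap d p) = Z p by rewrite /= K.
have kappa : kappa_relations r.+1 (Z p) (du d Z p) (dv d Z p) (y00 p) (y11 p) (y01 p) (s1 * s2).
  exact: (kappa_transport (adapted_kappa orc (crange_cmap pd) CZ ss2 pair) KZ
    (esym (second_derivative_chart d0 d0 pd)) (esym (second_derivative_chart d1 d1 pd))
    (esym (second_derivative_chart d0 d1 pd))).
have [[a1 a2 a3 a4] [b1 b2 b3 b4] kk] := kappa.
split.
- by rewrite scaleNr addrC addrK.
- by rewrite scaleNr addrC addrK.
- by move=> x; exact: (ip_span4 a1 a2 a3 a4).
- by move=> x; exact: (ip_span4 b1 b2 b3 b4).
- exact: (etrans kk (congr1 (fun t => t *: _) sb)).
Qed.

Lemma adapted_chart_darboux q : cdom d q ->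
  [/\ ip (Z q) (Zh q) != 0,
      du d Zh q \in (<[Zh q]> + <[Z q]> + <[dv d Z q]>)%VS &
      dv d Zh q \in (<[Zh q]> + <[Z q]> + <[du d Z q]>)%VS].
Proof.
move=> qd; have [[_ _ zz] _ e1 e2 _] := pair (crange_cmap qd).
rewrite /= K// in zz e1 e2.
have span3 (a b c : W) (u v w : R) :
    (u *: (c - v *: b) - w *: a) \in (<[a]> + <[b]> + <[c]>)%VS.
  have -> : u *: (c - v *: b) - w *: a = (- w) *: a + (- (u * v)) *: b + u *: c.
    by apply/matrixP => i j; rewrite !mxE; ring.
  by rewrite !memv_add// rpredZ// memv_line.
split; first by rewrite zz oner_eq0.
  by rewrite /du /dchart e1; exact: span3.
by rewrite /dv /dchart e2; exact: span3.
Qed.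

End AdaptedCharts.

(** * The sign of the isothermic surfaces *)

Lemma same_line (K : fieldType) (vT : vectType K) (u v : vT) : u != 0 -> (<[u]> = <[v]>)%VS ->
  exists2 l, l != 0 & u = l *: v.
Proof.
move=> u0 E; have : u \in <[v]>%VS by rewrite -E memv_line.
move=> /vlineP[l ul]; exists l; last exact: ul.
by apply: contraNneq u0 => l0; rewrite ul l0 scale0r.
Qed.

Section NullDirections.
Context {R : realType} (n r : nat) (M : surface R).
Local Notation V := 'rV[R]_2.
Local Notation W := 'cV[R]_n.+2.
Local Notation ip := (@ip R n.+2 r.+1).
Local Notation d0 := (delta_mx 0 0 : V).
Local Notation d1 := (delta_mx 0 1 : V).

(** The form q has a nontrivial zero at p. Existential over charts and
    lifts, this can be tested in any of them; it is what makes the sign of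
    an adapted chart independent of the chart. *)
Definition null_direction (y yh : M -> quadric R n r) (p : M) : Prop :=
  exists c a (U U' : set M) (Y Yh : M -> W),
    [/\ atlas c /\ cdom c p, local_lift y U Y /\ U p, local_lift yh U' Yh /\ U' p, a != 0 &
        ip (tproj r.+1 (Y p) (Yh p) (dchart c a Y p))
           (tproj r.+1 (Yh p) (Y p) (dchart c a Yh p)) = 0].

Lemma null_direction_sym (y yh : M -> quadric R n r) p :
  null_direction y yh p -> null_direction yh y p.
Proof.
move=> [c [a [U [U' [Y [Yh [h1 h2 h3 h4 h5]]]]]]]; exists c, a, U', U, Yh, Y.
by split=> //; rewrite ipC.
Qed.

(** N_v = v0 N_0 + v1 N_1 and Nh_v = 2 s1 v0 N_1 + 2 s2 v1 N_0, with <N_0,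
    N_0> = <N_1, N_1> = 0 and <N_0, N_1> = 1/2. *)
Lemma adapted_form_algebra (Z Zh Zu Zv Zhu Zhv : W) (s1 s2 v0 v1 : R) :
  ip Z Z = 0 -> ip Z Zh = 1 -> ip Zu Z = 0 -> ip Zv Z = 0 ->
  ip Zu Zu = 0 -> ip Zv Zv = 0 -> ip Zu Zv = 2^-1 ->
  Zhu = (2 * s1) *: (Zv - ip Zv Zh *: Z) - ip Zu Zh *: Zh ->
  Zhv = (2 * s2) *: (Zu - ip Zu Zh *: Z) - ip Zv Zh *: Zh ->
  ip (tproj r.+1 Z Zh (v0 *: Zu + v1 *: Zv)) (tproj r.+1 Zh Z (v0 *: Zhu + v1 *: Zhv))
  = s1 * v0 ^+ 2 + s2 * v1 ^+ 2.
Proof.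
move=> zz zzh zu zv uu vv uv Eu Ev.
have zhz : ip Zh Z = 1 by rewrite ipC.
have Tl : tproj r.+1 Z Zh (v0 *: Zu + v1 *: Zv) =
   v0 *: (Zu - ip Zu Zh *: Z) + v1 *: (Zv - ip Zv Zh *: Z).
  by rewrite /tproj zzh divr1 !ipE; apply/matrixP => i j; rewrite !mxE; ring.
have Tr : tproj r.+1 Zh Z (v0 *: Zhu + v1 *: Zhv) =
   (2 * s1 * v0) *: (Zv - ip Zv Zh *: Z) + (2 * s2 * v1) *: (Zu - ip Zu Zh *: Z).
  have hu : ip Zhu Z = - ip Zu Zh by rewrite Eu !ipE zv zz zhz; ring.
  have hv : ip Zhv Z = - ip Zv Zh by rewrite Ev !ipE zu zz zhz; ring.
  rewrite /tproj zhz divr1 ipDl !ipZl hu hv Eu Ev.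
  by apply/matrixP => i j; rewrite !mxE; ring.
rewrite Tl Tr !ipE [ip Z Zu]ipC [ip Z Zv]ipC [ip Zv Zu]ipC zz zu zv uu vv uv.
by field.
Qed.

Lemma square_one (s : R) : s * s = 1 -> s = 1 \/ s = -1.
Proof. by move=> /eqP; rewrite -expr2 sqrf_eq1 => /orP[]/eqP; [left|right]. Qed.

Section AdaptedForm.
Variables (y yh : M -> quadric R n r) (d : chart R M) (Z Zh : M -> W) (s1 s2 : R).
Hypothesis ad : adapted_chart y yh d Z Zh s1 s2.

Lemma adapted_chart_form p v : cdom d p ->
  ip (tproj r.+1 (Z p) (Zh p) (dchart d v Z p)) (tproj r.+1 (Zh p) (Z p) (dchart d v Zh p))
  = s1 * (v 0 0) ^+ 2 + s2 * (v 0 1) ^+ 2.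
Proof.
case: ad => atl [od sZ hZ] [_ sZh hZh] _ pair pd.
have [_ orc K _ _] := atlas_chart atl.
have Cg (g : M -> W) : smooth_fun (cdom d) g -> forall k, Ck k (crange d) (g \o cinv d).
  by move=> sg k; apply: Ck_sub (smooth_fun_chart atl sg k) => _ [q qd <-]; exists q.
have dg (g : M -> W) : smooth_fun (cdom d) g -> forall x, crange d x -> differentiable (g \o cinv d) x.
  by move=> sg x xd; exact: (Cg g sg 1%N).1.
have cp := crange_cmap pd.
have nZ x : crange d x -> ip ((Z \o cinv d) x) ((Z \o cinv d) x) = 0 by move=> /pair[[]].
have h1 v' := derive_null v' orc cp (dg _ sZ) nZ.
have [[zz _ zzh] [m0 m1 m2] e1 e2 _] := pair _ cp.
rewrite /dchart (derive_coord2 v (dg _ sZ _ cp)) (derive_coord2 v (dg _ sZh _ cp)).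
have KZ : (Z \o cinv d) (cmap d p) = Z p by rewrite /= K.
have KZh : (Zh \o cinv d) (cmap d p) = Zh p by rewrite /= K.
rewrite -KZ -KZh.
exact: (adapted_form_algebra _ _ zz zzh (h1 d0) (h1 d1) m0 m1 m2 e1 e2).
Qed.

(** In an adapted chart q is s1 v0^2 + s2 v1^2. If the signs differ, (1, 1)
    is a zero; if they agree, q is definite. A zero in other charts and
    lifts is transported by a frame of f, in which the tangent vectors are
    given by the p-part of the Maurer-Cartan form and the lifts enter
    linearly. *)
Lemma adapted_chart_sign (f : M -> lorentz_plane R n r) p :
  (forall p : M, lplane (f p) = (qline (y p) + qline (yh p))%VS) -> smooth_grass f ->
  cdom d p -> (null_direction y yh p <-> s1 * s2 = -1).
Proof.
move=> hfy hf pd; have form := adapted_chart_form _ pd; case: (ad) => atl lZ lZh [ss1 ss2] _.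
have [_ _ hZ] := lZ; have [_ _ hZh] := lZh.
split; last first.
  move=> s12; exists d, (d0 + d1), (cdom d), (cdom d), Z, Zh; split=> //.
    apply/eqP => /(congr1 (fun v : V => v 0 0)); rewrite !mxE /= addr0 => /eqP.
    by rewrite oner_eq0.
  rewrite form !mxE /= addr0 add0r expr1n !mulr1.
  have : s1 * (s1 + s2) = 0 by rewrite mulrDr ss1 s12 subrr.
  move/eqP; rewrite mulf_eq0 => /orP[/eqP s10|/eqP //].
  by move: ss1; rewrite s10 mul0r => /eqP; rewrite eq_sym oner_eq0.
move=> [c [a [U [U' [Y [Yh [[ac pc] [lY pU] [lYh pU'] a0 q0]]]]]]].
have [U0 [F [pU0 lF]]] := hf p.
have [_ _ hY] := lY; have [_ _ hYh] := lYh.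
pose v := chart_jacobian d c p a.
have v0 : v != 0 by apply: contra a0 => /eqP h; apply/eqP; exact: (chart_jacobian_inj atl ac pd pc h).
have aE : alpha_p F c a p = alpha_p F d v p by exact: (alpha_p_change a atl ac lF pd pc pU0).
have [Y0 YE] := hY p pU; have [Yh0 YhE] := hYh p pU'.
have [Z0 ZE] := hZ p pd; have [Zh0 ZhE] := hZh p pd.
have [l ln lE] := same_line Y0 (etrans YE (esym ZE)).
have [m mn mE] := same_line Yh0 (etrans YhE (esym ZhE)).
move: q0; rewrite (tangent_frame_l hfy ac lF lY lYh pc pU0 pU pU') (tangent_frame_r hfy ac lF lY lYh pc pU0 pU pU').
rewrite aE lE mE -!scalemxAr.
rewrite -(tangent_frame_l hfy atl lF lZ lZh pd pU0 pd pd) -(tangent_frame_r hfy atl lF lZ lZh pd pU0 pd pd).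
rewrite ipZl ipZr form => /eqP; rewrite !mulf_eq0 (negPf ln) (negPf mn) /= => /eqP q0.
have [h1|h1] := square_one ss1; have [h2|h2] := square_one ss2; rewrite h1 h2 in q0 *; try by ring.
- exfalso; move/eqP: v0; apply; apply/rowP => j; rewrite mxE.
  have := sqr_ge0 (v 0 0); have := sqr_ge0 (v 0 1) => g1 g2.
  by case: (ord2E j) => ->; apply/eqP; rewrite -sqrf_eq0; apply/eqP; lra.
- exfalso; move/eqP: v0; apply; apply/rowP => j; rewrite mxE.
  have := sqr_ge0 (v 0 0); have := sqr_ge0 (v 0 1) => g1 g2.
  by case: (ord2E j) => ->; apply/eqP; rewrite -sqrf_eq0; apply/eqP; lra.
Qed.

End AdaptedForm.

(** By [adapted_chart_sign] the points with a null direction form an open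
    and closed set. *)
Lemma curved_flat_global_sign (f : M -> lorentz_plane R n r) (y yh : M -> quadric R n r) :
  connected [set: M] ->
  (forall p : M, lplane (f p) = (qline (y p) + qline (yh p))%VS) ->
  smooth_grass f -> timelike_immersion y -> timelike_immersion yh -> curved_flat f ->
  (forall p, null_direction y yh p) \/ (forall p, ~ null_direction y yh p).
Proof.
move=> hM hfy hf hy hyh cf.
have loc p : exists U : set M, [/\ open U, U p & forall q, U q -> (null_direction y yh q <-> null_direction y yh p)].
  have [d [Z [Zh [s1 [s2 [pd ad]]]]]] := curved_flat_adapted_chart p hfy hf hy hyh cf.
  exists (cdom d); split=> //; first by case: ad => /atlas_chart[].
  move=> q qd; apply: (iff_trans (adapted_chart_sign ad hfy hf qd)).
  exact: iff_sym (adapted_chart_sign ad hfy hf pd).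
pose A : set M := [set p | null_direction y yh p].
have oA : open A.
  rewrite openE => p Ap; have [U [oU Up UA]] := loc p.
  apply: (filterS _ (open_nbhs_nbhs (conj oU Up))) => q Uq; exact/(UA q Uq).
have cA : closed A.
  rewrite -openC openE => p Ap; have [U [oU Up UA]] := loc p.
  apply: (filterS _ (open_nbhs_nbhs (conj oU Up))) => q Uq /(UA q Uq); exact: Ap.
have [A0|/set0P A0] := eqVneq A set0.
  by right => p Ap; have : A p by []; rewrite A0.
left; have AT : A = [set: M].
  by apply: hM => //; exists A => //; rewrite setTI.
by move=> p; have : [set: M] p by []; rewrite -AT.
Qed.

End NullDirections.

(** * Darboux pairs span curved flats, and the theorem *)

Section Backward.
Context {R : realType} (n r : nat) (M : surface R).
Local Notation V := 'rV[R]_2.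
Local Notation W := 'cV[R]_n.+2.
Local Notation ip := (@ip R n.+2 r.+1).
Local Notation d0 := (delta_mx 0 0 : V).
Local Notation d1 := (delta_mx 0 1 : V).

Lemma tproj_lin (z zh u v : W) (a b : R) :
  tproj r.+1 z zh (a *: u + b *: v) = a *: tproj r.+1 z zh u + b *: tproj r.+1 z zh v.
Proof. by rewrite /tproj !ipE; apply/matrixP => i j; rewrite !mxE; ring. Qed.

(** A linear relation between the derivatives becomes proportionality after
    projecting away the plane; that the coefficient of z is compatible
    follows from zhu being orthogonal to zh. *)
Lemma darboux_tproj (z zh zv zhu : W) : ip z z = 0 -> ip zh zh = 0 -> ip z zh != 0 ->
  ip zv z = 0 -> ip zhu zh = 0 -> zhu \in (<[zh]> + <[z]> + <[zv]>)%VS ->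
  exists g, tproj r.+1 zh z zhu = g *: tproj r.+1 z zh zv.
Proof.
move=> zz zhzh zzh zvz hu /memv_addP[_ /memv_addP[_ /vlineP[a ->] [_ /vlineP[b ->] ->]] [_ /vlineP[g ->] E]].
exists g; have h : b * ip z zh = - (g * ip zv zh).
  by apply/eqP; rewrite -addr_eq0; apply/eqP; move: hu; rewrite E !ipE zhzh mulr0 add0r.
have gb : g * (ip zv zh / ip z zh) = - b.
  by rewrite mulrA -[g * _]opprK -h mulNr mulfK.
have -> : tproj r.+1 zh z zhu = b *: z + g *: zv.
  rewrite /tproj E !ipE zz zvz !mulr0 !addr0 [ip zh z]ipC mulfK//.
  by apply/matrixP => i j; rewrite !mxE; ring.
by rewrite /tproj scalerBr scalerA gb scaleNr opprK addrC.
Qed.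

(** The equations of flatness are bilinear and alternating in the two
    tangent vectors, and N0, N1 being null removes the terms that do not
    cancel. *)
Lemma flat_vec_null (z zh N0 N1 : W) (a0 a1 b0 b1 g0 g1 : R) : ip N0 N0 = 0 -> ip N1 N1 = 0 ->
  flat_vec r z zh (a0 *: N0 + a1 *: N1) (b0 *: N0 + b1 *: N1)
    (a0 *: (g0 *: N1) + a1 *: (g1 *: N0)) (b0 *: (g0 *: N1) + b1 *: (g1 *: N0)).
Proof.
move=> n0 n1; split=> [|w _ _].
  by rewrite !ipE [ip N1 N0]ipC n0 n1; ring.
by rewrite !ipE; apply/matrixP => i j; rewrite !mxE; ring.
Qed.

Variables (f : M -> lorentz_plane R n r) (y yh : M -> quadric R n r).
Hypotheses (hfy : forall p : M, lplane (f p) = (qline (y p) + qline (yh p))%VS)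
  (hf : smooth_grass f) (hy : timelike_immersion y) (hyh : timelike_immersion yh).

(** Where the p-part vanishes the derivative of Y is a multiple of Y by
    [tangent_frame_l], which is excluded by y being an immersion. *)
Lemma plane_immersion : immersion_grass f.
Proof.
split=> // U F c p a lF ac pU pc al0.
have [[sy iy] _] := hy; have [[syh _] _] := hyh.
have [U1 [Y [pU1 lY]]] := sy p; have [U2 [Yh [pU2 lYh]]] := syh p.
apply: (iy U1 Y c p a lY ac pU1 pc).
have := tangent_frame_l hfy ac lF lY lYh pc pU pU1 pU2 a.
rewrite al0 mul0mx mulmx0 => /tproj_eq0[t ->].
by apply: rpredZ; exact: memv_line.
Qed.

(** By [darboux_tproj] the projected derivatives of both lifts are, in
    asymptotic coordinates, combinations as in [flat_vec_null]. *)
Lemma darboux_flat_at (d : chart R M) (Z Zh : M -> W) p :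
  canonical_lift y d Z -> local_lift yh (cdom d) Zh ->
  (forall q, cdom d q -> [/\ ip (Z q) (Zh q) != 0,
     du d Zh q \in (<[Zh q]> + <[Z q]> + <[dv d Z q]>)%VS &
     dv d Zh q \in (<[Zh q]> + <[Z q]> + <[du d Z q]>)%VS]) ->
  cdom d p -> flat_at r.+1 (Z \o cinv d) (Zh \o cinv d) (cmap d p).
Proof.
move=> [atl lZ asy _] lZh dar pd.
have [_ orc K _ _] := atlas_chart atl.
have dg (g : M -> W) : smooth_fun (cdom d) g -> forall x, crange d x -> differentiable (g \o cinv d) x.
  move=> sg x [q qd <-]; apply: (smooth_fun_chart atl sg 1%N).1.
  by exists q.
have cp := crange_cmap pd; have [_ sZ _] := lZ; have [_ sZh _] := lZh.
have nl (u : M -> quadric R n r) (X : M -> W) : local_lift u (cdom d) X -> forall x, crange d x ->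
    ip ((X \o cinv d) x) ((X \o cinv d) x) = 0.
  by move=> lX _ [q qd <-] /=; rewrite K//; exact: (lift_null lX qd).
have zz := nl y Z lZ _ cp; have zhzh := nl yh Zh lZh _ cp.
have zv v := derive_null v orc cp (dg _ sZ) (nl y Z lZ).
have zhv v := derive_null v orc cp (dg _ sZh) (nl yh Zh lZh).
have [zzh du1 dv1] := dar p pd; have [asu asv] := asy p pd.
have KZ : (Z \o cinv d) (cmap d p) = Z p by rewrite /= K.
have KZh : (Zh \o cinv d) (cmap d p) = Zh p by rewrite /= K.
rewrite -KZ -KZh in zzh du1 dv1.
have [g0 G0] := darboux_tproj zz zhzh zzh (zv d1) (zhv d0) du1.
have [g1 G1] := darboux_tproj zz zhzh zzh (zv d0) (zhv d1) dv1.
have n0 := etrans (ip_tproj ((Zh \o cinv d) (cmap d p)) zz (zv d0) (zv d0)) asu.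
have n1 := etrans (ip_tproj ((Zh \o cinv d) (cmap d p)) zz (zv d1) (zv d1)) asv.
move=> a b N Nh.
have NE v : N v = v 0 0 *: N d0 + v 0 1 *: N d1.
  by rewrite /N (derive_coord2 v (dg _ sZ _ cp)) tproj_lin.
have NhE v : Nh v = v 0 0 *: (g0 *: N d1) + v 0 1 *: (g1 *: N d0).
  rewrite /Nh (derive_coord2 v (dg _ sZh _ cp)) tproj_lin.
  exact: (congr2 (fun A B => v 0 0 *: A + v 0 1 *: B) G0 G1).
rewrite (NhE a) (NhE b) (NE a) (NE b).
exact: (flat_vec_null _ _ (a 0 0) (a 0 1) (b 0 0) (b 0 1) g0 g1 n0 n1).
Qed.

(** The values of the p-part in the two coordinate directions of an adapted
    chart span the Abelian subalgebra; in any other chart the p-part takes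
    the same values. *)
Lemma darboux_curved_flat (b : bool) : darboux_transform b y yh -> curved_flat f.
Proof.
move=> [_ _ dar]; split; first exact: plane_immersion.
move=> U F c p lF ac pU pc.
have [d [Z [Zh [pd [cZ _] lZh rel]]]] := dar p.
have [atl lZ _ _] := cZ.
have fl := darboux_flat_at cZ lZh rel pd.
have comm := (flat_at_alpha hfy atl lF lZ lZh pd pU pd pd).1 fl.
have gd v := alpha_p_in_g atl lF lZ lZh pd pU pd pd v.
have alin a a' t := alpha_p_lin a a' t atl lF pd pU.
pose A : {vspace 'M[R]_n.+2} := (<[alpha_p F d d0 p]> + <[alpha_p F d d1 p]>)%VS.
have A0 : alpha_p F d 0 p = 0.
  have := alin 0 0 1; rewrite scaler0 addr0 scale1r => /eqP.
  by rewrite -subr_eq0 opprD addrA subrr sub0r oppr_eq0 => /eqP.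
have aZ t a : alpha_p F d (t *: a) p = t *: alpha_p F d a p.
  by rewrite -[t *: a]addr0 alin A0 addr0.
have AP X : X \in A -> exists v, X = alpha_p F d v p.
  move=> /memv_addP[_ /vlineP[s ->] [_ /vlineP[t ->] ->]].
  by exists (s *: d0 + t *: d1); rewrite alin aZ.
exists A; first split.
- by move=> X /AP[v ->].
- by move=> X X' /AP[v ->] /AP[v' ->]; rewrite comm mem0v.
- by move=> X X' /AP[v ->] /AP[v' ->]; exact: comm.
move=> a; rewrite (alpha_p_change a atl ac lF pd pc pU).
rewrite [chart_jacobian _ _ _ _]rV2E alin aZ.
by apply: memv_add; apply: rpredZ; exact: memv_line.
Qed.

End Backward.

Theorem theorem4p6 (R : realType) (n r : nat)
    (hr : (1 <= r)%N) (hnr : (2 <= n - r)%N)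
    (M : surface R) (hM : connected [set: M])
    (f : M -> lorentz_plane R n r) (y yh : M -> quadric R n r)
    (hf : smooth_grass f)
    (hfy : forall p : M, lplane (f p) = (qline (y p) + qline (yh p))%VS)
    (hy : timelike_immersion y) (hyh : timelike_immersion yh) :
  curved_flat f <->
  exists b : bool,
    [/\ isothermic b y, isothermic b yh & darboux_transform b y yh].
Proof.
split=> [cf|[b [_ _ dar]]]; last exact: (darboux_curved_flat hfy hf hy hyh dar).
have hfy' p : lplane (f p) = (qline (yh p) + qline (y p))%VS by rewrite hfy addvC.
(* the sign is (-) where the form q is indefinite *)
have [b bP] : exists b : bool, forall p, null_direction y yh p <-> b.
  have [h|h] := curved_flat_global_sign hM hfy hf hy hyh cf.
    by exists true => p; split => // _; exact: h.
  by exists false => p; split => // np; case: (h p).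
have sign (u v : M -> quadric R n r) d Z Zh s1 s2 p :
    (forall p : M, lplane (f p) = (qline (u p) + qline (v p))%VS) ->
    (null_direction u v p <-> b) -> adapted_chart u v d Z Zh s1 s2 -> cdom d p ->
    s1 * s2 = (-1) ^+ b.
  move=> huv bp ad pd; have sg := adapted_chart_sign ad huv hf pd.
  have [_ _ _ [ss1 ss2] _] := ad.
  have [h|h] : s1 * s2 = 1 \/ s1 * s2 = -1 by apply: square_one; rewrite mulrACA ss1 ss2 mulr1.
    case: (boolP b) => [bt|_]; last exact: h.
    have := sg.1 (bp.2 bt); rewrite h => /eqP.
    by rewrite -subr_eq0 opprK -mulr2n pnatr_eq0.
  by rewrite (bp.1 (sg.2 h)) h.
have bP' p : null_direction yh y p <-> b.
  by split=> [/null_direction_sym|bt]; [move/bP|apply: null_direction_sym; exact/bP].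
have iso (u v : M -> quadric R n r) :
    (forall p : M, lplane (f p) = (qline (u p) + qline (v p))%VS) ->
    (forall p, null_direction u v p <-> b) ->
    timelike_immersion u -> timelike_immersion v -> isothermic b u.
  move=> huv hb hu hv; split=> // p.
  have [d [Z [Zh [s1 [s2 [pd ad]]]]]] := curved_flat_adapted_chart p huv hf hu hv cf.
  exists d, Z; split=> //; apply: (adapted_chart_adapted ad).
  exact: (sign u v d Z Zh s1 s2 p huv (hb p) ad pd).
exists b; split.
- exact: (iso y yh hfy bP hy hyh).
- exact: (iso yh y hfy' bP' hyh hy).
split=> //; first exact: (iso y yh hfy bP hy hyh).
move=> p; have [d [Z [Zh [s1 [s2 [pd ad]]]]]] := curved_flat_adapted_chart p hfy hf hy hyh cf.
exists d, Z, Zh; split=> //.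
- apply: (adapted_chart_adapted ad).
  exact: (sign y yh d Z Zh s1 s2 p hfy (bP p) ad pd).
- by case: ad.
- by move=> q qd; exact: (adapted_chart_darboux ad qd).
Qed.
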